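(* Let $H\subset\mathbb{R}^N$ be an open affine half space, let $Q:\mathbb{R}^N\to\mathbb{R}^N$ be the reflection at $\partial H$, and write $\bar x=Q(x)$. Let $J:\mathbb{R}^N\setminus\{0\}\to[0,\infty)$ be a measurable, even function ($J(-z)=J(z)$) such that $(J1)$ $\int_{\mathbb{R}^N\setminus B_1(0)}J(z)\,dz+\int_{B_1(0)}|z|^2J(z)\,dz<\infty$ and $\int_{\mathbb{R}^N}J(z)\,dz=\infty$; $J(\bar x-\bar y)=J(x-y)$ for all $x,y\in\mathbb{R}^N$ with $x\ne y$; $J(x-y)>J(x-\bar y)$ for all $x,y\in H$ with $x\neq y$. Let $U\subset H$ be an open bounded set and $c\in L^\infty(U)$. Let $v$ be an antisymmetric supersolution of the problem $$Iv=c(x)v\ \text{ in }U,\qquad v\equiv0\ \text{ on }H\setminus U$$ such that $v\ge0$ a.e. in $H$. Then either $v\equiv0$ a.e. in $\mathbb{R}^N$, or $\operatorname{ess\,inf}_Kv>0$ for every compact subset $K\subset U$.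
   Context: Functions are identified when they agree almost everywhere; the essential infimum over a null set is $+\infty$. Put $$\mathcal{J}(u,v)=\frac12\int_{\mathbb{R}^N}\int_{\mathbb{R}^N}(u(x)-u(y))(v(x)-v(y))J(x-y)\,dx\,dy.$$ For open $U\subset\mathbb{R}^N$, $\mathcal{D}(U)=\{u:\mathbb{R}^N\to\mathbb{R}\text{ measurable}:\mathcal{J}(u,u)<\infty,\ u\equiv0\text{ on }\mathbb{R}^N\setminus U\}$; for bounded open $U$ one has $\mathcal{D}(U)\subset L^2(\mathbb{R}^N)$. For measurable $U'\subset\mathbb{R}^N$, $\mathcal{H}(U')$ is the space of all $v\in L^2(\mathbb{R}^N)$ with $\int_{U'}\int_{U'}(v(x)-v(y))^2J(x-y)\,dx\,dy<\infty$. A function $v:\mathbb{R}^N\to\mathbb{R}$ is antisymmetric if $v(\bar x)=-v(x)$ for $x\in\mathbb{R}^N$. For an open bounded set $U\subset H$ and $c\in L^\infty(U)$, an antisymmetric function $v:\mathbb{R}^N\to\mathbb{R}$ is called an antisymmetric supersolution of the problem $Iv=c(x)v$ in $U$, $v\equiv0$ on $H\setminus U$, if $v\in\mathcal{H}(U')$ for some open bounded set $U'\subset\mathbb{R}^N$ with $Q(U')=U'$ and $\overline U\subset U'$, $v\ge0$ on $H\setminus U$, and $$\mathcal{J}(v,\varphi)\ge\int_Uc(x)v(x)\varphi(x)\,dx\qquad\text{for all }\varphi\in\mathcal{D}(U),\ \varphi\ge0.$$ (The double integral defining $\mathcal{J}(v,\varphi)$ converges absolutely for such $v$ and $\varphi$.)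 *)

(* Defs.v *)
From HB Require Import structures.
From mathcomp Require Import all_boot all_order all_algebra.
From mathcomp Require Import all_classical all_reals all_analysis.
From mathcomp Require Import ess_sup_inf.
Import numFieldNormedType.Exports.
Import Order.TTheory GRing.Theory Num.Theory.
Set Implicit Arguments.
Unset Strict Implicit.
Unset Printing Implicit Defensive.
Local Open Scope classical_set_scope.
Local Open Scope ring_scope.

(* The library has no Lebesgue measure on R^n: it is built here, on the full
   (complete) Lebesgue sigma-algebra, by Caratheodory's method from the outer
   measure defined by countable covers with half-open boxes. The
   dimension is N.+1: in dimension 0 the empty set would not get measure 0. *)
Section lebesgue_Rn.
Context {R : realType} {N : nat}.
Local Notation E := 'rV[R]_N.+1.

Definition box (p : E * E) : set E :=
  [set x | forall i, p.1 0 i < x 0 i <= p.2 0 i].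

Definition box_vol (p : E * E) : R :=
  \prod_(i < N.+1) Num.max 0 (p.2 0 i - p.1 0 i).

Definition leb (A : set E) : \bar R :=
  ereal_inf [set (\sum_(k <oo) (box_vol (B k))%:E)%E |
             B in [set B : nat -> E * E | A `<=` \bigcup_k box (B k)]].

Local Open Scope ereal_scope.

Lemma box_vol_ge0 p : 0 <= (box_vol p)%:E.
Proof. by rewrite lee_fin; apply: prodr_ge0 => i _; rewrite le_max lexx. Qed.

Lemma leb_ge0 A : 0 <= leb A.
Proof.
apply: le_ereal_inf_tmp => _ [B _ <-].
by apply: nneseries_ge0 => k _ _; exact: box_vol_ge0.
Qed.

Lemma leb0 : leb set0 = 0.
Proof.
apply/eqP; rewrite eq_le leb_ge0 andbT.
apply: ereal_inf_lbound; exists (fun=> (0, 0)%R); first exact: sub0set.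
apply: eseries0 => k _ _; rewrite /box_vol /= (bigD1 ord0)//=.
by rewrite !mxE subrr maxxx mul0r.
Qed.

Lemma le_leb : {homo leb : A B / A `<=` B >-> A <= B}.
Proof.
move=> A B AB; apply/ereal_inf_le_tmp => _ [C BC <-].
by exists C => //; exact: subset_trans BC.
Qed.

Lemma leb_sigma_subadditive : sigma_subadditive leb.
Proof.
move=> A; have [[i ioo]|] := pselect (exists i, leb (A i) = +oo).
  rewrite (eseries_pinfty _ _ ioo) ?leey// => n _.
  by rewrite -ltNye (lt_le_trans _ (leb_ge0 _)).
rewrite -forallNE => Aoo.
suff add2e (e : {posnum R}) :
    leb (\bigcup_n A n) <= \sum_(i <oo) leb (A i) + e%:num%:E.
  by apply/lee_addgt0Pr => _/posnumP[].
rewrite (le_trans _ (epsilon_trick _ _ _))//; last first.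
  by move=> n; exact: leb_ge0.
pose P n (B : nat -> E * E) := A n `<=` \bigcup_k box (B k) /\
  \sum_(k <oo) (box_vol (B k))%:E <= leb (A n) + (e%:num / (2 ^ n.+1)%:R)%:E.
have [G PG] : {G : nat -> nat -> E * E & forall n, P n (G n)}.
  apply: (@choice _ _ P) => n; rewrite /P /leb.
  set S := (X in ereal_inf X); move infS : (ereal_inf S) => iS.
  case: iS infS => [r Sr|Soo|Soo].
  - have en1 : (0 < e%:num / (2 ^ n.+1)%:R)%R by [].
    have /(lb_ereal_inf_adherent en1) : ereal_inf S \is a fin_num by rewrite Sr.
    move=> [x [B AnB muBx] xS].
    by exists B; split => //; rewrite muBx -Sr; exact/ltW.
  - by have := Aoo n; rewrite /leb Soo.
  - suff : lbound S 0 by move/le_ereal_inf_tmp; rewrite Soo.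
    by move=> /= _ [B _ <-]; apply: nneseries_ge0 => k _ _; exact: box_vol_ge0.
pose vG (x : nat * nat) := (box_vol (G x.1 x.2))%:E.
have vG_ge0 x : 0 <= vG x by exact: box_vol_ge0.
apply: (@le_trans _ _ (\esum_(i in setT) vG i)).
  rewrite /leb; apply: ereal_inf_lbound => /=.
  have /card_esym/ppcard_eqP[f] := card_nat2.
  exists (fun k => G (f k).1 (f k).2).
    move=> t [i _ /((PG i).1 t) [j _ Bijt]].
    by exists (f^-1%FUN (i, j)) => //=; rewrite invK ?inE.
  rewrite -[LHS](esum_pred_image vG f xpredT) ?[fun=> _]set_true//.
  by rewrite image_eq.
rewrite (_ : esum _ _ = \sum_(i <oo) \sum_(j <oo) vG (i, j)); last first.
  pose J : nat -> set (nat * nat) := fun i => [set (i, j) | j in setT].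
  rewrite (_ : setT = \bigcup_k J k); last first.
    by rewrite predeqE => -[a b]; split => // _; exists a => //; exists b.
  rewrite esum_bigcupT /=; last 2 first.
    - apply/trivIsetP => i j _ _ ij.
      rewrite predeqE => -[n m] /=; split => //= -[] [_] _ [<-{n} _].
      by move=> [m' _] [] /esym/eqP; rewrite (negbTE ij).
    - by move=> /= nm; exact: vG_ge0.
  rewrite -(image_id [set: nat]) -fun_true esum_pred_image//; last first.
    by move=> n _; exact: esum_ge0.
  apply: eq_eseriesr => /= j _.
  rewrite -(esum_pred_image vG (pair j) predT)//=; last first.
    by move=> ? ? _ _; exact: (@can_inj _ _ _ snd).
  by congr esum; rewrite predeqE => -[a b]; split; move=> [i _ <-]; exists i.
apply: lee_lim.
- apply: is_cvg_nneseries => n *.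
  by apply: nneseries_ge0 => m *; exact: (vG_ge0 (n, m)).
- by apply: is_cvg_nneseries => n *; apply: adde_ge0 => //; exact: leb_ge0.
- by near=> n; apply: lee_sum => i _; exact: (PG i).2.
Unshelve. all: by end_near. Qed.

HB.instance Definition _ := isOuterMeasure.Build R E leb
  leb0 leb_ge0 le_leb leb_sigma_subadditive.

HB.instance Definition _ := @isMeasurable.Build (caratheodory_display leb)
  E leb.-caratheodory
  (caratheodory_measurable_set0 leb)
  (@caratheodory_measurable_setC _ _ leb)
  (@caratheodory_measurable_bigcup _ _ leb).

HB.instance Definition _ := isMeasure.Build _ E R leb
  leb0 leb_ge0 (@caratheodory_measure_sigma_additive R E leb).

End lebesgue_Rn.

Section nonlocal.
Context {R : realType} {N : nat}.
Local Notation E := 'rV[R]_N.+1.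

Definition dotv (x y : E) : R := \sum_i x 0 i * y 0 i.

(* `|x| is the library's sup norm; this is the Euclidean one. *)
Definition enorm (x : E) : R := Num.sqrt (dotv x x).

(* e is meant to be a unit vector in the next two definitions. *)
Definition half_space (e : E) (l : R) : set E := [set x | l < dotv x e].

Definition reflection (e : E) (l : R) (x : E) : E :=
  x - (2 * (dotv x e - l)) *: e.

Definition unit_ball : set E := [set z | enorm z < 1].

(* Kernels are total functions; the value at 0 is irrelevant: it is integrated
   over a null set only, or multiplied by 0. *)
Definition J1 (J : E -> R) : Prop :=
  (\int[leb]_(z in ~` unit_ball) (J z)%:E
     + \int[leb]_(z in unit_ball) (enorm z ^+ 2 * J z)%:E < +oo)%E
  /\ (\int[leb]_z (J z)%:E = +oo)%E.

Definition calJ (J : E -> R) (u v : E -> R) : \bar R :=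
  ((2^-1)%:E * \int[leb]_y \int[leb]_x
     ((u x - u y) * (v x - v y) * J (x - y))%:E)%E.

Definition calD (J : E -> R) (U : set E) (u : E -> R) : Prop :=
  [/\ measurable_fun setT u,
      (calJ J u u < +oo)%E &
      \forall x \ae leb, ~ U x -> u x = 0].

Definition L2 (u : E -> R) : Prop :=
  measurable_fun setT u /\ finite_norm leb 2%:E u.

Definition Linfty (U : set E) (c : E -> R) : Prop :=
  measurable_fun U c /\ finite_norm leb +oo%E (c \_ U).

Definition calH (J : E -> R) (U' : set E) (v : E -> R) : Prop :=
  L2 v /\
  (\int[leb]_(y in U') \int[leb]_(x in U')
     ((v x - v y) ^+ 2 * J (x - y))%:E < +oo)%E.

Definition antisymmetric_fun (Q : E -> E) (v : E -> R) : Prop :=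
  \forall x \ae leb, v (Q x) = - v x.

(* Functions are identified when they agree almost everywhere, so all pointwise
   conditions on v and phi are almost everywhere conditions. The equation
   I v = c v is only ever meant in the weak sense below. *)
Definition antisym_supersolution (J : E -> R) (H : set E) (Q : E -> E)
    (U : set E) (c v : E -> R) : Prop :=
  [/\ antisymmetric_fun Q v,
      exists U' : set E, [/\ open U', bounded_set U', Q @` U' = U',
        closure U `<=` U' & calH J U' v],
      \forall x \ae leb, (H `\` U) x -> 0 <= v x &
      forall phi : E -> R, calD J U phi ->
        (\forall x \ae leb, 0 <= phi x) ->
        (\int[leb]_(x in U) (c x * v x * phi x)%:E <= calJ J v phi)%E].

(* extending by +oo off K makes the essential infimum over a null set +oo *)
Definition ess_inf_on (K : set E) (v : E -> R) : \bar R :=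
  ess_inf leb (patch (fun=> +oo%E) K (EFin \o v)).

End nonlocal.

(* Main.v *)
Require Import Defs.
From HB Require Import structures.
From mathcomp Require Import all_boot all_order all_algebra.
From mathcomp Require Import all_classical all_reals all_analysis.
From mathcomp Require Import measurable_realfun ess_sup_inf lra ring.
Import numFieldNormedType.Exports.
Import Order.TTheory GRing.Theory Num.Theory.
Set Implicit Arguments.
Unset Strict Implicit.
Unset Printing Implicit Defensive.
Local Open Scope classical_set_scope.
Local Open Scope ring_scope.

(** Let [f] be a bump with compact support in [U], [tau] a small number, and test
    the inequality for [v] with the truncation [phi], the positive part of
    [tau * f - v] on the set where [f] is positive. In [H], [tau * f <= v] holds
    exactly where [phi] vanishes. Let [G] be the positive part of [v - tau * f] in
    [H] and [Q] the reflection. Since [v] is antisymmetric and nonnegative in [H],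
    [phi x * (v x - v y)] is at most [phi x] times

      [(phi y - phi x) + tau * (f x - f y) - G y + G (Q y) + tau * f (Q y)].

    Integrate this against [J (x - y)]. The first difference symmetrizes to minus
    an energy, which is dropped. The two terms with [f] are of order
    [tau * \int phi]: in the first, [energy_le_of_second_difference] replaces
    differences of [f] by second differences, which a Levy kernel integrates; in
    the second, [Q y] lies in the support of [f], so [y] is far from [x]. In the
    terms with [G] the substitution of [Q y] for [y] produces the kernel
    [J (x - y) - J (x - Q y)], which is positive on [H]. The weak inequality
    together with the boundedness of [c] thus gives, by [excess_inequality],

      [\int\int phi x * G y * (J (x - y) - J (x - Q y)) <= A * tau * \int phi]

    with [A] independent of [tau]. It is used twice. If [v] vanished on a set of
    positive measure in the bump, then [phi = tau * f] there; dividing by [tau] and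
    letting [tau] tend to [0] forces [v = 0] in [H] ([ae_positive_of_nonzero]).
    Otherwise [v] is positive almost everywhere in the bump, hence larger than some
    [delta] off a set of small measure, so that [G >= delta / 2] there for small
    [tau]. As [J] is not integrable at the origin while [J (x - Q y)] stays under
    control, the left-hand side is at least [delta / 2 * \int phi], and
    [\int phi = 0] once [A * tau] is small ([lower_bound_of_positive]). Hence [v]
    is bounded below near every point of [U], and a finite cover of the compact set
    concludes.

    The measure theory behind this concerns the complete Lebesgue sigma-algebra,
    for which addition need not be measurable on pairs. Kernels are thus replaced
    by Borel ones ([kernel_modification]). That the reflection preserves measure
    follows from the uniqueness up to a constant of translation-invariant measures,
    the constant being [1] for an involution ([leb_preserving_involution]). *)

(** * Half-spaces, boxes and the Borel sigma-algebra *)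

Section lebesgue_measure_Rn.
Context {R : realType} {N : nat}.
Local Notation E := 'rV[R]_N.+1.

Lemma leb_box_le (p : E * E) : (leb (box p) <= (box_vol p)%:E)%E.
Proof.
apply: ereal_inf_lbound => /=.
exists (fun k => if k == 0%N then p else (0, 0)); first by move=> x px; exists 0%N.
rewrite (@nneseries_split _ _ 0 1) => [|k _]; last exact: box_vol_ge0.
rewrite add0n big_nat1 eqxx eseries0 ?adde0// => -[|k] //= _ _.
rewrite /box_vol/= (bigD1 ord0)//=.
by rewrite !mxE subrr maxxx mul0r.
Qed.

(** With [box_vol_split]: cutting a box along a coordinate hyperplane leaves the
    total volume unchanged, which is what Caratheodory's criterion asks of the
    half-spaces. *)
Definition set_coord (x : E) (i : 'I_N.+1) (a : R) : E :=
  \row_j (if j == i then a else x 0 j).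

Lemma box_vol_split (p : E * E) i (a : R) :
  box_vol (p.1, set_coord p.2 i (Num.min (p.2 0 i) a)) +
  box_vol (set_coord p.1 i (Num.max (p.1 0 i) a), p.2) = box_vol p.
Proof.
rewrite /box_vol (bigD1 i)//= [X in _ + X](bigD1 i)//= [RHS](bigD1 i)//=.
rewrite !mxE eqxx.
set P := \prod_(_ < _ | _) _.
rewrite (_ : \prod_(_ < _ | _) _ = P); last first.
  by apply: eq_bigr => j /negbTE ji; rewrite !mxE ji.
set P' := \prod_(_ < _ | _) _.
rewrite (_ : P' = P); last first.
  by apply: eq_bigr => j /negbTE ji; rewrite !mxE ji.
rewrite -mulrDl; congr (_ * _).
set u := p.2 0 i; set l := p.1 0 i.
rewrite /Num.max /Num.min.
by repeat case: ifPn; rewrite -?leNgt; lra.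
Qed.

Lemma measurable_halfspace (i : 'I_N.+1) (a : R) :
  measurable [set x : E | x 0 i <= a].
Proof.
apply: le_caratheodory_measurable => X.
apply: le_ereal_inf_tmp => _ [B XB <-].
pose B1 k := ((B k).1, set_coord (B k).2 i (Num.min ((B k).2 0 i) a)).
pose B2 k := (set_coord (B k).1 i (Num.max ((B k).1 0 i) a), (B k).2).
rewrite [leRHS](_ : _ = \sum_(k <oo) (box_vol (B1 k))%:E +
    \sum_(k <oo) (box_vol (B2 k))%:E)%E; last first.
  rewrite -nneseriesD//; [|move=> *; exact: box_vol_ge0..].
  by apply: eq_eseriesr => k _; rewrite -EFinD box_vol_split.
apply: leeD; apply: ereal_inf_lbound => /=.
- exists B1 => // x [Xx /= xa].
  have [k _ Bkx] := XB _ Xx; exists k => // j; rewrite /= !mxE.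
  have := Bkx j; case: eqP => // -> /andP[-> /=].
  by rewrite le_min xa andbT.
- exists B2 => // x [Xx /= /negP]; rewrite -ltNge => xa.
  have [k _ Bkx] := XB _ Xx; exists k => // j; rewrite /= !mxE.
  have := Bkx j; case: eqP => // -> /andP[+ ->].
  by rewrite gt_max xa !andbT.
Qed.

(** The generators of the Borel sigma-algebra, for which addition is measurable on
    pairs, as it need not be for the complete one. *)
Definition halfspaces : set (set E) :=
  [set A | exists (i : 'I_N.+1) (a : R), A = [set x : E | x 0 i <= a]].

Definition borel := g_sigma_algebraType halfspaces.

Lemma measurable_borel_leb (A : set E) :
  measurable (A : set borel) -> measurable A.
Proof.
apply: smallest_sub; first exact: sigma_algebra_measurable.
by move=> _ [i [a ->]]; exact: measurable_halfspace.
Qed.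

Lemma measurable_borel_coord (i : 'I_N.+1) :
  measurable_fun [set: borel] (fun x : borel => x 0 i).
Proof.
move=> _; apply: (measurability _ (RGenOInfty.measurableE R)) => //.
move=> _ [_ [a ->] <-]; rewrite setTI.
rewrite (_ : _ @^-1` _ = ~` [set x : E | x 0 i <= a]).
  by apply: measurableC; apply: sub_sigma_algebra; exists i, a.
apply/seteqP; split => x /=; rewrite in_itv/= andbT ltNge; first by move/negP.
by move/negP.
Qed.

Lemma measurable_fun_borel d (T : measurableType d) (f : T -> E) :
  (forall i, measurable_fun [set: T] (fun t => f t 0 i)) ->
  measurable_fun [set: T] (f : T -> borel).
Proof.
move=> mf; apply: (@measurability _ _ _ borel setT f halfspaces) => //.
move=> _ [_ [i [a ->]] <-]; rewrite setTI.
rewrite (_ : _ @^-1` _ = (fun t => f t 0 i) @^-1` `]-oo, a]%classic).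
  by rewrite -[X in measurable X]setTI; exact: mf.
by apply/seteqP; split => x /=; rewrite in_itv.
Qed.

Lemma measurable_id_borel : measurable_fun [set: E] (id : E -> borel).
Proof. by move=> _ A mA; rewrite setTI; exact: measurable_borel_leb. Qed.

Lemma measurable_coord (i : 'I_N.+1) :
  measurable_fun [set: E] (fun x : E => x 0 i).
Proof.
exact: (measurableT_comp (measurable_borel_coord i) measurable_id_borel).
Qed.

Lemma borel_opp (A : set borel) :
  measurable A -> measurable ([set x : E | A (- x)] : set borel).
Proof.
move=> mA; rewrite -[X in measurable X]setTI.
apply: (@measurable_fun_borel _ borel (fun x : E => - x)) => // i.
under eq_fun do rewrite mxE.
by apply: measurable_funN; exact: measurable_borel_coord.
Qed.

Lemma borel_box (p : E * E) : measurable (box p : set borel).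
Proof.
rewrite (_ : box p = \big[setI/setT]_(i < N.+1)
   ([set x : E | x 0 i <= p.2 0 i] `&` ~` [set x : E | x 0 i <= p.1 0 i])).
  apply: bigsetI_measurable => i _; apply: measurableI.
    by apply: sub_sigma_algebra; exists i, (p.2 0 i).
  by apply: measurableC; apply: sub_sigma_algebra; exists i, (p.1 0 i).
rewrite -bigcap_seq; apply/seteqP; split => [x px i /= _|x px i].
  have /andP[h1 h2] := px i; split => //.
  by apply/negP; rewrite -ltNge.
have [|/= h1 h2] := px i; first by rewrite /= mem_index_enum.
by rewrite h1 andbT ltNge; apply/negP.
Qed.

Lemma measurable_box (p : E * E) : measurable (box p).
Proof. exact: measurable_borel_leb (borel_box p). Qed.

Definition cube (n : nat) : set E := box (const_mx (- n%:R), const_mx n%:R).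

Lemma cubeP n x : cube n x <-> forall i, - n%:R < x 0 i <= n%:R.
Proof. by split => h i; have := h i; rewrite /= !mxE. Qed.

Lemma bigcup_cube : \bigcup_n cube n = [set: E].
Proof.
apply/seteqP; split => // x _.
have h i : exists n : nat, `|x 0 i| < n%:R.
  by exists (Num.bound `|x 0 i|); apply: archi_boundP.
have [g hg] := choice h.
exists (\max_i g i)%N => //; apply/cubeP => i.
have := hg i; rewrite ltr_norml => /andP[h1 h2].
have : (g i)%:R <= (\max_i g i)%:R :> R by rewrite ler_nat leq_bigmax.
lra.
Qed.

Lemma leb_cube_lty n : (leb (cube n) < +oo)%E.
Proof. by rewrite (le_lt_trans (leb_box_le _))// ltry. Qed.

Lemma leb_sigma_finite : sigma_finite [set: E] leb.
Proof.
exists cube; first by rewrite bigcup_cube.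
by move=> n; split; [exact: measurable_box|exact: leb_cube_lty].
Qed.

HB.instance Definition _ :=
  Measure_isSigmaFinite.Build _ E R leb leb_sigma_finite.

(** A copy of [leb] whose domain is the Borel sigma-algebra, to which Tonelli's
    theorem applies with sums and differences of points. *)
Definition lebB (A : set borel) : \bar R := leb A.

Let lebB_sigma_additive : semi_sigma_additive lebB.
Proof.
move=> F mF tF mUF; apply: measure_semi_sigma_additive => //.
  by move=> n; exact: measurable_borel_leb.
exact: measurable_borel_leb.
Qed.

HB.instance Definition _ := isMeasure.Build _ borel R lebB
  leb0 (fun A => leb_ge0 A) lebB_sigma_additive.

Let lebB_sigma_finite : sigma_finite [set: borel] lebB.
Proof.
exists cube; first by rewrite bigcup_cube.
by move=> n; split; [exact: borel_box|exact: leb_cube_lty].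
Qed.

HB.instance Definition _ :=
  Measure_isSigmaFinite.Build _ borel R lebB lebB_sigma_finite.

Lemma borel_addr : measurable_fun [set: borel * borel]
  (fun z : borel * borel => (z.1 + z.2 : E) : borel).
Proof.
apply: measurable_fun_borel => i; under eq_fun do rewrite mxE.
apply: measurable_funD; apply: (measurableT_comp (measurable_borel_coord i)).
  exact: measurable_fst.
exact: measurable_snd.
Qed.

Lemma borel_subr : measurable_fun [set: borel * borel]
  (fun z : borel * borel => (z.1 - z.2 : E) : borel).
Proof.
apply: measurable_fun_borel => i; under eq_fun do rewrite !mxE.
apply: measurable_funB; apply: (measurableT_comp (measurable_borel_coord i)).
  exact: measurable_fst.
exact: measurable_snd.
Qed.

End lebesgue_measure_Rn.

(** * Maps that preserve Lebesgue measure *)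

Section invariance.
Context {R : realType} {N : nat}.
Local Notation E := 'rV[R]_N.+1.
Local Notation borel := (@borel R N).

(** Uniqueness of translation-invariant measures, by Tonelli: both sides are
    the measure of pairs with x in A and x + y in B. *)
Lemma translation_invariant_product
    (mu nu : {sigma_finite_measure set borel -> \bar R}) :
  (forall h (A : set borel), measurable A -> mu [set x : E | A (x + h)] = mu A) ->
  (forall h (A : set borel), measurable A -> nu [set x : E | A (x + h)] = nu A) ->
  forall A B : set borel, measurable A -> measurable B ->
  (mu A * nu B = mu B * nu [set x : E | A (- x)%R])%E.
Proof.
move=> muT nuT A B mA mB.
pose S : set (borel * borel) := (A \o fst) `&` [set z | B ((z.1 + z.2)%R : E)].
pose S' : set (borel * borel) := [set z | A ((z.1 - z.2)%R : E)] `&` (B \o fst).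
have mS : measurable S.
  apply: measurableI; rewrite -[X in measurable X]setTI.
    exact: measurable_fst.
  exact: borel_addr.
have mS' : measurable S'.
  apply: measurableI; rewrite -[X in measurable X]setTI.
    exact: borel_subr.
  exact: measurable_fst.
have lhs : (mu A * nu B = (mu \x nu) S)%E.
  rewrite -[in LHS](setIT A) -integral_indic// -ge0_integralZr//; last first.
    exact/measurable_EFinP/measurable_indic.
  apply: eq_integral => x _ /=; rewrite indicE.
  have [xA|xA] := boolP (x \in A); last first.
    rewrite mul0e (_ : xsection _ _ = set0) ?measure0//.
    apply/seteqP; split => // y; rewrite /xsection/= inE => -[/= xA' _].
    by rewrite notin_setE in xA.
  rewrite mul1e -(nuT x B mB); congr (nu _); apply/seteqP.
  by split => y; rewrite /xsection/= !inE/S/=; rewrite inE in xA; rewrite addrC;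
    [split|case].
have rhs : (mu B * nu [set x : E | A (- x)%R] = (mu \x nu) S')%E.
  have mA' := borel_opp mA.
  rewrite -[in LHS](setIT B) -integral_indic// -ge0_integralZr//; last first.
    exact/measurable_EFinP/measurable_indic.
  apply: eq_integral => x _ /=; rewrite indicE.
  have [xB|xB] := boolP (x \in B); last first.
    rewrite mul0e (_ : xsection _ _ = set0) ?measure0//.
    apply/seteqP; split => // y; rewrite /xsection/= inE => -[_ /= xB'].
    by rewrite notin_setE in xB.
  rewrite mul1e -(nuT (- x) _ mA'); congr (nu _); apply/seteqP.
  by split => y; rewrite /xsection/= !inE/S'/=; rewrite inE in xB;
    rewrite opprB; [split|case].
rewrite lhs rhs.
have E2 X : measurable X -> ((mu \x nu) X = \int[nu]_y mu (ysection X y))%E.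
  move=> mX; rewrite -[RHS]/((mu \x^ nu)%E X).
  by apply: product_measure_unique => //= C D mC mD; rewrite product_measure2E.
rewrite !E2//; apply: eq_integral => y _.
rewrite -(muT (- y) (ysection S y)); last exact: measurable_ysection.
congr (mu _); apply/seteqP; split => x; rewrite /ysection/= !inE /S/S'/=.
  by rewrite subrK.
by rewrite subrK.
Qed.

Lemma leb_preimage_le (S : E -> E) :
  (forall p, leb (S @^-1` box p) <= (box_vol p)%:E)%E ->
  forall A, (leb (S @^-1` A) <= leb A)%E.
Proof.
move=> Sbox A; apply: le_ereal_inf_tmp => _ [B AB <-].
apply: (@le_trans _ _ (leb (\bigcup_k (S @^-1` box (B k))))).
  by apply: le_leb => x /= /AB [k _ Bk]; exists k.
apply: (le_trans (leb_sigma_subadditive _)).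
by apply: lee_nneseries => [k _ _|k _]; [exact: leb_ge0|exact: Sbox].
Qed.

Definition leb_preserving (S : E -> E) :=
  measurable_fun [set: E] S /\ forall A, leb (S @^-1` A) = leb A.

(** The outer measure of every preimage is controlled by the preimages of boxes,
    and a bijection that preserves outer measure both ways preserves
    Caratheodory's condition. *)
Lemma leb_preserving_bij (S S' : E -> E) : cancel S S' -> cancel S' S ->
  (forall p, leb (S @^-1` box p) <= (box_vol p)%:E)%E ->
  (forall p, leb (S' @^-1` box p) <= (box_vol p)%:E)%E ->
  leb_preserving S.
Proof.
move=> SK S'K Sbox S'box.
have E1 A : S @^-1` (S' @^-1` A) = A by apply/seteqP; split => x /=; rewrite SK.
have E2 A : S' @^-1` (S @^-1` A) = A by apply/seteqP; split => x /=; rewrite S'K.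
have lS A : leb (S @^-1` A) = leb A.
  apply/eqP; rewrite eq_le leb_preimage_le//= -[in leLHS](E2 A).
  exact: leb_preimage_le.
have lS' A : leb (S' @^-1` A) = leb A by rewrite -lS E1.
split => // _ A mA; rewrite setTI.
have {}mA : leb.-caratheodory A := mA.
suff : leb.-caratheodory (S @^-1` A) by [].
move=> X /=.
by rewrite -lS' (mA (S' @^-1` X)) -[in LHS]lS -[X in (_ + X)%E]lS
  !preimage_setI E1.
Qed.

Lemma leb_preserving_translation (h : E) : leb_preserving (fun x => x + h).
Proof.
have tb (h' : E) (p : E * E) : (leb ((fun x : E => (x + h')%R) @^-1` box p) <= (box_vol p)%:E)%E.
  rewrite (_ : _ @^-1` _ = box (p.1 - h', p.2 - h')).
    apply: le_trans (leb_box_le _) _; rewrite /box_vol lee_fin.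
    rewrite le_eqVlt; apply/orP; left; apply/eqP/eq_bigr => i _.
    by rewrite !mxE /=; congr Num.max; lra.
  by apply/seteqP; split => x /= px i; have := px i; rewrite !mxE; lra.
by apply: (@leb_preserving_bij _ (fun x => x - h)) => // x; rewrite (addrK, subrK).
Qed.

Lemma leb_translation (A : set E) h : leb [set x | A (x + h)] = leb A.
Proof. exact: (leb_preserving_translation h).2. Qed.

(** The reflected box is in general no half-open box of the family. The product
    formula for [A = B] gives [m * m = m * m'] for the measures [m] and [m'] of
    the box and of its opposite, and symmetrically [m' * m' = m' * m]. *)
Lemma leb_opp_box p : leb [set x : E | box p (- x)] = leb (box p).
Proof.
have lT h (A : set borel) : measurable A -> lebB [set x : E | A (x + h)] = lebB A.
  by move=> _; exact: leb_translation.
have U (A B : set E) : measurable (A : set borel) -> measurable (B : set borel) ->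
    (leb A * leb B = leb B * leb [set x : E | A (- x)%R])%E.
  exact: (@translation_invariant_product lebB lebB lT lT).
have mb := borel_box p.
have fb : leb (box p) \is a fin_num.
  by rewrite ge0_fin_numE ?leb_ge0// (le_lt_trans (leb_box_le _))// ltry.
have fob : leb [set x : E | box p (- x)] \is a fin_num.
  rewrite ge0_fin_numE ?leb_ge0//.
  have bsub : [set x : E | box p (- x)] `<=`
      box (- p.2 - const_mx 1, - p.1).
    by move=> x px i; have := px i; rewrite !mxE; lra.
  by rewrite (le_lt_trans (le_leb bsub))// (le_lt_trans (leb_box_le _))// ltry.
have EE : [set x : E | [set x : E | box p (- x)] (- x)] = box p.
  by apply/seteqP; split => x /=; rewrite opprK.
have := U _ _ mb mb; have := U _ _ (borel_opp mb) (borel_opp mb); rewrite EE.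
rewrite -(fineK fb) -(fineK fob) -!EFinM => -[h1] [h2]; congr EFin.
have := @leb_ge0 R N (box p); have := @leb_ge0 R N [set x | box p (- x)].
rewrite -(fineK fb) -(fineK fob) !lee_fin; nra.
Qed.

Lemma leb_preserving_opp : leb_preserving (fun x : E => - x).
Proof.
by apply: (@leb_preserving_bij _ (fun x => - x)) => [x|x|p|p];
  rewrite ?opprK// leb_opp_box leb_box_le.
Qed.

Section involution.
Variable T : E -> E.
Hypothesis TK : involutive T.
Hypothesis TD : {morph T : x y / x + y}.
Hypothesis mT : forall i,
  measurable_fun [set: borel] (fun x : borel => T x 0 i).
Hypothesis Tbox : forall p, exists q, [set x : E | box p (T x)] `<=` box q.

Let nu (A : set borel) : \bar R := leb [set x : E | A (T x)].

Let mTA (A : set borel) : measurable A ->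
  measurable ([set x : E | A (T x)] : set borel).
Proof.
move=> mA; rewrite -[X in measurable X]setTI.
exact: (@measurable_fun_borel R N _ borel T).
Qed.

Let nu_sigma_additive : semi_sigma_additive nu.
Proof.
move=> F mF tF mUF.
have := @measure_semi_sigma_additive _ _ _ (@lebB R N)
  (fun n => [set x : E | F n (T x)]).
rewrite (_ : \bigcup_n [set x : E | F n (T x)] =
  [set x : E | (\bigcup_n F n) (T x)]); last by [].
apply => [n| |]; [exact: mTA| |exact: mTA].
by move=> i j _ _ [x [Fi Fj]]; apply: (tF i j) => //; exists (T x).
Qed.

HB.instance Definition _ := isMeasure.Build _ borel R nu
  leb0 (fun A => leb_ge0 [set x : E | A (T x)]) nu_sigma_additive.

Let nu_sigma_finite : sigma_finite [set: borel] nu.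
Proof.
exists (@cube R N); first by rewrite bigcup_cube.
move=> n; split; first exact: borel_box.
have [q /le_leb Tq] := Tbox (const_mx (- n%:R), const_mx n%:R).
by rewrite (le_lt_trans Tq)// (le_lt_trans (leb_box_le _))// ltry.
Qed.

HB.instance Definition _ :=
  Measure_isSigmaFinite.Build _ borel R nu nu_sigma_finite.

(** Uniqueness of the translation-invariant measure up to a constant makes the
    image of Lebesgue measure under [T] a multiple [c] of it, and [T] being an
    involution forces [c * c = 1]. *)
Lemma leb_preserving_involution : leb_preserving T.
Proof.
suff Tb p : (leb (T @^-1` box p) <= (box_vol p)%:E)%E.
  exact: (leb_preserving_bij TK TK Tb Tb).
have lT (h : E) (A : set borel) : measurable A ->
    lebB [set x : E | A (x + h)] = lebB A.
  by move=> _; exact: leb_translation.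
have nT (h : E) (A : set borel) : measurable A ->
    nu [set x : E | A (x + h)] = nu A.
  move=> _; rewrite /nu/= -[RHS](leb_translation _ (T h)); congr leb.
  by apply/seteqP; split => x /=; rewrite TD TK.
have U (A B : set E) : measurable (A : set borel) -> measurable (B : set borel) ->
    (leb A * nu B = leb B * nu [set x : E | A (- x)%R])%E.
  exact: (@translation_invariant_product lebB nu lT nT).
have mb := borel_box p.
have fb : leb (box p) \is a fin_num.
  by rewrite ge0_fin_numE ?leb_ge0// (le_lt_trans (leb_box_le _))// ltry.
have fn : nu (box p) \is a fin_num.
  rewrite ge0_fin_numE ?leb_ge0//; have [q /le_leb Tq] := Tbox p.
  by rewrite (le_lt_trans Tq)// (le_lt_trans (leb_box_le _))// ltry.
have := U _ _ (borel_opp mb) (mTA mb).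
rewrite leb_opp_box (_ : [set x : E | [set x : E | box p (- x)] (- x)] = box p).
  rewrite (_ : nu [set x : E | box p (T x)] = leb (box p)); last first.
    by rewrite /nu; congr leb; apply/seteqP; split => x /=; rewrite TK.
  rewrite -[leb [set x : E | box p (T x)]]/(nu (box p)).
  move=> UE; suff : (nu (box p) <= (box_vol p)%:E)%E by [].
  move: UE.
  have b0 := leb_ge0 (box p); have n0 : (0 <= nu (box p))%E by exact: leb_ge0.
  move=> UE; apply: le_trans (leb_box_le p); move: UE n0 b0.
  rewrite -(fineK fb) -(fineK fn) -!EFinM !lee_fin.
  have sq (a b : R) : a * a = b * b -> 0 <= b -> 0 <= a -> b <= a by nra.
  by move=> [h] n0 b0; exact: sq h n0 b0.
by apply/seteqP; split => x /=; rewrite opprK.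
Qed.

End involution.

Lemma leb_preserving_comp (S T : E -> E) :
  leb_preserving S -> leb_preserving T -> leb_preserving (S \o T).
Proof.
move=> [mS lS] [mT' lT]; split; first exact: (measurableT_comp mS mT').
by move=> A; rewrite comp_preimage lT lS.
Qed.

Lemma ge0_integral_leb_preserving (S : E -> E) (f : E -> \bar R) :
  leb_preserving S -> measurable_fun [set: E] f -> (forall x, 0 <= f x)%E ->
  (\int[leb]_x f (S x) = \int[leb]_x f x)%E.
Proof.
move=> [mS lS] mf f0.
have := ge0_integral_pushforward mS leb measurableT mf (fun y _ => f0 y).
rewrite preimage_setT => <-.
by apply: eq_measure_integral => A mA _; exact: lS.
Qed.

End invariance.

(** * Euclidean geometry and the reflection *)

Section euclidean.
Context {R : realType} {N : nat}.
Local Notation E := 'rV[R]_N.+1.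
Implicit Types (x y z e : E) (l : R).

Lemma dotvC x y : dotv x y = dotv y x.
Proof. by apply: eq_bigr => i _; rewrite mulrC. Qed.

Lemma dotvDl x y z : dotv (x + y) z = dotv x z + dotv y z.
Proof. by rewrite -big_split/=; apply: eq_bigr => i _; rewrite !mxE mulrDl. Qed.

Lemma dotvNl x z : dotv (- x) z = - dotv x z.
Proof. by rewrite -sumrN; apply: eq_bigr => i _; rewrite !mxE mulNr. Qed.

Lemma dotvZl a x z : dotv (a *: x) z = a * dotv x z.
Proof. by rewrite /dotv mulr_sumr; apply: eq_bigr => i _; rewrite !mxE mulrA. Qed.

Lemma dotvBl x y z : dotv (x - y) z = dotv x z - dotv y z.
Proof. by rewrite dotvDl dotvNl. Qed.

Lemma dotvDr x y z : dotv z (x + y) = dotv z x + dotv z y.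
Proof. by rewrite !(dotvC z) dotvDl. Qed.

Lemma dotvNr x z : dotv z (- x) = - dotv z x.
Proof. by rewrite !(dotvC z) dotvNl. Qed.

Lemma dotv_ge0 x : 0 <= dotv x x.
Proof. by apply: sumr_ge0 => i _; rewrite -expr2 sqr_ge0. Qed.

Lemma enorm_sqr x : enorm x ^+ 2 = dotv x x.
Proof. by rewrite sqr_sqrtr// dotv_ge0. Qed.

Lemma enorm_ge0 x : 0 <= enorm x.
Proof. exact: sqrtr_ge0. Qed.

Lemma coord_le_enorm x i : `|x 0 i| <= enorm x.
Proof.
rewrite -sqrtr_sqr ler_wsqrtr// /dotv (bigD1 i)//= expr2 lerDl.
by apply: sumr_ge0 => j _; rewrite -expr2 sqr_ge0.
Qed.

Lemma dotv_le x y : `|dotv x y| <= N.+1%:R * (enorm x * enorm y).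
Proof.
apply: (le_trans (ler_norm_sum _ _ _)).
rewrite -[N.+1 in leRHS]card_ord mulr_natl -sumr_const ler_sum// => i _.
by rewrite normrM ler_pM// coord_le_enorm.
Qed.

Lemma dotv_eq0 x : dotv x x = 0 -> x = 0.
Proof.
move=> x0; apply/rowP => i; rewrite mxE; apply/eqP; rewrite -normr_le0.
by rewrite (le_trans (coord_le_enorm x i))// /enorm x0 sqrtr0.
Qed.

Lemma ball_coord (x y : E) (r : R) : 0 < r ->
  (forall i, `|x 0 i - y 0 i| < r) -> ball x r y.
Proof. by move=> r0 h; split => // i j; rewrite (ord1 i); exact: h. Qed.

Lemma enorm_lt_ball (x y : E) (r : R) : enorm (x - y) < r -> ball x r y.
Proof.
move=> h; apply: ball_coord => [|i]; first exact: le_lt_trans (enorm_ge0 _) h.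
by have := coord_le_enorm (x - y) i; rewrite !mxE => /le_lt_trans; exact.
Qed.

Lemma dotv_lt_ball (x y : E) (r : R) : ball x r y ->
  dotv (x - y) (x - y) <= N.+1%:R * r ^+ 2.
Proof.
move=> -[r0 xy]; rewrite -[N.+1 in leRHS]card_ord mulr_natl -sumr_const.
apply: ler_sum => i _; have /= := xy 0 i; rewrite !mxE -expr2 /ball/= => h.
by rewrite -real_normK ?num_real// lerXn2r ?nnegrE ?(ltW r0)// ltW.
Qed.

(** An open set is the union of the rational boxes that it contains. *)
Lemma measurable_open (U : set E) : open U -> measurable (U : set (borel (R := R) (N := N))).
Proof.
move=> oU.
pose B (p : 'rV[rat]_N.+1 * 'rV[rat]_N.+1) : set E :=
  box (map_mx ratr p.1, map_mx ratr p.2).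
pose F n : set E := if unpickle n is Some p then
  (if asbool (B p `<=` U) then B p else set0) else set0.
have -> : U = \bigcup_n F n.
  apply/seteqP; split => [x Ux|x [n _]]; last first.
    rewrite /F; case: (unpickle n) => // p.
    by case: asboolP => // /[apply].
  have /nbhs_ballP[r /= r0 rU] := oU x Ux.
  have [a ha] : {a : 'I_N.+1 -> rat & forall i, x 0 i - r < ratr (a i) < x 0 i}.
    apply: (@choice _ _ (fun i q => x 0 i - r < ratr q < x 0 i)) => i.
    have /rat_in_itvoo[q] : x 0 i - r < x 0 i by rewrite ltrBlDr ltrDl.
    by rewrite in_itv/=; exists q.
  have [b hb] : {b : 'I_N.+1 -> rat & forall i, x 0 i < ratr (b i) < x 0 i + r}.
    apply: (@choice _ _ (fun i q => x 0 i < ratr q < x 0 i + r)) => i.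
    have /rat_in_itvoo[q] : x 0 i < x 0 i + r by rewrite ltrDl.
    by rewrite in_itv/=; exists q.
  pose p := (\row_i a i, \row_i b i).
  exists (pickle p) => //; rewrite /F pickleK.
  have BU : B p `<=` U.
    move=> y By; apply: rU; apply: ball_coord => // i.
    have := By i; have := ha i; have := hb i; rewrite /p !mxE => *.
    by rewrite ltr_norml; lra.
  case: asboolP => // _ i; have := ha i; have := hb i; rewrite /p !mxE; lra.
apply: bigcupT_measurable => n; rewrite /F; case: (unpickle n) => // p.
by case: asboolP => // _; exact: borel_box.
Qed.

Lemma measurable_dotv e : measurable_fun [set: @borel R N] (fun x => dotv x e).
Proof.
apply: measurable_sum => i; apply: measurable_funM => //.
exact: measurable_borel_coord.
Qed.

Lemma measurable_dotvv : measurable_fun [set: @borel R N] (fun x => dotv x x).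
Proof.
by apply: measurable_sum => i; apply: measurable_funM;
  exact: measurable_borel_coord.
Qed.

Lemma reflectionK e l : enorm e = 1 -> involutive (reflection e l).
Proof.
move=> e1 x; have ee : dotv e e = 1 by rewrite -enorm_sqr e1 expr1n.
rewrite /reflection dotvBl dotvZl ee; apply/rowP => i; rewrite !mxE; lra.
Qed.

Lemma reflection_dotv e l x : enorm e = 1 ->
  dotv (reflection e l x) e = 2 * l - dotv x e.
Proof.
move=> e1; have ee : dotv e e = 1 by rewrite -enorm_sqr e1 expr1n.
by rewrite /reflection dotvBl dotvZl ee; lra.
Qed.

Lemma measurable_reflection e l :
  measurable_fun [set: @borel R N] (reflection e l : @borel R N -> @borel R N).
Proof.
apply: measurable_fun_borel => i; rewrite /reflection.
under eq_fun do rewrite !mxE.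
apply: measurable_funB; first exact: measurable_borel_coord.
apply: measurable_funM => //; apply: measurable_funM => //.
by apply: measurable_funB => //; exact: measurable_dotv.
Qed.

(** Up to a translation the reflection is an additive involution; the constant
    [C] below bounds the coordinates of the image of a box. *)
Lemma leb_preserving_reflection e l : enorm e = 1 ->
  leb_preserving (reflection e l).
Proof.
move=> e1.
have -> : reflection e l = (fun x => x + (2 * l) *: e) \o reflection e 0.
  by apply/funext => x; apply/rowP => i; rewrite /= !mxE; lra.
apply: leb_preserving_comp; first exact: leb_preserving_translation.
apply: leb_preserving_involution.
- exact: reflectionK.
- by move=> x y; apply/rowP => i; rewrite /reflection dotvDl !mxE; lra.
- move=> i; apply: (measurableT_comp (measurable_borel_coord i)).
  exact: measurable_reflection.
- move=> p.
  pose M := \sum_i (`|p.1 0 i| + `|p.2 0 i|).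
  pose C := M + 2 * (N.+1%:R * M).
  exists (const_mx (- C - 1), const_mx C) => x px i.
  have hc y j : box p y -> `|y 0 j| <= M.
    move=> py; apply: (@le_trans _ _ (`|p.1 0 j| + `|p.2 0 j|)).
      have /andP[h1 h2] := py j; rewrite ler_norml.
      have := ler_norm (p.2 0 j); have := ler_norm (- p.1 0 j); rewrite normrN.
      have := normr_ge0 (p.1 0 j); have := normr_ge0 (p.2 0 j); lra.
    rewrite /M (bigD1 j)//= lerDl; by apply: sumr_ge0 => k _; rewrite addr_ge0 ?normr_ge0.
  suff : `|x 0 i| <= C.
    by rewrite ler_norml => /andP[h1 h2]; rewrite /= !mxE; apply/andP; split; lra.
  set y := reflection e 0 x in px.
  have -> : x = y - (2 * dotv y e) *: e.
    by rewrite -[LHS](reflectionK 0 e1) -/y {1}/reflection subr0.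
  have hy j : `|y 0 j| <= M by exact: hc px.
  clearbody y.
  have ei : `|e 0 i| <= 1 by rewrite -e1 coord_le_enorm.
  have ye : `|dotv y e| <= N.+1%:R * M.
    apply: (le_trans (ler_norm_sum _ _ _)).
    rewrite -[N.+1 in leRHS]card_ord mulr_natl -sumr_const ler_sum// => j _.
    rewrite normrM -[leRHS]mulr1 ler_pM//.
    by rewrite -e1 coord_le_enorm.
  rewrite !mxE; apply: (le_trans (ler_normB _ _)); apply: lerD; first exact: hy.
  by rewrite normrM -[leRHS]mulr1 ler_pM// normrM ger0_norm// ler_wpM2l.
Qed.

End euclidean.

(** * Borel versions of Lebesgue measurable functions *)

Section borel_versions.
Context {R : realType} {N : nat}.
Local Notation E := 'rV[R]_N.+1.
Local Notation borel := (@borel R N).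

Lemma leb_set1 (x : E) : leb [set x] = 0%E.
Proof.
apply/eqP; rewrite eq_le leb_ge0 andbT; apply/lee_addgt0Pr => r r0; rewrite add0e.
pose a := Num.min r 1; have a0 : 0 < a by rewrite lt_min r0/=.
apply: (@le_trans _ _ (leb (box (x - const_mx a, x)))).
  by apply: le_leb => _ -> i; rewrite /= !mxE lexx andbT gtrBl.
apply: (le_trans (leb_box_le _)); rewrite lee_fin /box_vol.
rewrite (eq_bigr (fun=> a)) => [|i _]; last first.
  by rewrite !mxE opprB addrCA subrr addr0 max_r// ltW.
rewrite prodr_const card_ord exprS (@le_trans _ _ a)//.
  by rewrite ler_piMr ?(ltW a0)// exprn_ile1// ?(ltW a0)// ge_min lexx orbT.
by rewrite ge_min lexx.
Qed.

Lemma borel_set1 (x : E) : measurable ([set x] : set borel).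
Proof.
rewrite (_ : [set x] = \bigcap_k box (x - const_mx k.+1%:R^-1, x)).
  by apply: bigcapT_measurable => k; exact: borel_box.
apply/seteqP; split => [_ -> k _ i|y h].
  by rewrite /= !mxE lexx andbT gtrBl invr_gt0.
apply/rowP => i; apply/eqP; rewrite eq_le; have /= := h 0%N I i.
move=> /andP[_ ->] /=; rewrite leNgt; apply/negP => yx.
have [k hk] := ltr_add_invr yx.
have := h k I i; rewrite !mxE => /andP[h1 _]; move: h1 hk => /=.
set t := k.+1%:R^-1; lra.
Qed.

Lemma ae_neq (x : E) : \forall y \ae leb, y != x.
Proof.
exists [set x]; split; [|exact: leb_set1|].
  exact: (measurable_borel_leb (borel_set1 x)).
by move=> y /= /negP; rewrite negbK => /eqP.
Qed.

Lemma ae_leb_preserving (S : E -> E) (P : E -> Prop) : leb_preserving S ->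
  (\forall x \ae leb, P x) -> \forall x \ae leb, P (S x).
Proof.
move=> [mS lS] [A [mA A0 PA]]; exists (S @^-1` A); split.
- by rewrite -[X in measurable X]setTI; exact: mS.
- by rewrite -A0; exact: lS.
- by move=> x /= nP; exact: PA.
Qed.

Lemma borel_hull (A : set E) : measurable A -> (leb A < +oo)%E ->
  exists G : set E, [/\ measurable (G : set borel), A `<=` G &
    leb (G `\` A) = 0%E].
Proof.
move=> mA Aoo.
have Afin : leb A \is a fin_num by rewrite ge0_fin_numE ?leb_ge0.
have cov n : exists B : nat -> E * E, A `<=` \bigcup_k box (B k) /\
    (\sum_(k <oo) (box_vol (B k))%:E <= leb A + n.+1%:R^-1%:E)%E.
  have n0 : 0 < n.+1%:R^-1 :> R by rewrite invr_gt0.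
  have [_ [B AB <-] h] := lb_ereal_inf_adherent n0 Afin.
  by exists B; split => //; exact: ltW.
have [B hB] := choice cov.
pose G := \bigcap_n \bigcup_k box (B n k).
have mG : measurable (G : set borel).
  apply: bigcapT_measurable => n; apply: bigcupT_measurable => k.
  exact: borel_box.
have AG : A `<=` G by move=> x Ax n _; exact: (hB n).1.
have lG : (leb G <= leb A)%E.
  apply/lee_addgt0Pr => r r0.
  have [n] := ltr_add_invr r0; rewrite add0r => nr.
  apply: (@le_trans _ _ (leb A + n.+1%:R^-1%:E)%E); last first.
    by rewrite leeD2l// lee_fin ltW.
  apply: le_trans (hB n).2; apply: ereal_inf_lbound.
  by exists (B n) => // x Gx; exact: Gx.
have mGE := measurable_borel_leb mG.
exists G; split => //.
have := @measureD _ _ _ leb G A mGE mA (le_lt_trans lG Aoo).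
rewrite (setIidr AG) => h; apply/eqP; rewrite eq_le leb_ge0 andbT.
by rewrite h; rewrite leeBlDr// add0e.
Qed.

(** In each cube, [A] differs from a Borel hull by a null set, which lies in a
    Borel null set by the same construction. *)
Lemma borel_modification (A : set E) : measurable A -> exists Z : set E,
  [/\ measurable (Z : set borel), leb Z = 0%E &
      measurable ((A `\` Z) : set borel)].
Proof.
move=> mA.
have step m : exists GZ : set E * set E, [/\ measurable (GZ.1 : set borel),
    measurable (GZ.2 : set borel), leb GZ.2 = 0%E &
    (A `&` cube m) `\` GZ.2 = GZ.1 `\` GZ.2].
  have mAm : measurable (A `&` cube m) by apply: measurableI => //; exact: measurable_box.
  have [|G [mG AG G0]] := borel_hull mAm.
    by apply: le_lt_trans (leb_cube_lty m); apply: le_leb.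
  have mGA : measurable (G `\` (A `&` cube m)).
    by apply: measurableD => //; exact: measurable_borel_leb.
  have [|Z [mZ GZ Z0]] := borel_hull mGA; first by rewrite [ltLHS]G0.
  exists (G, Z); split => //=.
    apply/eqP; rewrite eq_le leb_ge0 andbT.
    apply: (@le_trans _ _ (leb (G `\` (A `&` cube m)) + leb (Z `\` (G `\` (A `&` cube m)))))%E; last first.
      by rewrite [X in (X + _)%E]G0 [X in (_ + X)%E]Z0 adde0.
    apply: le_trans (outer_measureU2 leb _ _); apply: le_leb => x Zx.
    by have [|] := pselect ((G `\` (A `&` cube m)) x); [left|right].
  apply/seteqP; split => x [h1 h2]; split => //; first exact: AG.
  by apply: contrapT => h; apply: h2; exact: GZ.
have [GZ hGZ] := choice step.
exists (\bigcup_m (GZ m).2); split.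
- by apply: bigcupT_measurable => m; have [] := hGZ m.
- have nm m : leb.-negligible (GZ m).2.
    apply/negligibleP; have [_ mZ Z0 _] := hGZ m => //.
    exact: measurable_borel_leb.
  have /negligible_bigcup := nm; move/measure_negligible; apply.
  apply: bigcupT_measurable => m; apply: measurable_borel_leb.
  by have [] := hGZ m.
- rewrite (_ : A `\` _ = \bigcup_m ((GZ m).1 `\` \bigcup_k (GZ k).2)).
    apply: bigcupT_measurable => m; apply: measurableD; first by have [] := hGZ m.
    by apply: bigcupT_measurable => k; have [] := hGZ k.
  apply/seteqP; split => x.
    move=> [Ax nZ]; have [m _ xm] : (\bigcup_n @cube R N n) x by rewrite bigcup_cube.
    exists m => //; split => //.
    have [_ _ _ h] := hGZ m; have : ((A `&` cube m) `\` (GZ m).2) x.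
      by split => // Zx; apply: nZ; exists m.
    by rewrite h => -[].
  move=> [m _ [Gx nZ]]; split => //.
  have [_ _ _ h] := hGZ m; have : ((GZ m).1 `\` (GZ m).2) x.
    by split => // Zx; apply: nZ; exists m.
  by rewrite -h => -[[]].
Qed.

(** The exceptional set collects those of the superlevel sets of rational level.
    It is allowed to grow, so that it can be made symmetric about the origin. *)
Lemma borel_modification_fun (f : E -> R) : measurable_fun [set: E] f ->
  exists Z : set E, [/\ measurable (Z : set borel), leb Z = 0%E &
    forall Z' : set E, measurable (Z' : set borel) -> Z `<=` Z' ->
      measurable_fun [set: borel] (fun x : borel => if asbool (Z' x) then 0 else f x)].
Proof.
move=> mf.
have step n : exists Z : set E, [/\ measurable (Z : set borel), leb Z = 0%E &
    measurable (([set x | ratr (odflt 0 (unpickle n)) < f x] `\` Z) : set borel)].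
  apply: borel_modification.
  rewrite (_ : mkset _ = f @^-1` `]ratr (odflt 0 (unpickle n)), +oo[%classic).
    by rewrite -[X in measurable X]setTI; apply: mf => //; exact: measurable_itv.
  by apply/seteqP; split => x /=; rewrite in_itv/= andbT.
have [Z hZ] := choice step.
exists (\bigcup_n Z n); split.
- by apply: bigcupT_measurable => m; have [] := hZ m.
- have nm m : leb.-negligible (Z m).
    apply/negligibleP; have [mZ Z0 _] := hZ m => //.
    exact: measurable_borel_leb.
  have /negligible_bigcup := nm; move/measure_negligible; apply.
  apply: bigcupT_measurable => m; apply: measurable_borel_leb.
  by have [] := hZ m.
- move=> Z' mZ' ZZ' _; apply: (measurability _ (RGenOInfty.measurableE R)) => //.
  move=> _ [_ [a ->] <-]; rewrite setTI.
  pose D n : set E := if a < ratr (odflt 0 (unpickle n)) then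
    ([set x | ratr (odflt 0 (unpickle n)) < f x] `\` Z n) `\` Z' else set0.
  rewrite (_ : _ @^-1` _ = (\bigcup_n D n) `|` (if 0 > a then Z' else set0)).
    apply: measurableU; last by case: ifP.
    apply: bigcupT_measurable => n; rewrite /D; case: ifP => // _.
    by apply: measurableD => //; have [] := hZ n.
  apply/seteqP; split => x /=; rewrite in_itv/= andbT.
    case: asboolP => [Zx a0|Zx af]; first by right; rewrite a0.
    left; have [q] := rat_in_itvoo af; rewrite in_itv/= => /andP[aq qf].
    exists (pickle q) => //; rewrite /D pickleK/= aq; split => //; split => //.
    by move=> Zq; apply: Zx; apply: ZZ'; exists (pickle q).
  move=> [[n _]|].
    by rewrite /D; case: ifPn => // an [[fx _] Zx]; case: asboolP => // _; exact: lt_trans fx.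
  by case: ifPn => // a0 Zx; case: asboolP.
Qed.

End borel_versions.

(** * Integrals over pairs of points *)

Section product_integrals.
Context {R : realType} {N : nat}.
Local Notation E := 'rV[R]_N.+1.
Local Notation borel := (@borel R N).
Local Notation leb2 := (leb \x leb)%E.
Local Notation int1 f := (leb.-integrable [set: E] (EFin \o f)).
Local Notation int2 F := (leb2.-integrable [set: E * E] (EFin \o F)).

Lemma integral_leb_preserving (S : E -> E) (g : E -> \bar R) :
  leb_preserving S -> measurable_fun [set: E] g ->
  (\int[leb]_x g (S x) = \int[leb]_x g x)%E.
Proof.
move=> hS mg; rewrite integralE [RHS]integralE.
congr (_ - _)%E.
  transitivity (\int[leb]_x (g^\+ (S x)))%E; first by apply: eq_integral => x _; rewrite !(funeposE, funenegE).
  by apply: ge0_integral_leb_preserving => //; exact: measurable_funepos.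
transitivity (\int[leb]_x (g^\- (S x)))%E; first by apply: eq_integral => x _; rewrite !(funeposE, funenegE).
by apply: ge0_integral_leb_preserving => //; exact: measurable_funeneg.
Qed.

Lemma measurable_section1 (F : E * E -> \bar R) x :
  measurable_fun setT F -> measurable_fun setT (fun y => F (x, y)).
Proof. by move=> mF; exact: (measurableT_comp mF (pair1_measurable x)). Qed.

Lemma measurable_section2 (F : E * E -> \bar R) y :
  measurable_fun setT F -> measurable_fun setT (fun x => F (x, y)).
Proof. by move=> mF; exact: (measurableT_comp mF (pair2_measurable y)). Qed.

(** Only the fibers of [(x, y) |-> (x, S x y)] are known to preserve measure, and
    the complete sigma-algebra need not make this map measurable on pairs: hence
    the separate measurability hypothesis. *)
Lemma int2_fiber (F : E * E -> R) (S : E -> E -> E) :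
  (forall x, leb_preserving (S x)) ->
  measurable_fun setT (fun p => F (p.1, S p.1 p.2)) -> int2 F ->
  int2 (fun p => F (p.1, S p.1 p.2)) /\
  \int[leb2]_p F (p.1, S p.1 p.2) = \int[leb2]_p F p.
Proof.
move=> hS mFS iF; have mF := measurable_int _ iF.
have mFS' : measurable_fun setT (EFin \o (fun p => F (p.1, S p.1 p.2))).
  exact/measurable_EFinP.
have iFS : int2 (fun p => F (p.1, S p.1 p.2)).
  apply/(integrable12ltyP _ _ mFS').
  move/(integrable12ltyP _ _ mF) : iF; apply: le_lt_trans.
  rewrite le_eqVlt; apply/orP; left; apply/eqP/eq_integral => x _.
  apply: (@integral_leb_preserving (S x) (fun y => `|(F (x, y))%:E|)%E) => //.
  exact: (measurable_section1 x (measurableT_comp (@abse_measurable _ setT) mF)).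
split => //; congr fine.
rewrite -[LHS](integral12_prod_meas1 iFS) -[RHS](integral12_prod_meas1 iF).
apply: eq_integral => x _.
apply: (@integral_leb_preserving (S x) (fun y => (F (x, y))%:E)) => //.
exact: (measurable_section1 x mF).
Qed.

Lemma measurable_flip : measurable_fun setT (fun p : E * E => (p.2, p.1)).
Proof. by apply: measurable_fun_pair; [exact: measurable_snd|exact: measurable_fst]. Qed.

Lemma int2_swap (F : E * E -> R) : int2 F ->
  int2 (fun p => F (p.2, p.1)) /\
  \int[leb2]_p F (p.2, p.1) = \int[leb2]_p F p.
Proof.
move=> iF; have mF := measurable_int _ iF.
have mFS : measurable_fun setT (EFin \o (fun p => F (p.2, p.1))).
  exact: (measurableT_comp mF measurable_flip).
have iFS : int2 (fun p => F (p.2, p.1)).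
  by apply/(integrable21ltyP _ _ mFS); move/(integrable12ltyP _ _ mF) : iF.
split => //; congr fine.
by rewrite -[LHS](integral21_prod_meas1 iFS) -[RHS](integral12_prod_meas1 iF).
Qed.

Lemma measurable_fun_pair_coord d (T : measurableType d) (f : E * E -> E)
    (g : borel -> T) :
  (forall i, measurable_fun setT (fun p => f p 0 i)) ->
  measurable_fun setT g -> measurable_fun setT (fun p => g (f p)).
Proof.
by move=> mf mg; exact: (measurableT_comp mg (measurable_fun_borel mf)).
Qed.

Lemma measurable_fst_coord i : measurable_fun setT (fun p : E * E => p.1 0 i).
Proof. exact: (measurableT_comp (measurable_coord i) measurable_fst). Qed.

Lemma measurable_snd_coord i : measurable_fun setT (fun p : E * E => p.2 0 i).
Proof. exact: (measurableT_comp (measurable_coord i) measurable_snd). Qed.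

Lemma measurable_conv (k : E -> R) : measurable_fun setT (k : borel -> R) ->
  measurable_fun setT (fun p : E * E => k (p.1 - p.2)).
Proof.
apply: (@measurable_fun_pair_coord _ _ (fun p => p.1 - p.2)) => i.
under eq_fun do rewrite !mxE.
by apply: measurable_funB; [exact: measurable_fst_coord|exact: measurable_snd_coord].
Qed.

Lemma measurable_borel_fun d (T : measurableType d) (k : E -> T) :
  measurable_fun setT (k : borel -> T) -> measurable_fun setT k.
Proof. by move=> mk; exact: (measurableT_comp mk measurable_id_borel). Qed.

Lemma leb_preserving_subl (x : E) : leb_preserving (fun y => x - y).
Proof.
rewrite (_ : (fun y => _) = (fun y => y + x) \o (fun y => - y)); last first.
  by apply/funext => y; rewrite /= addrC.
apply: leb_preserving_comp; first exact: leb_preserving_translation.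
exact: leb_preserving_opp.
Qed.

Lemma integral_subl (x : E) (g : E -> \bar R) : measurable_fun [set: E] g ->
  (\int[leb]_y g (x - y)%R = \int[leb]_y g y)%E.
Proof. exact: integral_leb_preserving (leb_preserving_subl x). Qed.

Lemma measurable_subl d (T : measurableType d) (x : E) (g : E -> T) :
  measurable_fun [set: E] g -> measurable_fun [set: E] (fun y => g (x - y)).
Proof. by move=> mg; exact: (measurableT_comp mg (leb_preserving_subl x).1). Qed.

Lemma int1_subl (x : E) (k : E -> R) : int1 k -> int1 (fun y => k (x - y)).
Proof.
move=> /integrableP[mk k_oo]; apply/integrableP; split.
  exact: measurable_subl mk.
rewrite (integral_subl x (g := fun y => `|(k y)%:E|%E))//.
exact: (measurableT_comp (@abse_measurable _ setT) mk).
Qed.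

Lemma measurable_fst_fun (a : E -> R) : measurable_fun setT a ->
  measurable_fun setT (fun p : E * E => a p.1).
Proof. by move=> ma; exact: (measurableT_comp ma measurable_fst). Qed.

Lemma measurable_snd_fun (a : E -> R) : measurable_fun setT a ->
  measurable_fun setT (fun p : E * E => a p.2).
Proof. by move=> ma; exact: (measurableT_comp ma measurable_snd). Qed.

Lemma int1_measurable (a : E -> R) : int1 a -> measurable_fun setT a.
Proof. by move=> /measurable_int/measurable_EFinP. Qed.

Lemma int2_conv (a k : E -> R) : int1 a ->
  measurable_fun setT (k : borel -> R) -> int1 k ->
  int2 (fun p => a p.1 * k (p.1 - p.2)) /\
  \int[leb2]_p (a p.1 * k (p.1 - p.2)) = \int[leb]_x a x * \int[leb]_x k x.
Proof.
move=> ia mk ik; have ma := int1_measurable ia.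
have mk' := int1_measurable ik.
have mF : measurable_fun setT (EFin \o (fun p : E * E => a p.1 * k (p.1 - p.2))).
  apply/measurable_EFinP; apply: measurable_funM; last exact: measurable_conv.
  exact: measurable_fst_fun.
have iF : int2 (fun p => a p.1 * k (p.1 - p.2)).
  apply/(integrable12ltyP _ _ mF).
  have /integrableP[_ a_oo] := ia; have /integrableP[_ k_oo] := ik.
  have mak : measurable_fun setT (fun y => `|(k y)%:E|%E).
    by apply/measurable_EFinP; exact: (measurableT_comp (@normr_measurable _ setT) mk').
  rewrite (eq_integral (fun x => `|(a x)%:E| * \int[leb]_y `|(k y)%:E|)%E).
    rewrite ge0_integralZr//; last 2 first.
      exact: (measurableT_comp (@abse_measurable _ setT) (measurable_int _ ia)).
      by apply: integral_ge0.
    apply: lte_mul_pinfty => //; first exact: integral_ge0.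
    by rewrite ge0_fin_numE//; exact: integral_ge0.
  move=> x _; rewrite -(integral_subl x mak).
  rewrite -ge0_integralZl//; last exact: measurable_subl mak.
  by apply: eq_integral => y _; rewrite /= normrM EFinM.
split => //.
rewrite /Rintegral -[X in fine X](integral12_prod_meas1 iF) -fineM; last 2 first.
  exact: integrable_fin_num. exact: integrable_fin_num.
congr fine.
rewrite -(fineK (integrable_fin_num measurableT ik)) -integralZr//.
apply: eq_integral => x _; rewrite /fubini_F/= fineK; last exact: integrable_fin_num.
rewrite -(integral_subl x (measurable_int _ ik)).
by rewrite -integralZl//; exact: int1_subl ik.
Qed.

End product_integrals.

(** * Singular kernels and second differences *)

Section principal_value.
Context {R : realType} {N : nat}.
Local Notation E := 'rV[R]_N.+1.
Local Notation borel := (@borel R N).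
Local Notation leb2 := (leb \x leb)%E.
Local Notation int1 f := (leb.-integrable [set: E] (EFin \o f)).
Local Notation int2 F := (leb2.-integrable [set: E * E] (EFin \o F)).

Lemma int1_le (f g : E -> R) : measurable_fun setT f ->
  (forall x, `|f x| <= g x) -> int1 g -> int1 f.
Proof.
move=> mf fg; apply: (le_integrable measurableT); first exact/measurable_EFinP.
by move=> x _; rewrite /= lee_fin (le_trans (fg x))// ler_norm.
Qed.

Lemma int2_le (F G : E * E -> R) : measurable_fun setT F ->
  (forall p, `|F p| <= G p) -> int2 G -> int2 F.
Proof.
move=> mf fg; apply: (le_integrable measurableT); first exact/measurable_EFinP.
by move=> x _; rewrite /= lee_fin (le_trans (fg x))// ler_norm.
Qed.

Lemma int2D (F G : E * E -> R) : int2 F -> int2 G -> int2 (fun p => F p + G p).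
Proof. by move=> iF iG; have := integrableD measurableT iF iG. Qed.

Lemma int2B (F G : E * E -> R) : int2 F -> int2 G -> int2 (fun p => F p - G p).
Proof. by move=> iF iG; have := integrableB measurableT iF iG. Qed.

Lemma int2Z (k : R) (F : E * E -> R) : int2 F -> int2 (fun p => k * F p).
Proof. by move=> iF; have := integrableZl measurableT k iF. Qed.

Lemma int1Z (k : R) (F : E -> R) : int1 F -> int1 (fun p => k * F p).
Proof. by move=> iF; have := integrableZl measurableT k iF. Qed.

Lemma measurable_int2 (F : E * E -> R) : int2 F -> measurable_fun setT F.
Proof. by move=> /measurable_int/measurable_EFinP. Qed.

Definition weight (z : E) : R := Num.min 1 (dotv z z).

Lemma weight_ge0 z : 0 <= weight z.
Proof. by rewrite le_min ler01 dotv_ge0. Qed.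

Lemma dotvNN (z : E) : dotv (- z) (- z) = dotv z z.
Proof. by rewrite dotvNl dotvNr opprK. Qed.

Lemma weightN z : weight (- z) = weight z.
Proof. by rewrite /weight dotvNN. Qed.

Lemma measurable_weight : measurable_fun setT (weight : borel -> R).
Proof. by apply: measurable_minr => //; exact: measurable_dotvv. Qed.

Record singular_kernel (J : E -> R) : Prop := {
  kernel_measurable : measurable_fun setT (J : borel -> R);
  kernel_ge0 : forall z, 0 <= J z;
  kernelN : forall z, J (- z) = J z;
  kernel_weight : int1 (fun z => weight z * J z) }.

Variable J : E -> R.
Hypothesis hJ : singular_kernel J.

Let Jm := kernel_measurable hJ.
Let J0 := kernel_ge0 hJ.
Let Jeven := kernelN hJ.
Let wJ := kernel_weight hJ.

(** Cutting the singularity off makes the kernel integrable, so that the double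
    integral of a product can be split into separate terms. *)
Definition Jtr (r : R) (z : E) : R := if r <= dotv z z then J z else 0.

Lemma Jtr_ge0 r z : 0 <= Jtr r z. Proof. by rewrite /Jtr; case: ifP. Qed.

Lemma JtrN r z : Jtr r (- z) = Jtr r z.
Proof. by rewrite /Jtr dotvNN Jeven. Qed.

Lemma Jtr_le r z : Jtr r z <= J z.
Proof. by rewrite /Jtr; case: ifP. Qed.

Lemma measurable_Jtr r : measurable_fun setT (Jtr r : borel -> R).
Proof.
apply: measurable_fun_ifT; [|exact: Jm|by []].
by apply: measurable_fun_ler => //; exact: measurable_dotvv.
Qed.

Lemma Jtr_le_weight r z : 0 < r <= 1 -> Jtr r z <= r^-1 * (weight z * J z).
Proof.
move=> /andP[r0 r1]; rewrite /Jtr; case: ifPn => [rz|_]; last first.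
  by rewrite !mulr_ge0 ?weight_ge0// invr_ge0 ltW.
rewrite mulrA ler_peMl// mulrC ler_pdivlMr// mul1r.
by rewrite /weight le_min r1.
Qed.

Lemma int1_Jtr r : 0 < r <= 1 -> int1 (Jtr r).
Proof.
move=> r01; apply: (int1_le _ _ (int1Z r^-1 wJ)).
  exact: (measurable_borel_fun (measurable_Jtr r)).
by move=> z; rewrite ger0_norm ?Jtr_ge0// Jtr_le_weight.
Qed.

Lemma measurable_wJ : measurable_fun setT ((fun z => weight z * J z) : borel -> R).
Proof. exact: (measurable_funM measurable_weight Jm). Qed.

Lemma leb_preserving_refl_pt (x : E) : leb_preserving (fun y => x + x - y).
Proof. exact: leb_preserving_subl. Qed.

(** The weak form of a one-sided bound for the operator with kernel [J]: after
    truncating [J] near the origin, [y] may be replaced by [x + x - y], which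
    turns first differences of [f] into second differences. *)
Lemma energy_le_of_second_difference (f phi : E -> R) (C F0 : R) :
  0 <= C -> measurable_fun setT (f : borel -> R) -> (forall x, 0 <= f x <= F0) ->
  (forall x z, 2 * f x - f (x + z) - f (x - z) <= C * weight z) ->
  int1 phi -> (forall x, 0 <= phi x) ->
  int2 (fun p => (f p.1 - f p.2) * (phi p.1 - phi p.2) * J (p.1 - p.2)) ->
  \int[leb2]_p ((f p.1 - f p.2) * (phi p.1 - phi p.2) * J (p.1 - p.2)) <=
  C * (\int[leb]_x phi x * \int[leb]_x (weight x * J x)).
Proof.
move=> C0 mfb fb f2 iphi phi0 iF.
have mf := measurable_borel_fun mfb.
have mphi := int1_measurable iphi.
set W := \int[leb]_x phi x * _.
pose r n : R := n.+1%:R^-1.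
have r01 n : 0 < r n <= 1 by rewrite invr_gt0 ltr0n/= invf_le1// ler1n.
pose A n (p : E * E) := phi p.1 * (f p.1 - f p.2) * Jtr (r n) (p.1 - p.2).
pose A' n (p : E * E) := A n (p.1, p.1 + p.1 - p.2).
pose F n (p : E * E) :=
  (f p.1 - f p.2) * (phi p.1 - phi p.2) * Jtr (r n) (p.1 - p.2).
have mA n : measurable_fun setT (A n).
  apply: measurable_funM; last exact: (measurable_conv (measurable_Jtr (r n))).
  apply: measurable_funM; first exact: measurable_fst_fun.
  by apply: measurable_funB; [exact: measurable_fst_fun|exact: measurable_snd_fun].
have iA n : int2 (A n).
  have [+ _] := int2_conv iphi (measurable_Jtr (r n)) (int1_Jtr (r01 n)).
  move=> /(int2Z F0); apply: int2_le => // p.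
  rewrite /A mulrA !normrM (ger0_norm (phi0 _)) (ger0_norm (Jtr_ge0 _ _)).
  rewrite [F0 * _]mulrC ler_wpM2r ?Jtr_ge0// ler_wpM2l//.
  by have := fb p.1; have := fb p.2; rewrite ler_norml; lra.
have mA' n : measurable_fun setT (A' n).
  have mc i : measurable_fun setT (fun p : E * E => (p.1 + p.1 - p.2) 0 i).
    under eq_fun do rewrite !mxE.
    apply: measurable_funB; last exact: measurable_snd_coord.
    by apply: measurable_funD; exact: measurable_fst_coord.
  apply: measurable_funM.
    apply: measurable_funM; first exact: measurable_fst_fun.
    apply: measurable_funB; first exact: measurable_fst_fun.
    exact: (measurable_fun_pair_coord mc mfb).
  apply: (@measurable_fun_pair_coord _ _ _ _ (fun p => p.1 - (p.1 + p.1 - p.2))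
    _ _ (measurable_Jtr (r n))) => i.
  under eq_fun do rewrite mxE.
  apply: measurable_funD; first exact: measurable_fst_coord.
  by under eq_fun do rewrite mxE; apply: measurable_funN; exact: mc.
have [iA' A'A] : (forall n, int2 (A' n)) /\
    (forall n, \int[leb2]_p A' n p = \int[leb2]_p A n p).
  by split => n; have [] :=
    int2_fiber (fun x => leb_preserving_refl_pt x) (mA' n) (iA n).
have AW n : \int[leb2]_p A n p + \int[leb2]_p A n p <= C * W.
  rewrite -{2}(A'A n) -RintegralD//.
  have [iw wE] := int2_conv iphi measurable_wJ wJ.
  rewrite /W -wE -RintegralZl//; apply: le_Rintegral => //.
  - exact: int2D.
  - exact: int2Z.
  move=> [x y] _; rewrite /A'/A/=.
  rewrite (_ : x - (x + x - y) = - (x - y)); last first.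
    by apply/rowP => i; rewrite !mxE; lra.
  rewrite JtrN -mulrDl -mulrDr.
  have := f2 x (x - y).
  have -> : x + (x - y) = x + x - y by rewrite addrA.
  have -> : x - (x - y) = y by apply/rowP => i; rewrite !mxE; lra.
  set w := weight _; have w0 : 0 <= w by exact: weight_ge0.
  have := Jtr_le (r n) (x - y); have := Jtr_ge0 (r n) (x - y).
  have := phi0 x; move: (phi x) (f x) (f y) (f _) (Jtr _ _) (J _).
  move=> p a b c j1 j p0 j10 jj h.
  rewrite !mulrA -[leRHS]mulrA [C * p]mulrC -[leRHS]mulrA -[leLHS]mulrA ler_wpM2l//.
  rewrite [leRHS]mulrA; apply: (@le_trans _ _ (C * w * j1)).
    by rewrite ler_wpM2r//; lra.
  by rewrite ler_wpM2l// mulr_ge0.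
have FA n : \int[leb2]_p F n p = \int[leb2]_p A n p + \int[leb2]_p A n p.
  have [iS ES] := int2_swap (iA n).
  rewrite -{2}ES -RintegralD//.
  apply: eq_Rintegral => -[x y] _; rewrite /F/A/=.
  rewrite -[in RHS](opprB x y) JtrN; ring.
pose F_ (p : E * E) := (f p.1 - f p.2) * (phi p.1 - phi p.2) * J (p.1 - p.2).
have mF : measurable_fun setT (EFin \o F_) by exact: measurable_int iF.
have mFn n : measurable_fun setT (F n).
  apply: measurable_funM; last exact: (measurable_conv (measurable_Jtr (r n))).
  by apply: measurable_funM; apply: measurable_funB;
    (exact: measurable_fst_fun || exact: measurable_snd_fun).
have FF n p : `|F n p| <= `|F_ p|.
  rewrite /F /F_ !normrM ler_wpM2l ?mulr_ge0//.
  by rewrite !ger0_norm ?Jtr_ge0 ?Jtr_le.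
have iFn n : int2 (F n) by apply: int2_le (integrable_norm iF) => // p; exact: FF.
have h1 n : measurable_fun setT (EFin \o F n) by exact/measurable_EFinP.
have h2 : {ae leb2, forall p, setT p ->
    (fun n => (EFin \o F n) p) @ \oo --> (EFin \o F_) p}.
  apply: aeW => -[x y] _; apply: cvg_EFin; first by near=> n.
  apply: cvg_near_cst; rewrite /F/F_/= /Jtr.
  have [xy|xy] := eqVneq (dotv (x - y) (x - y)) 0.
    have /eqP := dotv_eq0 xy; rewrite subr_eq0 => /eqP ->.
    by apply: nearW => n; rewrite !subrr mulr0 !mul0r.
  have xy0 : 0 < dotv (x - y) (x - y) by rewrite lt_def xy dotv_ge0.
  have [k hk] := ltr_add_invr xy0; rewrite add0r in hk.
  exists k => // n /= kn; rewrite ifT// (le_trans _ (ltW hk))//.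
  by rewrite lef_pV2 ?posrE// ler_nat.
pose aF p := `|F_ p|.
have h3 : {ae leb2, forall p, forall n, setT p ->
    (`|(EFin \o F n) p| <= (EFin \o aF) p)%E}.
  by apply: aeW => p n _; rewrite /= lee_fin; exact: FF.
have [_ _ cv] := dominated_convergence measurableT h1 mF h2 (integrable_norm iF) h3.
rewrite -lee_fin fineK; last exact: (integrable_fin_num measurableT iF).
rewrite -(cvg_lim _ cv)//; apply: lime_le; first by apply/cvg_ex; eexists; exact: cv.
apply: nearW => n /=.
rewrite -(fineK (integrable_fin_num measurableT (iFn n))) lee_fin.
by rewrite -[leLHS]/(\int[leb2]_p F n p) FA AW.
Unshelve. all: by end_near. Qed.

End principal_value.

(** * Comparison of a supersolution with a bump *)

Section measurability.
Context {R : realType} {N : nat}.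
Local Notation E := 'rV[R]_N.+1.

Lemma measurable_positive_part_on d (T : measurableType d) (f v : T -> R) (tau : R) :
  measurable_fun setT f -> measurable_fun setT v ->
  measurable_fun setT
    (fun x => if 0 < f x then Num.max 0 (tau * f x - v x) else 0).
Proof.
move=> mf mv; apply: measurable_fun_ifT => //; first exact: measurable_fun_ltr.
apply: measurable_maxr => //; apply: measurable_funB => //.
exact: measurable_funM.
Qed.

Lemma measurable_asbool d (T : measurableType d) (A : set T) :
  measurable A -> measurable_fun setT (fun t => asbool (A t)).
Proof.
move=> mA; apply: (measurable_fun_bool true).
rewrite setTI (_ : _ @^-1` _ = A)//.
by apply/seteqP; split => t /=; [move/asboolP|move=> ?; apply/asboolP].
Qed.

Lemma measurable_negative_part_in d (T : measurableType d) (H : set T) (f v : T -> R) (tau : R) :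
  measurable H -> measurable_fun setT f -> measurable_fun setT v ->
  measurable_fun setT
    (fun x => if asbool (H x) then Num.max 0 (v x - tau * f x) else 0).
Proof.
move=> mH mf mv; apply: measurable_fun_ifT => //.
  exact: measurable_asbool.
apply: measurable_maxr => //; apply: measurable_funB => //.
exact: measurable_funM.
Qed.

Lemma measurable_difference (a : E -> R) : measurable_fun setT a ->
  measurable_fun setT (fun p : E * E => a p.1 - a p.2).
Proof.
by move=> ma; apply: measurable_funB;
  [exact: measurable_fst_fun|exact: measurable_snd_fun].
Qed.

Lemma measurable_product (a b : E -> R) : measurable_fun setT a ->
  measurable_fun setT b -> measurable_fun setT (fun p : E * E => a p.1 * b p.2).
Proof.
by move=> ma mb; apply: measurable_funM;
  [exact: measurable_fst_fun|exact: measurable_snd_fun].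
Qed.

Lemma measurable_conv_reflected (Q : E -> E) (k : E -> R) : leb_preserving Q ->
  measurable_fun setT (k : @borel R N -> R) ->
  measurable_fun setT (fun p : E * E => k (p.1 - Q p.2)).
Proof.
move=> [mQ _] mk.
apply: (measurable_fun_pair_coord (f := fun p => p.1 - Q p.2) _ mk) => i.
under eq_fun do rewrite !mxE.
apply: measurable_funB; first exact: measurable_fst_coord.
exact: (measurableT_comp (measurable_coord i) (measurableT_comp mQ measurable_snd)).
Qed.

End measurability.

Section comparison.
Context {R : realType} {N : nat}.
Local Notation E := 'rV[R]_N.+1.
Local Notation borel := (@borel R N).
Local Notation leb2 := (leb \x leb)%E.
Local Notation int1 f := (leb.-integrable [set: E] (EFin \o f)).
Local Notation int2 F := (leb2.-integrable [set: E * E] (EFin \o F)).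

Record half_space_reflection (H : set E) (Q : E -> E) : Prop := {
  side_measurable : measurable H;
  reflection_preserving : leb_preserving Q;
  reflection_involutive : involutive Q;
  reflection_side : forall x, H x -> ~ H (Q x) }.

(** The conditions hold at every point and not merely almost everywhere, so that
    inequalities between increments are pointwise statements. *)
Record antisymmetric_nonneg (H : set E) (Q : E -> E) (v : E -> R) : Prop := {
  antisym_measurable : measurable_fun setT v;
  antisym_ge0 : forall x, H x -> 0 <= v x;
  antisymE : forall x, v (Q x) = - v x;
  antisym_boundary : forall x, ~ H x -> ~ H (Q x) -> v x = 0;
  antisym_square : int1 (fun x => v x ^+ 2) }.

Record finite_energy_on (J : E -> R) (H V : set E) (v : E -> R) : Prop := {
  region_side : V `<=` H;
  region_integrable : int1 (\1_V : E -> R);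
  region_energy : int2 (fun p =>
    \1_V p.1 * \1_V p.2 * (v p.1 - v p.2) ^+ 2 * J (p.1 - p.2)) }.

(** The second differences of the bump [f] are bounded from one side only, so that
    the maximum of a concave quadratic and zero qualifies. The margin [d] is a lower
    bound for the squared distance from a point where [f] is positive to the
    complement of [V]. *)
Record barrier (V : set E) (f : E -> R) (C F0 d : R) : Prop := {
  barrier_measurable : measurable_fun setT (f : borel -> R);
  barrier_bounds : forall x, 0 <= f x <= F0;
  barrier_constant_ge0 : 0 <= C;
  barrier_second_difference :
    forall x z, 2 * f x - f (x + z) - f (x - z) <= C * weight z;
  barrier_difference : forall x y, (f x - f y) ^+ 2 <= C * weight (x - y);
  barrier_margin : 0 < d <= 1;
  barrier_region : forall x y, 0 < f x -> dotv (x - y) (x - y) < d -> V y }.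

Variables (J : E -> R) (H V : set E) (Q : E -> E) (v f : E -> R).
Variables (C F0 d tau : R).
Hypothesis hJ : singular_kernel J.
Hypothesis hQ : half_space_reflection H Q.
Hypothesis hv : antisymmetric_nonneg H Q v.
Hypothesis hV : finite_energy_on J H V v.
Hypothesis hf : barrier V f C F0 d.
Hypothesis tau01 : 0 < tau <= 1.

Let Jm := kernel_measurable hJ.
Let J0 := kernel_ge0 hJ.
Let Jeven := kernelN hJ.
Let wJ := kernel_weight hJ.
Let mH := side_measurable hQ.
Let Qpres := reflection_preserving hQ.
Let QK := reflection_involutive hQ.
Let QH := reflection_side hQ.
Let mv := antisym_measurable hv.
Let vH := antisym_ge0 hv.
Let vQ := antisymE hv.
Let vB := antisym_boundary hv.
Let v2 := antisym_square hv.
Let VH := region_side hV.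
Let iV := region_integrable hV.
Let vV := region_energy hV.
Let mf := barrier_measurable hf.
Let fF0 := barrier_bounds hf.
Let C0 := barrier_constant_ge0 hf.
Let f2 := barrier_second_difference hf.
Let fC := barrier_difference hf.
Let d01 := barrier_margin hf.
Let fV := barrier_region hf.

Implicit Types x y z : E.

(** The test function: the part of [tau * f] above [v]. In [H] it vanishes where
    the bound [tau * f <= v] holds, and only there. *)
Definition truncation (x : E) : R :=
  if 0 < f x then Num.max 0 (tau * f x - v x) else 0.

Definition excess (x : E) : R :=
  if asbool (H x) then Num.max 0 (v x - tau * f x) else 0.

Local Notation phi := truncation.
Local Notation G := excess.

Let fpos x : 0 < f x -> V x.
Proof.
by move=> fx; apply: (fV fx); have /andP[d0 _] := d01; rewrite subrr /dotv big1// => i _; rewrite mxE mul0r.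
Qed.

Let fH x : ~ H x -> f x = 0.
Proof.
move=> nH; apply/eqP; have /andP[f0 _] := fF0 x; rewrite eq_le f0 andbT leNgt.
by apply/negP => /fpos /VH.
Qed.

Let phiH x : H x -> phi x = Num.max 0 (tau * f x - v x).
Proof.
move=> Hx; rewrite /phi; case: ifPn => // /negP fx.
have -> : f x = 0 by apply/eqP; have /andP[f0 _] := fF0 x; rewrite eq_le f0 andbT leNgt; apply/negP.
by rewrite mulr0 sub0r max_l// oppr_le0 vH.
Qed.

Let phiNH x : ~ H x -> phi x = 0.
Proof. by move=> /fH fx; rewrite /phi fx ltxx. Qed.

Let GH x : H x -> G x = Num.max 0 (v x - tau * f x).
Proof. by rewrite /G; case: asboolP. Qed.

Let GNH x : ~ H x -> G x = 0.
Proof. by rewrite /G; case: asboolP. Qed.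

Lemma truncation_ge0 x : 0 <= phi x.
Proof. by rewrite /phi; case: ifP => // _; rewrite le_max lexx. Qed.

Lemma excess_ge0 x : 0 <= G x.
Proof. by rewrite /G; case: asboolP => // _; rewrite le_max lexx. Qed.

Let phi0 := truncation_ge0.
Let G0 := excess_ge0.

Lemma truncation_le x : phi x <= tau * f x.
Proof.
have /andP[f0 _] := fF0 x; have /andP[t0 _] := tau01.
rewrite /phi; case: ifPn => [fx|_]; last by rewrite mulr_ge0// ltW.
rewrite ge_max mulr_ge0 ?(ltW t0)//= lerBlDr lerDl vH//.
exact/VH/fpos.
Qed.

Let phi_le := truncation_le.

Let indV x : 0 <= (\1_V x : R) <= 1.
Proof. by rewrite indicE; case: (x \in V); rewrite lexx ler01. Qed.

Let ind0 x : 0 <= (\1_V x : R).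
Proof. by case/andP: (indV x). Qed.

Let term0 x y : 0 <= (\1_V x * \1_V y * (v x - v y) ^+ 2 : R).
Proof. by rewrite mulr_ge0 ?sqr_ge0// mulr_ge0 ?ind0. Qed.

Let indV1 x : V x -> \1_V x = 1 :> R.
Proof. by rewrite indicE => /mem_set ->. Qed.

Let phipos x : phi x != 0 -> [/\ 0 < f x, V x & H x].
Proof.
rewrite /phi; case: ifPn => [fx _|_]; last by rewrite eqxx.
by have Vx := fpos fx; split => //; exact: VH.
Qed.

Let phiF0 x : phi x <= F0 * \1_V x.
Proof.
have [->|/phipos[fx Vx _]] := eqVneq (phi x) 0.
  by rewrite mulr_ge0//; have := fF0 x; have := indV x; lra.
rewrite indV1// mulr1; have := phi_le x; have := fF0 x; have := tau01; nra.
Qed.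

Let Gv x : G x <= `|v x|.
Proof.
rewrite /G; case: asboolP => // Hx; rewrite ge_max normr_ge0/= ger0_norm ?vH//.
by rewrite gerBl mulr_ge0//; have := tau01; have := fF0 x; lra.
Qed.

(* A single majorant, integrable against [J], for all the products of increments
   whose integrability is needed. *)
Let B x y := \1_V x * \1_V y * (v x - v y) ^+ 2 +
  (\1_V x + \1_V y + v x ^+ 2 + v y ^+ 2) * weight (x - y).

Let B0 x y : 0 <= B x y.
Proof.
have /andP[a0 _] := indV x; have /andP[b0 _] := indV y.
have ? := sqr_ge0 (v x); have ? := sqr_ge0 (v y).
apply: addr_ge0; apply: mulr_ge0; rewrite ?sqr_ge0 ?weight_ge0 ?mulr_ge0//.
by rewrite !addr_ge0.
Qed.

Let dist_sym x y : dotv (y - x) (y - x) = dotv (x - y) (x - y).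
Proof. by rewrite -dotvNN opprB. Qed.

(* The two regimes of a pair of points: close points where [phi] does not
   vanish lie in [V], while distant points see a kernel bounded by the weight. *)
Let far x y : d <= dotv (x - y) (x - y) -> 1 <= d^-1 * weight (x - y).
Proof.
move=> dx; have /andP[d0 d1] := d01.
by rewrite mulrC ler_pdivlMr// mul1r le_min d1.
Qed.

Let near x y : dotv (x - y) (x - y) < d -> phi x != 0 \/ phi y != 0 ->
  V x /\ V y.
Proof.
move=> xy [/phipos[fx Vx _]|/phipos[fy Vy _]]; split => //.
  exact: fV fx xy.
by apply: fV fy _; rewrite dist_sym.
Qed.

Let regimes x y : [\/ phi x = 0 /\ phi y = 0,
   [/\ V x, V y & B x y = (v x - v y) ^+ 2 +
     (2 + v x ^+ 2 + v y ^+ 2) * weight (x - y)] |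
   1 <= d^-1 * weight (x - y)].
Proof.
have [xy|xy] := ltP (dotv (x - y) (x - y)) d; last by apply: Or33; exact: far.
have [px|px] := eqVneq (phi x) 0; have [py|py] := eqVneq (phi y) 0.
- exact: Or31.
- have [Vx Vy] := near xy (or_intror py); apply: Or32.
  by rewrite /B !indV1// !mul1r.
- have [Vx Vy] := near xy (or_introl px); apply: Or32.
  by rewrite /B !indV1// !mul1r.
- have [Vx Vy] := near xy (or_introl px); apply: Or32.
  by rewrite /B !indV1// !mul1r.
Qed.

Let K1 := 2 + 2 * C + F0 ^+ 2 / d.

Let K1_ge0 : 0 <= K1.
Proof.
have d0 : 0 < d by case/andP: d01.
have := divr_ge0 (sqr_ge0 F0) (ltW d0); rewrite /K1; have := C0; lra.
Qed.

Let max_diff (p q : R) : (Num.max 0 p - Num.max 0 q) ^+ 2 <= (p - q) ^+ 2.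
Proof.
rewrite /Num.max; case: ltP => h3; case: ltP => h4; rewrite ?subr0 ?sub0r ?sqrrN.
- by [].
- by nra.
- by nra.
- by rewrite expr0n sqr_ge0.
Qed.

Let sqr_bound (a b c e w t : R) : 0 <= w -> 0 < t <= 1 -> (c - e) ^+ 2 <= C * w ->
  (Num.max 0 (t * c - a) - Num.max 0 (t * e - b)) ^+ 2 <=
  2 * (a - b) ^+ 2 + 2 * (C * w).
Proof.
move=> w0 t01 h.
have h1 : t ^+ 2 * (c - e) ^+ 2 <= C * w.
  case/andP: t01 => t0 t1.
  by apply: le_trans h; rewrite ler_piMl ?sqr_ge0// exprn_ile1// ltW.
have h2 : (Num.max 0 (t * c - a) - Num.max 0 (t * e - b)) ^+ 2 <=
    ((t * c - a) - (t * e - b)) ^+ 2.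
  exact: max_diff.
apply: le_trans h2 _; move: (C * w) h1 => W h1.
have := sqr_ge0 (t * (c - e) + (a - b)); nra.
Qed.

Let far_le (M : R) x y : 0 <= M -> 1 <= d^-1 * weight (x - y) ->
  M * (\1_V x + \1_V y + v x ^+ 2 + v y ^+ 2) <= M / d * B x y.
Proof.
move=> M0 xy; have d0 : 0 < d by case/andP: d01.
have ax := indV x; have ay := indV y.
rewrite -[leRHS]mulrA ler_wpM2l//.
set s := (_ + v y ^+ 2); have s0 : 0 <= s by rewrite !addr_ge0 ?sqr_ge0 ?ind0.
apply: (@le_trans _ _ (s * (d^-1 * weight (x - y)))); first by rewrite ler_peMr.
rewrite mulrCA ler_wpM2l ?invr_ge0 ?(ltW d0)// /B -/s lerDr.
by rewrite term0.
Qed.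

Let phi_sqr x : phi x ^+ 2 <= F0 ^+ 2 * \1_V x.
Proof.
have /andP[a0 a1] := indV x; have px := phiF0 x; have px0 := phi0 x.
apply: (@le_trans _ _ ((F0 * \1_V x) ^+ 2)).
  by rewrite lerXn2r// nnegrE// (le_trans px0).
rewrite exprMn ler_wpM2l ?sqr_ge0// expr2 ler_piMr//.
Qed.

Let prod_bound (s t a b : R) : s ^+ 2 <= a -> t ^+ 2 <= b -> `|s * t| <= a + b.
Proof.
move=> sa tb; have := sqr_ge0 (s + t); have := sqr_ge0 (s - t).
have := sqr_ge0 s; have := sqr_ge0 t.
by rewrite ler_norml => *; apply/andP; split; lra.
Qed.

Let lin_bound (c w b s : R) : 0 <= c -> 0 <= w -> 0 <= s -> s + 2 * w <= b ->
  s + c * w <= (1 + c) * b.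
Proof.
move=> c0 w0 s0 h; have b0 : 0 <= b by lra.
have := ler_wpM2l c0 h; have := mulr_ge0 c0 s0; have := mulr_ge0 c0 w0; lra.
Qed.

Let phi_diff x y : (phi x - phi y) ^+ 2 <= K1 * B x y.
Proof.
have d0 : 0 < d by case/andP: d01.
have FD : 0 <= F0 ^+ 2 / d by rewrite divr_ge0 ?sqr_ge0// ltW.
have [[-> ->]|[Vx Vy BE]|xy] := regimes x y.
- by rewrite subrr expr0n/= mulr_ge0// /K1; have := C0; lra.
- rewrite !phiH; [|exact: VH..].
  apply: le_trans (sqr_bound (v x) (v y) (weight_ge0 (x - y)) tau01 (fC x y)) _.
  have Bw : (v x - v y) ^+ 2 + 2 * weight (x - y) <= B x y.
    rewrite BE lerD2l ler_wpM2r ?weight_ge0//.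
    by have := sqr_ge0 (v x); have := sqr_ge0 (v y); lra.
  have w0 := weight_ge0 (x - y); have s0 := sqr_ge0 (v x - v y).
  apply: (@le_trans _ _ ((2 + 2 * C) * B x y)); last first.
    by rewrite ler_wpM2r// /K1; lra.
  by have := lin_bound C0 w0 s0 Bw; lra.
- have fl := far_le (sqr_ge0 F0) xy.
  have px := phi_sqr x; have py := phi_sqr y.
  have px0 := phi0 x; have py0 := phi0 y.
  apply: (@le_trans _ _ (F0 ^+ 2 / d * B x y)); last first.
    by rewrite ler_wpM2r// /K1; have := C0; lra.
  apply: le_trans fl; have := sqr_ge0 (v x); have := sqr_ge0 (v y).
  have := sqr_ge0 F0; nra.
Qed.

Let v_phi_diff x y :
  `|(v x - v y) * (phi x - phi y)| <= (1 + K1 + 2 / d) * B x y.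
Proof.
have d0 : 0 < d by case/andP: d01.
have D0 : 0 <= 2 / d by rewrite divr_ge0// ltW.
have K0 := K1_ge0.
have pd := phi_diff x y.
have [[-> ->]|[Vx Vy BE]|xy] := regimes x y.
- by rewrite subrr mulr0 normr0 mulr_ge0//; lra.
- have Bv : (v x - v y) ^+ 2 <= B x y.
    rewrite BE lerDl mulr_ge0 ?weight_ge0//.
    by have := sqr_ge0 (v x); have := sqr_ge0 (v y); lra.
  have b0 := B0 x y; apply: (@le_trans _ _ ((1 + K1) * B x y)); last first.
    by rewrite ler_wpM2r//; lra.
  by rewrite [leRHS]mulrDl mul1r prod_bound.
- have fl := far_le (@ler0n R 2) xy.
  apply: (@le_trans _ _ (2 / d * B x y + K1 * B x y)); last first.
    by rewrite -mulrDl ler_wpM2r//; lra.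
  apply: prod_bound pd; apply: le_trans fl.
  have := ind0 x; have := ind0 y; have := sqr_ge0 (v x + v y); lra.
Qed.

Let f_phi_diff x y : `|(f x - f y) * (phi x - phi y)| <= (C + K1) * B x y.
Proof.
have pd := phi_diff x y; have fc := fC x y.
have w0 := weight_ge0 (x - y).
have [pp|pp] := eqVneq (phi x - phi y) 0.
  by rewrite pp mulr0 normr0 mulr_ge0// addr_ge0 ?K1_ge0.
have ax := indV x; have ay := indV y.
have i1 : 1 <= \1_V x + \1_V y :> R.
  have [px|/phipos[_ Vx _]] := eqVneq (phi x) 0; last by rewrite indV1//; lra.
  have [py|/phipos[_ Vy _]] := eqVneq (phi y) 0; last by rewrite [X in _ + X]indV1//; lra.
  by rewrite px py subrr eqxx in pp.
have Bw : weight (x - y) <= B x y.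
  rewrite /B -[leLHS]add0r lerD ?term0//.
  by rewrite ler_peMl//; have := sqr_ge0 (v x); have := sqr_ge0 (v y); lra.
have : C * weight (x - y) <= C * B x y by rewrite ler_wpM2l.
by move=> cb; rewrite [leRHS]mulrDl prod_bound// (le_trans fc).
Qed.

Let phi_G x y : phi x * G y <= (1 + C + (F0 ^+ 2 + 1) / d) * B x y.
Proof.
have d0 : 0 < d by case/andP: d01.
have FD : 0 <= (F0 ^+ 2 + 1) / d by rewrite divr_ge0 ?(ltW d0)// addr_ge0 ?sqr_ge0.
have [[-> _]|[Vx Vy BE]|xy] := regimes x y.
- by rewrite mul0r mulr_ge0//; have := C0; lra.
- rewrite phiH ?GH; [|exact: VH..].
  have Bw : (v x - v y) ^+ 2 + 2 * weight (x - y) <= B x y.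
    rewrite BE lerD2l ler_wpM2r ?weight_ge0//.
    by have := sqr_ge0 (v x); have := sqr_ge0 (v y); lra.
  have w0 := weight_ge0 (x - y); have s0 := sqr_ge0 (v x - v y).
  have h1 : tau ^+ 2 * (f x - f y) ^+ 2 <= C * weight (x - y).
    case/andP: tau01 => t0 t1.
    by apply: le_trans (fC x y); rewrite ler_piMl ?sqr_ge0// exprn_ile1// ltW.
  apply: (@le_trans _ _ ((1 + C) * B x y)); last first.
    by rewrite ler_wpM2r//; lra.
  apply: (@le_trans _ _ ((v x - v y) ^+ 2 + C * weight (x - y))); last first.
    exact: lin_bound.
  have C1 := C0; rewrite /Num.max; case: ltP => h3; case: ltP => h4.
  - have : 0 <= (tau * f x - v x - (v y - tau * f y)) ^+ 2 by exact: sqr_ge0.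
    have : 0 <= (tau * (f x - f y) + (v x - v y)) ^+ 2 by exact: sqr_ge0.
    move: (C * weight _) h1 => Cw h1; nra.
  - rewrite mulr0 addr_ge0// mulr_ge0//.
  - by rewrite mul0r addr_ge0// mulr_ge0.
  - by rewrite mul0r addr_ge0// mulr_ge0.
- have F1 : 0 <= F0 ^+ 2 + 1 by rewrite addr_ge0 ?sqr_ge0.
  have fl := far_le F1 xy.
  apply: (@le_trans _ _ ((F0 ^+ 2 + 1) / d * B x y)); last first.
    by rewrite ler_wpM2r//; have := C0; lra.
  apply: le_trans fl; have px := phi_sqr x; have px0 := phi0 x.
  have gy := Gv y; have gy0 := G0 y.
  have gv : G y ^+ 2 <= v y ^+ 2.
    by rewrite -[leRHS]real_normK ?num_real// lerXn2r ?nnegrE.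
  have ax := indV x; have ay := indV y.
  have := sqr_ge0 (v x); have := sqr_ge0 F0.
  have : 0 <= (phi x - G y) ^+ 2 by exact: sqr_ge0.
  nra.
Qed.

Let phi_GQ x y : phi x * G (Q y) <= (F0 ^+ 2 + 1) / d * B x y.
Proof.
have d0 : 0 < d by case/andP: d01.
have F1 : 0 <= F0 ^+ 2 + 1 by rewrite addr_ge0 ?sqr_ge0.
have FD : 0 <= (F0 ^+ 2 + 1) / d by rewrite divr_ge0 ?(ltW d0).
have [HQ|nHQ] := pselect (H (Q y)); last by rewrite (GNH nHQ) mulr0 mulr_ge0.
have nHy : ~ H y by have := QH HQ; rewrite QK.
have [[-> _]|[_ /VH //]|xy] := regimes x y.
  by rewrite mul0r mulr_ge0 ?B0.
apply: le_trans (far_le F1 xy); have px := phi_sqr x; have px0 := phi0 x.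
have gy := Gv (Q y); have gy0 := G0 (Q y); rewrite vQ normrN in gy.
have gv : G (Q y) ^+ 2 <= v y ^+ 2.
  by rewrite -[leRHS]real_normK ?num_real// lerXn2r ?nnegrE.
have ax := indV x; have ay := indV y.
have := sqr_ge0 (v x); have := sqr_ge0 F0.
have : 0 <= (phi x - G (Q y)) ^+ 2 by exact: sqr_ge0.
nra.
Qed.

Let phi_fQ x y : phi x * f (Q y) <= F0 / d * (phi x * weight (x - y)).
Proof.
have d0 : 0 < d by case/andP: d01.
have FD : 0 <= F0 / d by rewrite divr_ge0 ?(ltW d0)//; have := fF0 x; lra.
have rhs0 : 0 <= F0 / d * (phi x * weight (x - y)).
  by rewrite mulr_ge0// mulr_ge0 ?weight_ge0 ?phi0.
have [HQ|/fH ->] := pselect (H (Q y)); last by rewrite mulr0.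
have nHy : ~ H y by have := QH HQ; rewrite QK.
have [[-> _]|[_ /VH //]|xy] := regimes x y; first by rewrite !mul0r mulr0.
rewrite mulrCA ler_wpM2l// -mulrA (@le_trans _ _ F0)//; first by case/andP: (fF0 (Q y)).
by rewrite ler_peMr//; have := fF0 x; lra.
Qed.

(** The comparison of increments that drives the proof. On [H] the excess of
    [v] over [tau * f] lowers the right-hand side, and across [H] antisymmetry
    returns at most the same excess at the reflected point. *)
Let increment x y : phi x * (v x - v y) <= phi x * ((phi y - phi x) +
  tau * (f x - f y) - G y + G (Q y) + tau * f (Q y)).
Proof.
have [->|px] := eqVneq (phi x) 0; first by rewrite !mul0r.
have [fx Vx Hx] := phipos px; rewrite ler_wpM2l//.
have px0 : 0 < phi x by rewrite lt_def px phi0.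
have t0 : 0 < tau by case/andP: tau01.
have E1 : v x = tau * f x - phi x.
  by move: px0; rewrite phiH// /Num.max; case: ifP => _ p0; lra.
have [Hy|nHy] := pselect (H y).
  rewrite (GNH (QH Hy)) (fH (QH Hy)) mulr0 !addr0 E1 (phiH Hy) GH//.
  rewrite mulrBr; move: (tau * f y) (tau * f x) => a b.
  by rewrite /Num.max; case: ifPn; rewrite -?leNgt => h1; case: ifPn; rewrite -?leNgt => h2; lra.
rewrite (phiNH nHy) (fH nHy) (GNH nHy) E1.
have := G0 (Q y); have /andP[fq _] := fF0 (Q y); have := mulr_ge0 (ltW t0) fq.
have [HQ|nHQ] := pselect (H (Q y)).
  have := GH HQ; rewrite vQ /Num.max.
  by case: ifPn; rewrite -?leNgt => h1 h2 h3 h4; lra.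
have vy := vB nHy nHQ.
by rewrite vy (GNH nHQ) (fH nHQ); lra.
Qed.

Let mf' : measurable_fun setT f. Proof. exact: measurable_borel_fun. Qed.

Lemma measurable_truncation : measurable_fun setT phi.
Proof. exact: measurable_positive_part_on mf' mv. Qed.

Lemma measurable_excess : measurable_fun setT G.
Proof. exact: measurable_negative_part_in mH mf' mv. Qed.

Let mphi := measurable_truncation.
Let mG := measurable_excess.

Lemma int1_truncation : int1 phi.
Proof.
apply: (int1_le mphi) (int1Z F0 iV) => x.
by rewrite ger0_norm; [exact: phiF0|exact: phi0].
Qed.

Let mJ : measurable_fun setT (fun p : E * E => J (p.1 - p.2)).
Proof. exact: (measurable_conv Jm). Qed.

Let int2_B : int2 (fun p => B p.1 p.2 * J (p.1 - p.2)).
Proof.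
have h (a : E -> R) : int1 a ->
    int2 (fun p => a p.1 * (weight (p.1 - p.2) * J (p.1 - p.2)) +
                   a p.2 * (weight (p.2 - p.1) * J (p.2 - p.1))).
  move=> ia; have [i1 _] := int2_conv ia (measurable_wJ hJ) wJ.
  have [i2 _] := int2_swap i1; exact: int2D i1 i2.
have := int2D vV (int2D (h _ iV) (h _ v2)).
congr integrable; apply/funext => -[x y]; rewrite /= /B; congr EFin.
rewrite -(opprB x y) Jeven weightN; ring.
Qed.

Let int2_dom (X : E * E -> R) (K : R) : measurable_fun setT X ->
  (forall x y, `|X (x, y)| <= K * B x y) ->
  int2 (fun p => X p * J (p.1 - p.2)).
Proof.
move=> mX XB; apply: (int2_le _ _ (int2Z K int2_B)).
  exact: (measurable_funM mX mJ).
by move=> [x y] /=; rewrite normrM (ger0_norm (J0 _)) mulrA ler_wpM2r.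
Qed.

Lemma int2_truncation_energy :
  int2 (fun p => (phi p.1 - phi p.2) * (phi p.1 - phi p.2) * J (p.1 - p.2)).
Proof.
apply: (@int2_dom (fun p => (phi p.1 - phi p.2) * (phi p.1 - phi p.2)) (K1)).
  exact: (measurable_funM (measurable_difference mphi) (measurable_difference mphi)).
by move=> x y; rewrite -expr2 ger0_norm ?sqr_ge0// phi_diff.
Qed.

Lemma int2_truncation_v :
  int2 (fun p => (v p.1 - v p.2) * (phi p.1 - phi p.2) * J (p.1 - p.2)).
Proof.
apply: (@int2_dom (fun p => (v p.1 - v p.2) * (phi p.1 - phi p.2)) (1 + K1 + 2 / d)); last exact: v_phi_diff.
exact: (measurable_funM (measurable_difference mv) (measurable_difference mphi)).
Qed.

Lemma int2_truncation_f :
  int2 (fun p => (f p.1 - f p.2) * (phi p.1 - phi p.2) * J (p.1 - p.2)).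
Proof.
apply: (@int2_dom (fun p => (f p.1 - f p.2) * (phi p.1 - phi p.2)) (C + K1)); last exact: f_phi_diff.
exact: (measurable_funM (measurable_difference mf') (measurable_difference mphi)).
Qed.

Lemma int2_truncation_excess : int2 (fun p => phi p.1 * G p.2 * J (p.1 - p.2)).
Proof.
apply: (@int2_dom (fun p => phi p.1 * G p.2) (1 + C + (F0 ^+ 2 + 1) / d)).
  exact: (measurable_product mphi mG).
by move=> x y; rewrite ger0_norm ?mulr_ge0// phi_G.
Qed.

Let mQ (a : E -> R) : measurable_fun setT a -> measurable_fun setT (a \o Q).
Proof. by move=> ma; exact: (measurableT_comp ma Qpres.1). Qed.

Let int2_phi_GQ : int2 (fun p => phi p.1 * G (Q p.2) * J (p.1 - p.2)).
Proof.
apply: (@int2_dom (fun p => phi p.1 * G (Q p.2)) ((F0 ^+ 2 + 1) / d)).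
  exact: (measurable_product mphi (mQ mG)).
by move=> x y; rewrite ger0_norm ?mulr_ge0// phi_GQ.
Qed.

Let reflected_excess :
  int2 (fun p => phi p.1 * G p.2 * J (p.1 - Q p.2)) /\
  \int[leb2]_p (phi p.1 * G p.2 * J (p.1 - Q p.2)) =
  \int[leb2]_p (phi p.1 * G (Q p.2) * J (p.1 - p.2)).
Proof.
have E1 (p : E * E) : phi p.1 * G (Q (Q p.2)) * J (p.1 - Q p.2) =
    phi p.1 * G p.2 * J (p.1 - Q p.2) by rewrite QK.
have m : measurable_fun setT
    (fun p : E * E => phi p.1 * G (Q (Q p.2)) * J (p.1 - Q p.2)).
  rewrite (funext E1).
  exact: (measurable_funM (measurable_product mphi mG) (measurable_conv_reflected Qpres Jm)).
have [h1 h2] := int2_fiber (fun _ => Qpres) m int2_phi_GQ.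
split; last by rewrite -[RHS]h2; apply: eq_Rintegral => p _; rewrite -E1.
by move: h1; congr integrable; apply/funext => p /=; rewrite -E1.
Qed.

Lemma int2_truncation_excess_reflected :
  int2 (fun p => phi p.1 * G p.2 * J (p.1 - Q p.2)).
Proof. exact: reflected_excess.1. Qed.

Let int_phi_fQ : int2 (fun p => phi p.1 * f (Q p.2) * J (p.1 - p.2)) /\
  \int[leb2]_p (phi p.1 * f (Q p.2) * J (p.1 - p.2)) <=
  F0 / d * (\int[leb]_x phi x * \int[leb]_x (weight x * J x)).
Proof.
have [iw wE] := int2_conv int1_truncation (measurable_wJ hJ) wJ.
have le p : phi p.1 * f (Q p.2) * J (p.1 - p.2) <=
    F0 / d * (phi p.1 * (weight (p.1 - p.2) * J (p.1 - p.2))).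
  by rewrite !mulrA -!(mulrA _ (phi _)) ler_wpM2r// -mulrA phi_fQ.
have i : int2 (fun p => phi p.1 * f (Q p.2) * J (p.1 - p.2)).
  apply: (int2_le _ _ (int2Z (F0 / d) iw)).
    exact: (measurable_funM (measurable_product mphi (mQ mf')) mJ).
  move=> p; rewrite ger0_norm ?le// mulr_ge0// mulr_ge0//.
  by case/andP: (fF0 (Q p.2)).
split => //; rewrite -wE -RintegralZl//; apply: le_Rintegral => //.
exact: int2Z.
Qed.

(** [increment] for [(x, y)] and for [(y, x)], added and integrated. The constant
    in front of [tau * \int phi] does not depend on [tau]; the energy of [phi],
    which appears with the good sign, is dropped. *)
Lemma excess_inequality :
  2^-1 * \int[leb2]_p ((v p.1 - v p.2) * (phi p.1 - phi p.2) * J (p.1 - p.2)) +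
  \int[leb2]_p (phi p.1 * G p.2 * J (p.1 - p.2)) <=
  (C / 2 + F0 / d) * \int[leb]_x (weight x * J x) * tau * \int[leb]_x phi x +
  \int[leb2]_p (phi p.1 * G p.2 * J (p.1 - Q p.2)).
Proof.
have iX := int2_truncation_v; have iY := int2_truncation_f.
have ig := int2_truncation_excess; have ih := int2_phi_GQ.
have [ik kle] := int_phi_fQ.
have Yle := energy_le_of_second_difference hJ C0 mf fF0 f2
  int1_truncation phi0 iY.
rewrite reflected_excess.2.
have [ig' gE] := int2_swap ig; have [ih' hE] := int2_swap ih.
have [ik' kE] := int2_swap ik.
have : \int[leb2]_p ((v p.1 - v p.2) * (phi p.1 - phi p.2) * J (p.1 - p.2) +
    (phi p.1 * G p.2 * J (p.1 - p.2) + phi p.2 * G p.1 * J (p.2 - p.1))) <=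
  \int[leb2]_p (tau * ((f p.1 - f p.2) * (phi p.1 - phi p.2) * J (p.1 - p.2) +
    (phi p.1 * f (Q p.2) * J (p.1 - p.2) + phi p.2 * f (Q p.1) * J (p.2 - p.1))) +
    (phi p.1 * G (Q p.2) * J (p.1 - p.2) + phi p.2 * G (Q p.1) * J (p.2 - p.1))).
  apply: le_Rintegral => //.
  - by apply: int2D iX _; exact: int2D ig ig'.
  - apply: int2D; last exact: int2D ih ih'.
    by apply: int2Z; apply: int2D iY _; exact: int2D ik ik'.
  move=> [x y] _ /=; rewrite -(opprB x y) Jeven -!mulrDl mulrA -!mulrDl.
  rewrite ler_wpM2r//.
  have := increment x y; have := increment y x.
  have := sqr_ge0 (phi x - phi y); lra.
rewrite RintegralD//; [|exact: int2D ig ig'].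
rewrite RintegralD// gE.
rewrite RintegralD//; [|by apply: int2Z; apply: int2D iY _; exact: int2D ik ik'|exact: int2D ih ih'].
rewrite RintegralZl//; [|by apply: int2D iY _; exact: int2D ik ik'].
rewrite RintegralD//; [|exact: int2D ik ik'].
rewrite (RintegralD _ ik)// (RintegralD _ ih)// kE hE.
move: Yle kle; set X := \int[leb2]_p _; set g := \int[leb2]_p _.
set Y := \int[leb2]_p _; set k := \int[leb2]_p _; set h := \int[leb2]_p _.
set P := \int[leb]_x _; set W := \int[leb]_x _.
move: (F0 / d) => M h1 h2 h3.
have t0 : 0 <= tau by case/andP: tau01 => /ltW.
have a1 := ler_wpM2l t0 h1; have a2 := ler_wpM2l t0 h2.
rewrite (_ : _ * W * tau * P = (tau * (C * (P * W))) / 2 + tau * (M * (P * W))).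
  by move: h3 a1 a2; rewrite !mulrDr; lra.
by field.
Qed.

End comparison.

(** * A quadratic bump *)

Section quadratic_bump.
Context {R : realType} {N : nat}.
Local Notation E := 'rV[R]_N.+1.
Local Notation borel := (@borel R N).
Implicit Types x y z : E.

Definition quadratic_bump (x0 : E) (rho2 : R) (x : E) : R :=
  Num.max 0 (rho2 - dotv (x - x0) (x - x0)).

Variables (x0 : E) (rho2 : R).
Hypothesis rho0 : 0 < rho2.

Local Notation f := (quadratic_bump x0 rho2).
Local Notation q x := (dotv (x - x0) (x - x0)).

Let measurable_bump : measurable_fun setT (f : borel -> R).
Proof.
apply: measurable_maxr => //; apply: measurable_funB => //.
apply: (measurableT_comp (f := fun x : borel => dotv x x)).
  exact: measurable_dotvv.
apply: measurable_fun_borel => i; under eq_fun do rewrite !mxE.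
by apply: measurable_funB => //; exact: measurable_borel_coord.
Qed.

Lemma bump_bounds x : 0 <= f x <= rho2.
Proof.
rewrite le_max lexx/= ge_max ltW//= gerBl; exact: dotv_ge0.
Qed.

Lemma bump_gt0 x : 0 < f x -> q x < rho2.
Proof. by rewrite lt_max ltxx/= subr_gt0. Qed.

Let bump_ge x : rho2 - q x <= f x.
Proof. by rewrite le_max lexx orbT. Qed.

Let bumpE x : 0 < f x -> f x = rho2 - q x.
Proof. by move=> /bump_gt0 h; rewrite /quadratic_bump max_r// subr_ge0 ltW. Qed.

Let bump_eq0 x : ~~ (0 < f x) -> f x = 0.
Proof. by rewrite -leNgt => h; apply/eqP; rewrite eq_le h; case/andP: (bump_bounds x). Qed.

Let qD x z : q (x + z) = q x + 2 * dotv z (x - x0) + dotv z z.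
Proof.
have -> : x + z - x0 = (x - x0) + z by rewrite addrAC.
move: (x - x0) => a; rewrite dotvDl !dotvDr (dotvC a z); ring.
Qed.

Let bump_second_difference x z :
  2 * f x - f (x + z) - f (x - z) <= (2 + 2 * rho2) * weight z.
Proof.
have z0 := dotv_ge0 z; have w0 := weight_ge0 z.
have /andP[a0 a1] := bump_bounds x; have /andP[b0 _] := bump_bounds (x + z).
have /andP[c0 _] := bump_bounds (x - z).
have [fx|/bump_eq0 fx] := boolP (0 < f x); last first.
  rewrite fx mulr0; apply: (@le_trans _ _ 0); first lra.
  by rewrite mulr_ge0//; lra.
have b1 := bump_ge (x + z); have c1 := bump_ge (x - z).
have E1 := bumpE fx; rewrite qD in b1; rewrite qD dotvNl dotvNN in c1.
rewrite /weight /Num.min; case: ifP => _; first lra.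
have := mulr_ge0 (ltW rho0) z0; lra.
Qed.

Let C2 : R := 8 * N.+1%:R ^+ 2 * rho2 + 2 + rho2 ^+ 2.

(* In the cross term [t], the two vectors are bounded by [|z|] and by the radius:
   this is the Cauchy inequality with the cruder constant of [dotv_le]. *)
Let bump_difference_wlog x y : 0 < f x -> f y <= f x ->
  (f x - f y) ^+ 2 <= C2 * weight (x - y).
Proof.
move=> fx fyx; set z := y - x.
have -> : weight (x - y) = weight z by rewrite -weightN opprB.
have z0 := dotv_ge0 z; have w0 := weight_ge0 z.
have h0 : 0 <= f x - f y by rewrite subr_ge0.
have /andP[a0 a1] := bump_bounds x; have /andP[b0 _] := bump_bounds y.
have N0 : 0 <= 8 * N.+1%:R ^+ 2 * rho2 by rewrite !mulr_ge0 ?exprn_ge0 ?ler0n// ltW.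
have [z1|z1] := leP 1 (dotv z z).
  rewrite /weight min_l// mulr1 /C2.
  have : (f x - f y) ^+ 2 <= rho2 ^+ 2.
    by rewrite lerXn2r ?nnegrE ?(ltW rho0)//; lra.
  lra.
rewrite /weight min_r ?(ltW z1)//.
have E1 := bumpE fx; set t := dotv z (x - x0).
have b1 : rho2 - (q x + 2 * t + dotv z z) <= f y.
  have -> : y = x + z by rewrite /z addrC subrK.
  by have := bump_ge (x + z); rewrite qD.
have ht : t ^+ 2 <= N.+1%:R ^+ 2 * (dotv z z * rho2).
  rewrite -real_normK ?num_real// (@le_trans _ _ ((N.+1%:R * (enorm z * enorm (x - x0))) ^+ 2))//.
    by rewrite lerXn2r ?nnegrE ?mulr_ge0 ?enorm_ge0 ?ler0n// dotv_le.
  rewrite exprMn exprMn !enorm_sqr ler_wpM2l ?exprn_ge0 ?ler0n// ler_wpM2l//.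
  by rewrite ltW// bump_gt0.
have hd : f x - f y <= 2 * t + dotv z z by lra.
clearbody t z.
have : (f x - f y) ^+ 2 <= (2 * t + dotv z z) ^+ 2.
  by rewrite lerXn2r ?nnegrE// (le_trans h0).
have : (2 * t + dotv z z) ^+ 2 <= 8 * t ^+ 2 + 2 * dotv z z ^+ 2.
  have := sqr_ge0 (2 * t - dotv z z); lra.
have : dotv z z ^+ 2 <= dotv z z by rewrite expr2 ler_piMl// ltW.
have : 0 <= rho2 ^+ 2 * dotv z z by rewrite mulr_ge0 ?sqr_ge0.
rewrite /C2; lra.
Qed.

Let bump_difference x y : (f x - f y) ^+ 2 <= C2 * weight (x - y).
Proof.
have C20 : 0 <= C2 * weight (x - y).
  rewrite mulr_ge0 ?weight_ge0// /C2 !addr_ge0 ?sqr_ge0//.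
  by rewrite !mulr_ge0 ?ler0n// ltW.
have [fx|/bump_eq0 fx] := boolP (0 < f x); have [fy|/bump_eq0 fy] := boolP (0 < f y).
- have [/bump_difference_wlog|/ltW/bump_difference_wlog] := leP (f y) (f x); first exact.
  by move=> /(_ fy); rewrite -weightN opprB -(sqrrN (f y - f x)) opprB.
- by apply: bump_difference_wlog => //; rewrite fy ltW.
- rewrite -sqrrN opprB -(weightN (x - y)) opprB.
  by apply: bump_difference_wlog => //; rewrite fx ltW.
- by rewrite fx fy subrr expr0n.
Qed.

Lemma bump_barrier : barrier [set y | q y < 4 * rho2] f
  (2 + 2 * rho2 + C2) rho2 (Num.min 1 rho2).
Proof.
have C20 : 0 <= C2.
  rewrite /C2 !addr_ge0 ?sqr_ge0//.
  by rewrite !mulr_ge0 ?ler0n// ltW.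
split.
- exact: measurable_bump.
- exact: bump_bounds.
- by have := rho0; lra.
- move=> x z; apply: le_trans (bump_second_difference x z) _.
  by rewrite ler_wpM2r ?weight_ge0//; lra.
- move=> x y; apply: le_trans (bump_difference x y) _.
  by rewrite ler_wpM2r ?weight_ge0//; have := rho0; lra.
- by rewrite lt_min ltr01 rho0 ge_min lexx.
- move=> x y /bump_gt0 qx; rewrite lt_min => /andP[_ xy] /=.
  have -> : y - x0 = (x - x0) - (x - y) by apply/rowP => i; rewrite !mxE; lra.
  move: (x - x0) (x - y) qx xy => a b qx xy.
  have := dotv_ge0 (a + b).
  rewrite !dotvDl !dotvDr !dotvNl !dotvNr (dotvC b a); lra.
Qed.

End quadratic_bump.

(** * Inequalities that hold on almost every fiber *)

Section fiberwise.
Context {R : realType} {N : nat}.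
Local Notation E := 'rV[R]_N.+1.
Local Notation leb2 := (leb \x leb)%E.
Local Notation int1 f := (leb.-integrable [set: E] (EFin \o f)).
Local Notation int2 F := (leb2.-integrable [set: E * E] (EFin \o F)).

Lemma int2_prod (a b : E -> R) : int1 a -> int1 b ->
  int2 (fun p => a p.1 * b p.2) /\
  \int[leb2]_p (a p.1 * b p.2) = \int[leb]_x a x * \int[leb]_x b x.
Proof.
move=> ia ib; have ma := int1_measurable ia; have mb := int1_measurable ib.
have mF : measurable_fun setT (EFin \o (fun p : E * E => a p.1 * b p.2)).
  by apply/measurable_EFinP; exact: measurable_product.
have iF : int2 (fun p => a p.1 * b p.2).
  apply/(integrable12ltyP _ _ mF).
  have /integrableP[_ a_oo] := ia; have /integrableP[mb' b_oo] := ib.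
  rewrite (eq_integral (fun x => `|(a x)%:E| * \int[leb]_y `|(b y)%:E|)%E).
    rewrite ge0_integralZr//; last 2 first.
      exact: (measurableT_comp (@abse_measurable _ setT) (measurable_int _ ia)).
      by apply: integral_ge0.
    apply: lte_mul_pinfty => //; first exact: integral_ge0.
    by rewrite ge0_fin_numE//; exact: integral_ge0.
  move=> x _; rewrite -ge0_integralZl//; last first.
    exact: (measurableT_comp (@abse_measurable _ setT) mb').
  by apply: eq_integral => y _; rewrite /= normrM EFinM.
split => //.
rewrite /Rintegral -[X in fine X](integral12_prod_meas1 iF) -fineM; last 2 first.
  exact: integrable_fin_num. exact: integrable_fin_num.
congr fine.
rewrite -(fineK (integrable_fin_num measurableT ib)) -integralZr//.
apply: eq_integral => x _; rewrite /fubini_F/= fineK; last exact: integrable_fin_num.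
by rewrite -integralZl.
Qed.

Lemma fiber_ge0 (F : E * E -> R) x : measurable_fun setT F ->
  (\forall y \ae leb, 0 <= F (x, y)) ->
  (\int[leb]_y (F (x, y))%:E = \int[leb]_y `|(F (x, y))%:E|)%E.
Proof.
move=> /measurable_EFinP/(measurable_section1 x) mF F0.
apply: ae_eq_integral => //.
  exact: (measurableT_comp (@abse_measurable _ setT) mF).
by apply: filterS F0 => y Fy _; rewrite /= ger0_norm.
Qed.

Lemma int2_ge0 (F : E * E -> R) : int2 F ->
  (forall x, \forall y \ae leb, 0 <= F (x, y)) -> 0 <= \int[leb2]_p F p.
Proof.
move=> iF F0; rewrite /Rintegral -[X in fine X](integral12_prod_meas1 iF).
apply: fine_ge0; apply: integral_ge0 => x _; rewrite /fubini_F/=.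
by rewrite fiber_ge0 ?integral_ge0//; exact: measurable_int2.
Qed.

Lemma int2_le_fiber (F G : E * E -> R) : int2 F -> int2 G ->
  (forall x, \forall y \ae leb, F (x, y) <= G (x, y)) ->
  \int[leb2]_p F p <= \int[leb2]_p G p.
Proof.
move=> iF iG FG; rewrite -subr_ge0 -RintegralB//; apply: int2_ge0.
  exact: int2B.
by move=> x; apply: filterS (FG x) => y; rewrite subr_ge0.
Qed.

Lemma int2_eq0_fiber (F : E * E -> R) : int2 F ->
  (forall x, \forall y \ae leb, 0 <= F (x, y)) -> \int[leb2]_p F p <= 0 ->
  \forall x \ae leb, \forall y \ae leb, F (x, y) = 0.
Proof.
move=> iF F0 F1.
have mF := measurable_int2 iF.
have rE x := fiber_ge0 mF (F0 x).
have i0 : (\int[leb]_x fubini_F leb (EFin \o F) x = 0)%E.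
  rewrite (integral12_prod_meas1 iF) -(fineK (integrable_fin_num measurableT iF)).
  by congr EFin; apply/eqP; rewrite eq_le F1; exact: int2_ge0.
have mFF := measurable_fubini_F iF.
have : ae_eq leb setT (fubini_F leb (EFin \o F)) (cst 0%E).
  apply/(ae_eq_integral_abs leb measurableT mFF); rewrite -[RHS]i0.
  apply: eq_integral => x _; rewrite gee0_abs// /fubini_F/= rE.
  exact: integral_ge0.
apply: filterS => x /(_ I); rewrite /fubini_F/= rE => r0.
have : ae_eq leb setT (fun y => (F (x, y))%:E) (cst 0%E).
  apply/ae_eq_integral_abs => //.
  exact: (measurable_section1 x (measurable_int _ iF)).
by apply: filterS => y /(_ I) /= [].
Qed.

End fiberwise.

(** * Positivity and lower bounds for supersolutions *)

Section positivity.
Context {R : realType} {N : nat}.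
Local Notation E := 'rV[R]_N.+1.
Local Notation borel := (@borel R N).
Local Notation leb2 := (leb \x leb)%E.
Local Notation int1 f := (leb.-integrable [set: E] (EFin \o f)).
Local Notation int2 F := (leb2.-integrable [set: E * E] (EFin \o F)).
Implicit Types x y z : E.

Lemma int1_indic (A : set E) : measurable A -> (leb A < +oo)%E ->
  int1 (\1_A : E -> R) /\ \int[leb]_x (\1_A x : R) = fine (leb A).
Proof.
move=> mA Aoo; split; last by rewrite /Rintegral integral_indic// setIT.
apply/integrableP; split; first by apply/measurable_EFinP; exact: measurable_indic.
under eq_integral do rewrite /= ger0_norm//.
by rewrite integral_indic// setIT.
Qed.

Variables (J : E -> R) (H V : set E) (Q : E -> E) (v f : E -> R).
Variables (C F0 d A0 : R).
Hypothesis hJ : singular_kernel J.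
Hypothesis hQ : half_space_reflection H Q.
Hypothesis hv : antisymmetric_nonneg H Q v.
Hypothesis hV : finite_energy_on J H V v.
Hypothesis hf : barrier V f C F0 d.
Hypothesis Kmono : forall x, H x ->
  \forall y \ae leb, H y -> J (x - Q y) < J (x - y).
Hypothesis A00 : 0 <= A0.

Local Notation phi tau := (truncation v f tau).
Local Notation G tau := (excess H v f tau).

Hypothesis weak : forall tau, 0 < tau <= 1 ->
  - (A0 * tau * \int[leb]_x phi tau x) <=
  2^-1 * \int[leb2]_p ((v p.1 - v p.2) * (phi tau p.1 - phi tau p.2) *
    J (p.1 - p.2)).

Let J0 := kernel_ge0 hJ.
Let wJ := kernel_weight hJ.
Let fF0 := barrier_bounds hf.
Let d01 := barrier_margin hf.
Let fV := barrier_region hf.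
Let VH := region_side hV.
Let mf : measurable_fun setT f.
Proof. exact: (measurable_borel_fun (barrier_measurable hf)). Qed.

Let A := A0 + (C / 2 + F0 / d) * \int[leb]_x (weight x * J x).

Let A_ge0 : 0 <= A.
Proof.
have F00 : 0 <= F0 by have := fF0 0; lra.
have d0 : 0 <= d by case/andP: d01 => /ltW.
have := barrier_constant_ge0 hf => C0; rewrite addr_ge0// mulr_ge0//.
  by rewrite addr_ge0// divr_ge0.
by apply: Rintegral_ge0 => x _; rewrite mulr_ge0 ?weight_ge0.
Qed.

Let P tau (p : E * E) :=
  phi tau p.1 * G tau p.2 * (J (p.1 - p.2) - J (p.1 - Q p.2)).

Let int2_P tau : 0 < tau <= 1 -> int2 (P tau) /\
  \int[leb2]_p P tau p <= A * tau * \int[leb]_x phi tau x.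
Proof.
move=> tau01.
have i1 := int2_truncation_excess hJ hQ hv hV hf tau01.
have i2 := int2_truncation_excess_reflected hJ hQ hv hV hf tau01.
have PE p : P tau p = phi tau p.1 * G tau p.2 * J (p.1 - p.2) -
    phi tau p.1 * G tau p.2 * J (p.1 - Q p.2) by rewrite /P mulrBr.
rewrite (funext PE); split; first exact: int2B.
have := excess_inequality hJ hQ hv hV hf tau01; have := weak tau01.
rewrite RintegralB// /A !mulrDl; lra.
Qed.

Let fposV x : 0 < f x -> V x.
Proof.
move=> fx; apply: (fV fx); rewrite subrr /dotv big1 => [|i _].
  by case/andP: d01.
by rewrite mxE mul0r.
Qed.

Let phi_ge0 tau x : 0 <= phi tau x. Proof. exact: truncation_ge0. Qed.
Let G_ge0 tau y : 0 <= G tau y. Proof. exact: excess_ge0. Qed.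

Let phi_support tau x : phi tau x != 0 -> 0 < f x.
Proof. by rewrite /truncation; case: ifP => //; rewrite eqxx. Qed.

Let GK_ge0 tau x : H x -> \forall y \ae leb,
  0 <= G tau y * (J (x - y) - J (x - Q y)).
Proof.
move=> Hx; apply: filterS (Kmono Hx) => y Ky.
rewrite /excess; case: asboolP => [Hy|]; last by rewrite mul0r.
by rewrite mulr_ge0 ?le_max ?lexx// subr_ge0 ltW// Ky.
Qed.

Let P_ge0 tau x : \forall y \ae leb, 0 <= P tau (x, y).
Proof.
have [px|/phi_support/fposV/VH Hx] := eqVneq (phi tau x) 0.
  by apply: aeW => y; rewrite /P/= px !mul0r.
apply: filterS (GK_ge0 tau Hx) => y h.
by rewrite /P/= -mulrA mulr_ge0.
Qed.

Let int1_f : int1 f.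
Proof.
apply: (int1_le mf) (int1Z F0 (region_integrable hV)) => x.
have /andP[f0 f1] := fF0 x; rewrite ger0_norm// indicE.
have [fx|fx] := ltP 0 (f x); first by rewrite mem_set ?mulr1//; exact: fposV.
by rewrite (le_trans fx)// mulr_ge0// (le_trans f0).
Qed.

Let int_phi_le tau : 0 < tau <= 1 ->
  \int[leb]_x phi tau x <= tau * \int[leb]_x f x.
Proof.
move=> tau01; rewrite -RintegralZl//; apply: le_Rintegral => //.
- exact: (int1_truncation hv hV hf tau01).
- exact: int1Z.
- by move=> x _; exact: (truncation_le hv hV hf tau01).
Qed.

Let Z : set E := [set x | 0 < f x /\ v x = 0].

Let measurable_Z : measurable Z.
Proof.
have mv := antisym_measurable hv.
have -> : Z = f @^-1` `]0, +oo[%classic `&` v @^-1` [set 0].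
  by apply/seteqP; split => x; rewrite /Z/= in_itv/= andbT.
apply: measurableI; rewrite -[X in measurable X]setTI.
  by apply: mf => //; exact: measurable_itv.
by apply: mv => //; exact: measurable_set1.
Qed.

(* On the zero set of [v] the truncation is exactly [tau * f] and the excess
   decreases in [tau]. Hence the integral [r] for the fixed [tau0] is bounded by
   [tau0 / tau] times that for [tau <= tau0], which is of order [tau ^ 2]. *)
Let excess_on_zeros tau0 : 0 < tau0 <= 1 ->
  \forall x \ae leb, \forall y \ae leb, \1_Z x * P tau0 (x, y) = 0.
Proof.
move=> tau01; have /andP[t0 t1] := tau01.
have [iP _] := int2_P tau01.
have iR : int2 (fun p => \1_Z p.1 * P tau0 p).
  apply: int2_le (integrable_norm iP).
    apply: measurable_funM (measurable_int2 iP).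
    have mZ : measurable_fun setT (\1_Z : E -> R) by exact: measurable_indic.
    exact: (measurable_fst_fun mZ).
  move=> p; rewrite normrM ler_piMl// indicE.
  by case: (_ \in _); rewrite ?normr1 ?normr0.
apply: (int2_eq0_fiber iR).
  move=> x; apply: filterS (P_ge0 tau0 x) => y h /=.
  by rewrite mulr_ge0// indicE; case: (_ \in _).
rewrite leNgt; apply/negP; set r := \int[leb2]_p _ => r0.
pose M := A * tau0 * \int[leb]_x f x.
have M0 : 0 <= M.
  rewrite mulr_ge0 ?mulr_ge0 ?A_ge0 ?(ltW t0)//.
  by apply: Rintegral_ge0 => x _; case/andP: (fF0 x).
have rM tau : 0 < tau <= tau0 -> r <= M * tau.
  move=> /andP[s0 s1]; have tau1 : 0 < tau <= 1 by rewrite s0 (le_trans s1).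
  have [iPt Pt] := int2_P tau1.
  have : \int[leb2]_p (tau / tau0 * (\1_Z p.1 * P tau0 p)) <=
      \int[leb2]_p P tau p.
    apply: int2_le_fiber => //; first exact: int2Z.
    move=> x /=; rewrite indicE; have [xZ|xZ] := boolP (x \in Z); last first.
      by apply: filterS (P_ge0 tau x) => y; rewrite mul0r mulr0.
    have {xZ} [fx vx] : Z x by move: xZ; rewrite inE.
    have ph s : 0 < s -> phi s x = s * f x.
      by move=> h; rewrite /truncation fx vx subr0 max_r// mulr_ge0 ?ltW.
    have Hx : H x by exact/VH/fposV.
    apply: filterS (Kmono Hx) => y Ky; rewrite mul1r /P/= !ph//.
    rewrite -!mulrA (mulrA tau0^-1) mulVf ?gt_eqF// mul1r.
    rewrite ler_wpM2l ?(ltW s0)// ler_wpM2l ?(ltW fx)//.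
    rewrite /excess; case: asboolP => Hy; last by rewrite !mul0r.
    rewrite ler_wpM2r ?subr_ge0 ?(ltW (Ky Hy))//.
    have h : v y - tau0 * f y <= v y - tau * f y.
      by rewrite lerD2l lerN2 ler_wpM2r//; case/andP: (fF0 y).
    by rewrite ge_max !le_max lexx/= h orbT.
  rewrite RintegralZl// -/r => h.
  have {}h : tau / tau0 * r <= A * tau * (tau * \int[leb]_x f x).
    apply: (le_trans h); apply: (le_trans Pt).
    by rewrite ler_wpM2l ?int_phi_le// mulr_ge0 ?A_ge0 ?ltW.
  have st : 0 < tau / tau0 by rewrite divr_gt0.
  rewrite -(ler_pM2l st) (le_trans h)// /M le_eqVlt; apply/orP; left; apply/eqP.
  by field; rewrite gt_eqF.
pose t := Num.min tau0 (r / (2 * (M + 1))).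
have t00 : 0 < t by rewrite lt_min t0 divr_gt0//; lra.
have := rM t; rewrite t00 ge_min lexx => /(_ isT).
have : M * t <= M * (r / (2 * (M + 1))) by rewrite ler_wpM2l// ge_min lexx orbT.
have : (M + 1) * (r / (2 * (M + 1))) = r / 2 by field; lra.
have : 0 < r / (2 * (M + 1)) by rewrite divr_gt0//; lra.
move: (r / (2 * _)) => k k0; rewrite mulrDl mul1r; lra.
Qed.

(** If [v] vanishes on a set of positive measure where [f] is positive, then it
    vanishes in all of [H], since a zero of [v] sees, through the strictly positive
    kernel difference, all the mass of [v] in [H]. *)
Lemma ae_positive_of_nonzero : ~ (\forall x \ae leb, H x -> v x = 0) ->
  \forall x \ae leb, 0 < f x -> 0 < v x.
Proof.
move=> vn0; have [Z0|Z0] := pselect (leb.-negligible Z).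
  have nZ : \forall x \ae leb, ~ Z x.
    by apply: negligibleS Z0 => x /= /contrapT.
  apply: filterS nZ => x nZ fx.
  rewrite lt_def (antisym_ge0 hv) ?andbT//; last exact/VH/fposV.
  by apply/eqP => vx; apply: nZ.
exfalso; apply: vn0.
have vn n : \forall y \ae leb, H y -> v y <= n.+1%:R^-1 * f y.
  have n01 : 0 < (n.+1%:R^-1 : R) <= 1 by rewrite invr_gt0 ltr0n/= invf_le1// ler1n.
  have [x [[fx vx] xP]] : exists x, Z x /\
      \forall y \ae leb, \1_Z x * P n.+1%:R^-1 (x, y) = 0.
    apply: contrapT => nx; apply: Z0.
    apply: negligibleS (excess_on_zeros n01) => x Zx /= h.
    by apply: nx; exists x.
  have Hx : H x by exact/VH/fposV.
  apply: filterS2 xP (Kmono Hx) => y; rewrite indicE mem_set// mul1r /P/=.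
  rewrite {1}/truncation fx vx subr0 max_r; last first.
    by rewrite mulr_ge0 ?invr_ge0// ltW.
  move=> h Ky Hy; move: h; rewrite /excess; case: asboolP => // _.
  move=> /eqP; rewrite !mulf_eq0 (gt_eqF fx) invr_eq0 pnatr_eq0/=.
  rewrite subr_eq0 (gt_eqF (Ky Hy)) orbF => /eqP h.
  have : v y - n.+1%:R^-1 * f y <= 0 by rewrite -h le_max lexx orbT.
  by rewrite subr_le0.
apply: filterS (ae_foralln vn) => y h Hy; apply/eqP.
rewrite eq_le (antisym_ge0 hv)// andbT; apply/ler_addgt0Pr => e e0; rewrite add0r.
have F0_0 : 0 <= F0 by have := fF0 0; lra.
have e1 : 0 < e / (F0 + 1) by rewrite divr_gt0//; lra.
have [k hk] := ltr_add_invr e1.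
rewrite add0r in hk; apply: (le_trans (h k Hy)).
have /andP[f0 f1] := fF0 y.
have k0 : 0 <= k.+1%:R^-1 :> R by rewrite invr_ge0.
apply: (@le_trans _ _ (e / (F0 + 1) * (F0 + 1))); last by rewrite divfK// gt_eqF; lra.
by apply: ler_pM => //; [exact: ltW|lra].
Qed.

(* The kernel near the origin, cut at height [n]. As [J] is not integrable, its
   mass can be made as large as wished. *)
Let T n z : R := if dotv z z < d then Num.min (J z) n%:R else 0.

Let T_ge0 n z : 0 <= T n z.
Proof. by rewrite /T; case: ifP => // _; rewrite le_min J0 ler0n. Qed.

Let T_le n z : T n z <= J z.
Proof. by rewrite /T; case: ifP => // _; rewrite ge_min lexx. Qed.

Let T_len n z : T n z <= n%:R.
Proof. by rewrite /T; case: ifP => // _; rewrite ge_min lexx orbT. Qed.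

Let measurable_T n : measurable_fun setT (T n : borel -> R).
Proof.
have mJ := kernel_measurable hJ.
apply: (measurable_fun_ifT (T2 := R)).
- exact: measurable_fun_ltr measurable_dotvv (measurable_cst d).
- by apply: measurable_minr; [exact: mJ|exact: measurable_cst].
- exact: measurable_cst.
Qed.

Let int1_T n : int1 (T n).
Proof.
have [i _] := int1_indic (measurable_box _) (@leb_cube_lty R N 1).
apply: (int1_le (measurable_borel_fun (measurable_T n)) _ (int1Z n%:R i)) => z.
rewrite ger0_norm ?T_ge0//.
have [zd|zd] := ltP (dotv z z) d; last first.
  by rewrite /T ltNge zd/= mulr_ge0// indicE.
rewrite indicE mem_set ?mulr1 ?T_len//; apply/cubeP => i0.
have : `|z 0 i0| < 1.
  rewrite (le_lt_trans (coord_le_enorm z i0))// -(expr_lt1 (n := 2)) ?enorm_ge0//.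
  by rewrite enorm_sqr (lt_le_trans zd)//; case/andP: d01.
by rewrite ltr_norml => /andP[-> /ltW].
Qed.

Let far_kernel z : d <= dotv z z -> J z <= d^-1 * (weight z * J z).
Proof.
move=> dz; have /andP[d0 d1] := d01.
rewrite mulrA ler_peMl// mulrC ler_pdivlMr// mul1r.
by rewrite /weight le_min d1.
Qed.

Let int_T_large (M : R) : (\int[leb]_z (J z)%:E = +oo)%E ->
  exists n, M <= \int[leb]_z T n z.
Proof.
move=> Joo; apply: contrapT => nM.
have {}nM n : \int[leb]_z T n z <= M.
  by rewrite leNgt; apply/negP => h; apply: nM; exists n; exact: ltW.
pose Jn z : R := if dotv z z < d then J z else 0.
have mT n : measurable_fun setT (EFin \o T n).
  by apply/measurable_EFinP; exact: (measurable_borel_fun (measurable_T n)).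
have Jnle : (\int[leb]_z (Jn z)%:E <= M%:E)%E.
  have Tnd z : {homo (fun n => (EFin \o T n) z) : n m / (n <= m)%N >-> (n <= m)%E}.
    move=> n m nm; rewrite /= lee_fin /T; case: ifP => // _.
    by rewrite le_min !ge_min lexx/= ler_nat nm orbT.
  have := cvg_monotone_convergence (mu := leb) measurableT mT
    (fun n z _ => T_ge0 n z) (fun z _ => Tnd z).
  rewrite [X in _ --> X](_ : _ = \int[leb]_z (Jn z)%:E)%E; last first.
    apply: eq_integral => z _; apply: cvg_lim => //=.
    apply: cvg_EFin; first by near=> n.
    apply: cvg_near_cst; exists (Num.bound (J z)) => // n /= zn.
    rewrite /T /Jn; case: ifP => // _; rewrite min_l//.
    apply: (le_trans (ltW (archi_boundP (J0 z)))).
    by rewrite ler_nat.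
  move=> cv; rewrite -(cvg_lim _ cv)//; apply: lime_le.
    by apply/cvg_ex; eexists; exact: cv.
  apply: nearW => n.
  rewrite -[leLHS](fineK (integrable_fin_num measurableT (int1_T n))) lee_fin.
  exact: nM.
have mJ := measurable_borel_fun (kernel_measurable hJ).
have wJ' : int1 (fun z => d^-1 * (weight z * J z)) by exact: int1Z.
have : (\int[leb]_z (J z)%:E < +oo)%E.
  have le z : J z <= Jn z + d^-1 * (weight z * J z).
    rewrite /Jn; have [zd|zd] := ltP (dotv z z) d.
      rewrite lerDl mulr_ge0 ?mulr_ge0 ?weight_ge0// invr_ge0.
      by case/andP: d01 => /ltW.
    by rewrite add0r far_kernel.
  have mJn : measurable_fun setT Jn.
    apply: measurable_borel_fun; apply: (measurable_fun_ifT (T2 := R)).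
    - exact: measurable_fun_ltr measurable_dotvv (measurable_cst d).
    - exact: kernel_measurable hJ.
    - exact: measurable_cst.
  apply: (@le_lt_trans _ _ (\int[leb]_z ((Jn z)%:E + (d^-1 * (weight z * J z))%:E))%E).
    apply: (ge0_le_integral leb measurableT).
    - by move=> z _; rewrite lee_fin.
    - exact/measurable_EFinP.
    - apply: emeasurable_funD; first exact/measurable_EFinP.
      exact: measurable_int wJ'.
    - by move=> z _; rewrite -EFinD lee_fin.
  rewrite (ge0_integralD leb measurableT).
  - by rewrite lte_add_pinfty// ?(le_lt_trans Jnle) ?ltry//; exact: integrable_lty.
  - by move=> z _; rewrite lee_fin /Jn; case: ifP.
  - exact/measurable_EFinP.
  - move=> z _; rewrite lee_fin mulr_ge0 ?mulr_ge0 ?weight_ge0// invr_ge0.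
    by case/andP: d01 => /ltW.
  - exact: measurable_int wJ'.
by rewrite Joo ltxx.
Unshelve. all: by end_near. Qed.

Let small_sublevel (n : nat) : measurable V -> (leb V < +oo)%E ->
  (\forall x \ae leb, V x -> 0 < v x) ->
  exists delta : R, 0 < delta /\
    n%:R * fine (leb (V `&` [set x | v x < delta])) <= 1.
Proof.
move=> mV Voo vpos; have mv := antisym_measurable hv.
pose F k := V `&` [set x | v x < k.+1%:R^-1].
have mF k : measurable (F k).
  apply: measurableI => //; rewrite -[X in measurable X]setTI.
  rewrite (_ : [set x | _] = v @^-1` `]-oo, k.+1%:R^-1[%classic).
    by apply: mv => //; exact: measurable_itv.
  by apply/seteqP; split => x /=; rewrite in_itv.
have F0oo : (leb (F 0%N) < +oo)%E by apply: le_lt_trans Voo; apply: le_leb => x [].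
have mcap : measurable (\bigcap_k F k) by exact: bigcapT_measurable.
have cap0 : leb (\bigcap_k F k) = 0%E.
  apply/(measure_negligible mcap); apply: negligibleS vpos => x Fx /= vx.
  have Vx : V x by have [] := Fx 0%N I.
  have [k hk] := ltr_add_invr (vx Vx); rewrite add0r in hk.
  by have [_ /= /ltW] := Fx k I; rewrite leNgt hk.
have Fdec : {homo F : n m / (n <= m)%N >-> (m <= n)%O}.
  move=> i j ij; apply/subsetPset => x [Vx /= vx]; split => //=.
  by rewrite (lt_le_trans vx)// lef_pV2 ?posrE// ler_nat.
have cv : leb (F k) @[k --> \oo] --> 0%E.
  by rewrite -cap0; exact: (nonincreasing_cvg_mu F0oo mF mcap Fdec).
have n1 : 0 < n.+1%:R^-1 :> R by rewrite invr_gt0.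
have [k hk] : exists k, (leb (F k) < n.+1%:R^-1%:E)%E.
  apply: contrapT => nk; have : (n.+1%:R^-1%:E <= limn (leb \o F))%E.
    apply: lime_ge; first by apply/cvg_ex; eexists; exact: cv.
    by apply: nearW => k; rewrite leNgt; apply/negP => hk; apply: nk; exists k.
  by rewrite (cvg_lim _ cv)// lee_fin leNgt n1.
exists k.+1%:R^-1; split; first by rewrite invr_gt0.
have Ff : leb (F k) \is a fin_num by rewrite ge0_fin_numE ?leb_ge0// (lt_trans hk)// ltry.
have : fine (leb (F k)) <= n.+1%:R^-1 by rewrite -lee_fin fineK// ltW.
have : n%:R <= n.+1%:R :> R by rewrite ler_nat.
rewrite -/(F k) => h1 h2.
apply: (@le_trans _ _ (n.+1%:R * n.+1%:R^-1)); last by rewrite mulfV// pnatr_eq0.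
by rewrite ler_pM// fine_ge0 ?leb_ge0.
Qed.

Let small_mass (t k n delta p a : R) :
  delta / 2 * (p * (t - n - k)) <= a * p -> k + 2 <= t -> n <= 1 ->
  0 <= p -> 0 < delta -> a <= delta / 4 -> p <= 0.
Proof.
move=> h kt n1 p0 delta0 ad; rewrite leNgt; apply/negP => p1.
have h1 : p <= p * (t - n - k) by rewrite ler_peMr//; lra.
have h2 : delta / 2 * p <= delta / 2 * (p * (t - n - k)).
  by rewrite ler_wpM2l// divr_ge0// ltW.
have h3 : a * p <= delta / 4 * p by rewrite ler_wpM2r.
have h4 : 0 < delta * p by rewrite mulr_gt0.
lra.
Qed.

Let small_parameter (delta F B : R) : 0 < delta -> 0 <= F -> 0 <= B ->
  exists tau, [/\ 0 < tau <= 1, tau * F <= delta / 2 & B * tau <= delta / 4].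
Proof.
move=> delta0 F_0 B_0.
pose tau := Num.min 1 (Num.min (delta / (2 * (F + 1))) (delta / (4 * (B + 1)))).
have tau0 : 0 < tau.
  by rewrite !lt_min ltr01/= !divr_gt0//; lra.
exists tau; split.
- by rewrite tau0 ge_min lexx.
- have h : tau <= delta / (2 * (F + 1)) by rewrite !ge_min lexx orbT.
  have e1 : delta / (2 * (F + 1)) * (F + 1) = delta / 2 by field; lra.
  have := ler_wpM2r F_0 h; have : 0 < delta / (2 * (F + 1)) by rewrite divr_gt0//; lra.
  by move: e1; rewrite mulrDr mulr1; lra.
- have h : tau <= delta / (4 * (B + 1)) by rewrite !ge_min lexx !orbT.
  have e1 : (B + 1) * (delta / (4 * (B + 1))) = delta / 4 by field; lra.
  have := ler_wpM2l B_0 h; have : 0 < delta / (4 * (B + 1)) by rewrite divr_gt0//; lra.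
  by move: e1; rewrite mulrDl mul1r; lra.
Qed.

(** Once [v] is positive in [V], it exceeds some [delta] off a set [W] of small
    measure. Since [J] is not integrable at the origin, the integral of the
    kernel difference over the points off [W] near [x] exceeds any constant, while
    the right-hand side of the excess inequality carries the small factor [tau]:
    the truncation has to vanish. *)
Lemma lower_bound_of_positive : measurable V -> (leb V < +oo)%E ->
  (\int[leb]_z (J z)%:E = +oo)%E -> (\forall x \ae leb, V x -> 0 < v x) ->
  exists2 tau : R, 0 < tau & \forall x \ae leb, 0 < f x -> tau * f x <= v x.
Proof.
move=> mV Voo Joo vpos; have /andP[d0 d1] := d01.
have F0_0 : 0 <= F0 by have := fF0 0; lra.
pose wJi := \int[leb]_z (weight z * J z).
have [n hn] := int_T_large (d^-1 * wJi + 2) Joo.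
have [delta [delta0 hdelta]] := small_sublevel n mV Voo vpos.
set W := V `&` _ in hdelta.
have mW : measurable W.
  apply: measurableI => //; rewrite -[X in measurable X]setTI.
  rewrite (_ : [set x | _] = v @^-1` `]-oo, delta[%classic).
    by apply: (antisym_measurable hv) => //; exact: measurable_itv.
  by apply/seteqP; split => x /=; rewrite in_itv.
have Woo : (leb W < +oo)%E by apply: le_lt_trans Voo; apply: le_leb => x [].
have [tau [tau01 tauF tauA]] := small_parameter delta0 F0_0 A_ge0.
have [iP PA] := int2_P tau01.
have iphi := int1_truncation hv hV hf tau01.
have [iW WE] := int1_indic mW Woo.
have [iT TE] := int2_conv iphi (measurable_T n) (int1_T n).
have [iphiW phiWE] := int2_prod iphi (int1Z n%:R iW).
have [ik kE] := int2_conv iphi (measurable_wJ hJ) wJ.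
have mcQ : measurable_fun setT (fun p : E * E =>
    weight (p.1 - Q p.2) * J (p.1 - Q p.2)).
  exact: (measurable_conv_reflected (reflection_preserving hQ) (measurable_wJ hJ)).
have mphi := int1_measurable iphi.
have mkQ : measurable_fun setT (fun p : E * E =>
    phi tau p.1 * (weight (p.1 - Q p.2) * J (p.1 - Q p.2))).
  exact: (measurable_funM (measurable_fst_fun mphi) mcQ).
have [ikQ kQE] := int2_fiber (fun _ => reflection_preserving hQ) mkQ ik.
pose L (p : E * E) := delta / 2 * (phi tau p.1 * T n (p.1 - p.2) -
  phi tau p.1 * (n%:R * \1_W p.2) -
  d^-1 * (phi tau p.1 * (weight (p.1 - Q p.2) * J (p.1 - Q p.2)))).
have iL0 := int2B (int2B iT iphiW) (int2Z d^-1 ikQ).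
have iL : int2 L by exact: (int2Z (delta / 2) iL0).
have LP : \int[leb2]_p L p <= \int[leb2]_p P tau p.
  apply: int2_le_fiber => // x.
  have [px|px] := eqVneq (phi tau x) 0.
    by apply: aeW => y; rewrite /L/P/= px !mul0r mulr0 !subr0 mulr0.
  have fx := phi_support px; have Hx : H x by exact/VH/fposV.
  apply: filterS2 (Kmono Hx) (GK_ge0 tau Hx) => y Ky GK.
  rewrite /L/P/= (mulrCA d^-1) -!mulrBr mulrCA -mulrA ler_wpM2l//.
  set k := weight _ * _.
  have k0 : 0 <= d^-1 * k.
    by rewrite mulr_ge0 ?invr_ge0 ?(ltW d0)// mulr_ge0 ?weight_ge0.
  have delta2 : 0 <= delta / 2 by rewrite divr_ge0// ltW.
  have [Vy|nVy] := pselect (V y); last first.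
    apply: le_trans GK; rewrite pmulr_rle0 ?divr_gt0//.
    have -> : T n (x - y) = 0.
      by rewrite /T; case: ifP => // xy; exfalso; apply: nVy; exact: fV fx xy.
    by rewrite sub0r -opprD oppr_le0 addr_ge0// mulr_ge0// indicE.
  have [vd|vd] := ltP (v y) delta.
    apply: le_trans GK; rewrite pmulr_rle0 ?divr_gt0//.
    rewrite indicE mem_set// mulr1 subr_le0 (le_trans _ k0)// subr_le0.
    exact: T_len.
  have Hy := VH Vy.
  have -> : \1_W y = 0 :> R.
    by rewrite indicE memNset// => -[_ /=]; rewrite ltNge vd.
  rewrite mulr0 subr0.
  have Tk : T n (x - y) - d^-1 * k <= J (x - y) - J (x - Q y).
    rewrite lerB ?T_le// far_kernel// leNgt; apply/negP => xQ.
    by have := VH (fV fx xQ); exact: (reflection_side hQ Hy).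
  have K0 : 0 <= J (x - y) - J (x - Q y) by rewrite subr_ge0 ltW// Ky.
  apply: (le_trans (ler_wpM2l delta2 Tk)); apply: ler_wpM2r => //.
  rewrite /excess; case: asboolP => // _; rewrite le_max; apply/orP; right.
  have /andP[fy0 fy1] := fF0 y.
  have t0 : 0 <= tau by case/andP: tau01 => /ltW.
  have h1 : tau * f y <= delta / 2 by apply: le_trans tauF; rewrite ler_wpM2l.
  rewrite lerBrDr; apply: le_trans vd.
  by rewrite [leRHS](splitr delta) lerD2l.
have int_L : \int[leb2]_p L p = delta / 2 * (\int[leb]_x phi tau x *
    (\int[leb]_z T n z - n%:R * fine (leb W) - d^-1 * wJi)).
  rewrite RintegralZl//; congr (_ * _).
  rewrite (RintegralB measurableT (int2B iT iphiW) (int2Z d^-1 ikQ)).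
  rewrite (RintegralB measurableT iT iphiW) (RintegralZl _ measurableT ikQ).
  rewrite kQE kE TE phiWE (RintegralZl _ measurableT iW) WE /wJi; ring.
have phi_int0 : 0 <= \int[leb]_x phi tau x by exact: Rintegral_ge0.
have phi_int : \int[leb]_x phi tau x = 0.
  apply/eqP; rewrite eq_le phi_int0 andbT.
  move: (le_trans LP PA); rewrite int_L => h.
  exact: small_mass h hn hdelta phi_int0 delta0 tauA.
exists tau; first by case/andP: tau01.
have mphiE : measurable_fun setT (EFin \o phi tau) by exact/measurable_EFinP.
have : ae_eq leb setT (EFin \o phi tau) (cst 0%E).
  apply/(ae_eq_integral_abs leb measurableT mphiE).
  rewrite (eq_integral (EFin \o phi tau)) => [|x _]; last first.
    by rewrite /= ger0_norm.
  rewrite -(fineK (integrable_fin_num measurableT iphi)); congr EFin.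
  exact: phi_int.
apply: filterS => x /(_ I) [] h fx; move: h.
rewrite /truncation fx => h.
have : tau * f x - v x <= 0 by rewrite -h le_max lexx orbT.
by rewrite subr_le0.
Qed.

End positivity.

(** * Replacing the kernel and the function on null sets *)

Section kernel_reduction.
Context {R : realType} {N : nat}.
Local Notation E := 'rV[R]_N.+1.
Local Notation borel := (@borel R N).
Local Notation int1 f := (leb.-integrable [set: E] (EFin \o f)).
Implicit Types x y z : E.

Lemma leb_preserving_subr y : leb_preserving (fun x : E => x - y).
Proof. exact: (leb_preserving_translation (- y)). Qed.

Lemma measurable_of_punctured (J : E -> R) :
  measurable_fun [set z : E | z != 0] J -> measurable_fun setT J.
Proof.
move=> mJ; have m0 : measurable [set (0 : E)] by exact: (measurable_borel_leb (borel_set1 0)).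
have E0 : [set z : E | z != 0] = ~` [set 0].
  by apply/seteqP; split => z /= /eqP.
rewrite (_ : [set: E] = [set 0] `|` [set z | z != 0]); last by rewrite E0 setUv.
apply/measurable_funU => //; first by rewrite E0; exact: measurableC.
split => //; move=> _ B mB.
have [J0|J0] := pselect (B (J 0)).
  by rewrite (_ : _ `&` _ = [set 0])//; apply/seteqP; split => [z []//|_ ->].
by rewrite (_ : _ `&` _ = set0)//; apply/seteqP; split => // z [/= ->].
Qed.

Lemma measurable_unit_ball : measurable (@unit_ball R N).
Proof.
rewrite (_ : unit_ball = (fun z => dotv z z) @^-1` `]-oo, 1[%classic).
  rewrite -[X in measurable X]setTI; apply: (measurable_borel_fun (k := fun z => dotv z z)) => //.
  exact: measurable_dotvv.
apply/seteqP; split => z; rewrite /unit_ball/= in_itv/= -enorm_sqr;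
  by rewrite expr_lt1// enorm_ge0.
Qed.

(** [J (x - y)] is measurable on pairs when [J] is Borel, but need not be so for
    a general [J]. The exceptional set is enlarged by its opposite and by the
    origin to keep the new kernel even and nonnegative. *)
Lemma kernel_modification (J : E -> R) :
  (forall z, z != 0 -> 0 <= J z) -> measurable_fun [set z : E | z != 0] J ->
  (forall z, z != 0 -> J (- z) = J z) -> J1 J ->
  exists J' : E -> R, [/\ singular_kernel J', \forall z \ae leb, J' z = J z &
    (\int[leb]_z (J' z)%:E = +oo)%E].
Proof.
move=> J0 /measurable_of_punctured mJ Jeven [J1w Joo].
have [Z [mZ Z0 ZJ]] := borel_modification_fun mJ.
pose Z' : set E := (Z `|` [set z | Z (- z)]) `|` [set 0].
have mZ' : measurable (Z' : set borel).
  apply: measurableU; last exact: borel_set1.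
  by apply: measurableU => //; exact: borel_opp.
pose J' z : R := if asbool (Z' z) then 0 else J z.
have aeJ : \forall z \ae leb, J' z = J z.
  have nZ : \forall z \ae leb, ~ Z z.
    exists Z; split; [exact: measurable_borel_leb|exact: Z0|].
    by move=> z /= /contrapT.
  have nZo := ae_leb_preserving (leb_preserving_opp) nZ.
  apply: filterS3 nZ nZo (ae_neq 0) => z h1 h2 /eqP h3.
  by rewrite /J'; case: asboolP => // -[[]|].
have J'0 z : 0 <= J' z.
  rewrite /J'; case: asboolP => // nZ; apply: J0; apply/eqP => z0.
  by apply: nZ; right.
have mJ'b : measurable_fun setT (J' : borel -> R).
  by apply: ZJ => // z Zz; left; left.
have mJ' := measurable_borel_fun mJ'b.
have Joo' : (\int[leb]_z (J' z)%:E = +oo)%E.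
  rewrite -Joo; apply: ae_eq_integral => //; [exact/measurable_EFinP..|].
  by apply: filterS aeJ => z -> _.
exists J'; split => //; split => //.
  move=> z; rewrite /J'; have -> : asbool (Z' (- z)) = asbool (Z' z).
    apply: asbool_equiv_eq; rewrite /Z'/= opprK; split => -[[h|h]|h].
    - by left; right.
    - by left; left.
    - by right; rewrite -(opprK z) h oppr0.
    - by left; right.
    - by left; left.
    - by right; rewrite h oppr0.
  case: asboolP => // nZ; apply: Jeven; apply/eqP => z0.
  by apply: nZ; right.
have mw := measurable_borel_fun measurable_weight.
have mub := measurable_unit_ball.
have mwJ : measurable_fun setT (EFin \o (fun z => weight z * J' z)).
  by apply/measurable_EFinP; exact: measurable_funM.
apply/integrableP; split => //.
rewrite (eq_integral (EFin \o (fun z => weight z * J' z))) => [|z _]; last first.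
  by rewrite /= ger0_norm// mulr_ge0// weight_ge0.
rewrite -(setvU unit_ball) ge0_integral_setU//=; last 4 first.
- exact: measurableC.
- by rewrite setvU.
- by move=> z _; rewrite lee_fin mulr_ge0// weight_ge0.
- by apply/disj_setPS => z [].
rewrite [X in (X < _)%E](_ : _ = \int[leb]_(z in ~` unit_ball) (J z)%:E
     + \int[leb]_(z in unit_ball) (enorm z ^+ 2 * J z)%:E)%E//.
have m1 : measurable_fun (~` unit_ball) (fun z => (J z)%:E : \bar R).
  by apply: measurable_funTS; exact/measurable_EFinP.
congr (_ + _)%E.
  apply: ae_eq_integral => //; first exact: measurableC.
  - exact: measurable_funTS.
  - apply: filterS aeJ => z -> /= /negP; rewrite /unit_ball/= -leNgt => z1.
    rewrite /weight min_l ?mul1r// -enorm_sqr.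
    by rewrite expr_ge1 ?enorm_ge0.
apply: ae_eq_integral => //.
- exact: measurable_funTS.
- apply: measurable_funTS; apply/measurable_EFinP; apply: measurable_funM => //.
  under eq_fun do rewrite enorm_sqr.
  apply: (measurable_borel_fun (k := fun z => dotv z z)); exact: measurable_dotvv.
- apply: filterS aeJ => z -> /=; rewrite /unit_ball/= => z1.
  rewrite /weight min_r -?enorm_sqr//.
  by rewrite expr_le1 ?enorm_ge0// ltW.
Qed.

(** The iterated integral needs measurability of [J (x - y)] in [x] only, so the
    two kernels can be exchanged at each fixed [y]. *)
Lemma eq_calJ (J J' u w : E -> R) : measurable_fun setT J ->
  measurable_fun setT J' -> (\forall z \ae leb, J' z = J z) ->
  measurable_fun setT u -> measurable_fun setT w -> calJ J u w = calJ J' u w.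
Proof.
move=> mJ mJ' JJ mu mw; congr (_ * _)%E; apply: eq_integral => y _.
have m (k : E -> R) : measurable_fun setT k ->
    measurable_fun setT (fun x => ((u x - u y) * (w x - w y) * k (x - y))%:E).
  move=> mk; apply/measurable_EFinP; apply: measurable_funM.
    apply: measurable_funM; exact: measurable_funB.
  exact: (measurableT_comp mk (leb_preserving_subr y).1).
apply: ae_eq_integral => //; [exact: m..|].
by apply: filterS (ae_leb_preserving (leb_preserving_subr y) JJ) => x /= -> _.
Qed.

End kernel_reduction.

Section almost_everywhere.
Context {R : realType} {N : nat}.
Local Notation E := 'rV[R]_N.+1.
Local Notation leb2 := (leb \x leb)%E.
Local Notation int1 f := (leb.-integrable [set: E] (EFin \o f)).
Local Notation int2 F := (leb2.-integrable [set: E * E] (EFin \o F)).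
Implicit Types x y z : E.

Lemma int1_ae (f g : E -> R) : measurable_fun setT f ->
  (\forall x \ae leb, f x = g x) -> int1 g -> int1 f.
Proof.
move=> mf fg ig; have mg := int1_measurable ig; have /integrableP[_ goo] := ig.
apply/integrableP; split; first exact/measurable_EFinP.
rewrite [ltLHS](_ : _ = \int[leb]_x `|(g x)%:E|)%E//.
apply: ae_eq_integral => //.
- by apply: (measurableT_comp (@abse_measurable _ setT)); exact/measurable_EFinP.
- by apply: (measurableT_comp (@abse_measurable _ setT)); exact/measurable_EFinP.
- by apply: filterS fg => x /= -> _.
Qed.

Lemma ae_product (P : E -> Prop) : (\forall x \ae leb, P x) ->
  {ae leb2, forall p, P p.1 /\ P p.2}.
Proof.
move=> [A [mA A0 PA]].
exists ((A `*` [set: E]) `|` ([set: E] `*` A)); split.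
- by apply: measurableU; exact: measurableX.
- have n1 : leb2.-negligible (A `*` [set: E]).
    exists (A `*` [set: E]); split; [exact: measurableX| |by []].
    have := @product_measure1E _ _ _ _ _ leb leb A setT mA measurableT.
    by move=> ->; rewrite [X in (X * _)%E]A0 mul0e.
  have n2 : leb2.-negligible ([set: E] `*` A).
    exists ([set: E] `*` A); split; [exact: measurableX| |by []].
    have := @product_measure1E _ _ _ _ _ leb leb setT A measurableT mA.
    by move=> ->; rewrite [X in (_ * X)%E]A0 mule0.
  apply: measure_negligible; last exact: negligibleU.
  by apply: measurableU; exact: measurableX.
- move=> p /= nP; have [p1|p1] := pselect (P p.1); last by left; split => //; exact: PA.
  by right; split => //; apply: PA => p2; exact: nP.
Qed.

Lemma int2_ae (F G : E * E -> R) (P : E -> Prop) :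
  (\forall x \ae leb, P x) -> (forall p, P p.1 -> P p.2 -> F p = G p) ->
  measurable_fun setT F -> int2 G ->
  int2 F /\ \int[leb2]_p F p = \int[leb2]_p G p.
Proof.
move=> /ae_product aeP FG mF iG; have mG := measurable_int2 iG.
have FGae : {ae leb2, forall p, F p = G p}.
  by apply: filterS aeP => p [p1 p2]; exact: FG.
split; last first.
  congr fine; apply: ae_eq_integral => //; [exact/measurable_EFinP..|].
  by apply: filterS FGae => p /= -> _.
have /integrableP[_ goo] := iG.
apply/integrableP; split; first exact/measurable_EFinP.
rewrite [ltLHS](_ : _ = \int[leb2]_p `|(G p)%:E|)%E//.
apply: ae_eq_integral => //.
- by apply: (measurableT_comp (@abse_measurable _ setT)); exact/measurable_EFinP.
- by apply: (measurableT_comp (@abse_measurable _ setT)); exact/measurable_EFinP.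
- by apply: filterS FGae => p /= -> _.
Qed.

(** The new function is read off from the values in [H]; outside [H] and its
    reflection the points are fixed, where antisymmetry forces the value [0]. *)
Lemma antisymmetric_modification (H : set E) (Q : E -> E) (v : E -> R) :
  half_space_reflection H Q -> (forall x, ~ H x -> ~ H (Q x) -> Q x = x) ->
  measurable_fun setT v -> int1 (fun x => v x ^+ 2) ->
  (\forall x \ae leb, v (Q x) = - v x) -> (\forall x \ae leb, H x -> 0 <= v x) ->
  exists v' : E -> R,
    antisymmetric_nonneg H Q v' /\ \forall x \ae leb, v' x = v x.
Proof.
move=> hQ Qfix mv v2 vQ vH.
have QK := reflection_involutive hQ; have QH := reflection_side hQ.
have Qpres := reflection_preserving hQ.
pose v' x := if asbool (H x) then Num.max 0 (v x)
  else if asbool (H (Q x)) then - Num.max 0 (v (Q x)) else 0.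
have v'v : \forall x \ae leb, v' x = v x.
  apply: filterS3 vQ vH (ae_leb_preserving Qpres vH) => x h1 h2 h3.
  rewrite /v'; case: asboolP => [/h2 vx|nHx]; first by rewrite max_r.
  case: asboolP => [/h3 vx|nHQ]; first by rewrite max_r// h1 opprK.
  by move: h1; rewrite Qfix//; lra.
have mH : measurable_fun setT (fun x => asbool (H x)).
  exact: (measurable_asbool (side_measurable hQ)).
have mp : measurable_fun setT (fun x => Num.max 0 (v x)).
  exact: measurable_maxr.
have mv' : measurable_fun setT v'.
  apply: (measurable_fun_ifT mH mp); apply: measurable_fun_ifT; last exact: measurable_cst.
    exact: (measurableT_comp mH Qpres.1).
  apply: measurable_funN; exact: (measurableT_comp mp Qpres.1).
exists v'; split => //; split => //.
- by move=> x Hx; rewrite /v'; case: asboolP => // _; rewrite le_max lexx.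
- move=> x; rewrite /v' QK; case: asboolP => [HQ|nHQ].
    case: asboolP => [Hx|_]; first by case: (QH _ Hx HQ).
    by rewrite opprK.
  by case: asboolP => // _; rewrite oppr0.
- by move=> x nH nHQ; rewrite /v'; do 2 (case: asboolP => // _).
- apply: int1_ae v2; last by apply: filterS v'v => x ->.
  exact: measurable_funX.
Qed.

Lemma L2_square (v : E -> R) : L2 v -> int1 (fun x => v x ^+ 2).
Proof.
move=> [mv voo]; apply/integrableP; split.
  by apply/measurable_EFinP; exact: measurable_funX.
have n2 : (2 : R) != 0 by [].
have := poweR_Lnorm leb (EFin \o v) n2.
rewrite (eq_integral (fun x : E => `|(EFin \o (fun x : E => (v x ^+ 2)%R)) x|%E)) => [|x _]; last first.
  by rewrite /= powR_mulrn// real_normK ?num_real// ger0_norm// sqr_ge0.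
move=> <-; apply: poweR_lty; exact: voo.
Qed.

Lemma Linfty_bound (U : set E) (c : E -> R) : Linfty U c ->
  exists M, 0 <= M /\ \forall x \ae leb, U x -> `|c x| <= M.
Proof.
move=> [_]; rewrite /finite_norm unlock /Lnorm; case: ifPn => [l0 coo|]; last first.
  rewrite -leNgt => l0 _; exists 0; split => //; exists setT; split => //.
  by apply/eqP; rewrite eq_le l0 leb_ge0.
set M := ess_sup _ _ in coo.
have M0 : (0 <= M)%E.
  by apply: (ess_sup_gee l0); apply: nearW => x; exact: abse_ge0.
have Mf : M \is a fin_num by rewrite ge0_fin_numE.
exists (fine M); split; first exact: fine_ge0.
apply: filterS (ess_sup_ge leb (abse \o (EFin \o (c \_ U)))) => x /=.
by rewrite -/M -(fineK Mf) lee_fin => h Ux; move: h; rewrite patchT// inE.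
Qed.

End almost_everywhere.

(** * The weak inequality for truncations *)

Section supersolution.
Context {R : realType} {N : nat}.
Local Notation E := 'rV[R]_N.+1.
Local Notation borel := (@borel R N).
Local Notation leb2 := (leb \x leb)%E.
Local Notation int1 f := (leb.-integrable [set: E] (EFin \o f)).
Local Notation int2 F := (leb2.-integrable [set: E * E] (EFin \o F)).
Implicit Types x y z : E.

Lemma calJ_int2 (J u w : E -> R) :
  int2 (fun p => (u p.1 - u p.2) * (w p.1 - w p.2) * J (p.1 - p.2)) ->
  calJ J u w =
  (2^-1 * \int[leb2]_p ((u p.1 - u p.2) * (w p.1 - w p.2) * J (p.1 - p.2)))%:E.
Proof.
move=> i; rewrite EFinM fineK; last exact: (integrable_fin_num measurableT i).
by congr (_ * _)%E; rewrite -(integral21_prod_meas1 i).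
Qed.

Lemma int2_of_calH (J J' v : E -> R) (U' : set E) : measurable_fun setT J ->
  singular_kernel J' -> (\forall z \ae leb, J' z = J z) -> measurable U' ->
  calH J U' v ->
  int2 (fun p => \1_U' p.1 * \1_U' p.2 * (v p.1 - v p.2) ^+ 2 * J' (p.1 - p.2)).
Proof.
move=> mJ hJ JJ mU' [[mv _] voo].
have mJ' := measurable_borel_fun (kernel_measurable hJ).
have m1 : measurable_fun setT (\1_U' : E -> R) by exact: measurable_indic.
have mG : measurable_fun setT (EFin \o (fun p : E * E =>
    \1_U' p.1 * \1_U' p.2 * (v p.1 - v p.2) ^+ 2 * J' (p.1 - p.2))).
  apply/measurable_EFinP; apply: (measurable_funM _ (measurable_conv (kernel_measurable hJ))).
  apply: (measurable_funM (measurable_product m1 m1)).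
  by apply: measurable_funX; exact: measurable_difference.
apply/(integrable21ltyP _ _ mG); apply: le_lt_trans voo.
rewrite le_eqVlt; apply/orP; left; apply/eqP.
rewrite [RHS]integral_mkcond; apply: eq_integral => y _.
rewrite patchE; case: ifPn => yU; last first.
  rewrite (eq_integral (cst 0%E)) ?integral0// => x _ /=.
  by rewrite [\1_U' y]indicE (negbTE yU) mulr0 !mul0r normr0.
have mk (k : E -> R) : measurable_fun setT k ->
    measurable_fun setT (fun x => (v x - v y) ^+ 2 * k (x - y)).
  move=> mk; apply: measurable_funM; last exact: (measurableT_comp mk (leb_preserving_subr y).1).
  by apply: measurable_funX; exact: measurable_funB.
rewrite [RHS]integral_mkcond; apply: ae_eq_integral => //.
- apply: (measurableT_comp (@abse_measurable _ setT)).
  exact: (measurable_section2 y mG).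
- apply/(measurable_restrictT _ mU'); apply: measurable_funTS.
  by apply/measurable_EFinP; exact: mk.
- apply: filterS (ae_leb_preserving (leb_preserving_subr y) JJ) => x /= JE _.
  rewrite patchE [\1_U' y]indicE yU mulr1 indicE; case: ifPn => xU.
    by rewrite mul1r JE ger0_norm// mulr_ge0 ?sqr_ge0// -JE; exact: kernel_ge0 hJ _.
  by rewrite !mul0r normr0.
Qed.

Variables (J J' : E -> R) (H U U' : set E) (Q : E -> E) (c v v' : E -> R).
Variable M : R.
Hypothesis mJ : measurable_fun setT J.
Hypothesis hJ : singular_kernel J'.
Hypothesis JJ : \forall z \ae leb, J' z = J z.
Hypothesis hv : antisymmetric_nonneg H Q v'.
Hypothesis vv : \forall x \ae leb, v' x = v x.
Hypothesis mv : measurable_fun setT v.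
Hypothesis UH : U `<=` H.
Hypothesis mU : measurable U.
Hypothesis mU' : measurable U'.
Hypothesis UU' : U `<=` U'.
Hypothesis vU' : calH J U' v.
Hypothesis mc : measurable_fun U c.
Hypothesis M0 : 0 <= M.
Hypothesis cM : \forall x \ae leb, U x -> `|c x| <= M.
Hypothesis super : forall phi : E -> R, calD J U phi ->
  (\forall x \ae leb, 0 <= phi x) ->
  (\int[leb]_(x in U) (c x * v x * phi x)%:E <= calJ J v phi)%E.

Let mJ' : measurable_fun setT J'.
Proof. exact: (measurable_borel_fun (kernel_measurable hJ)). Qed.

Let mv' := antisym_measurable hv.

Lemma finite_energy_region (V : set E) : measurable V -> (leb V < +oo)%E ->
  V `<=` U -> finite_energy_on J' H V v'.
Proof.
move=> mV Voo VU; have [iV _] := int1_indic mV Voo.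
have m1 : measurable_fun setT (\1_V : E -> R) by exact: measurable_indic.
have mE (w : E -> R) : measurable_fun setT w -> measurable_fun setT (fun p : E * E =>
    \1_V p.1 * \1_V p.2 * (w p.1 - w p.2) ^+ 2 * J' (p.1 - p.2)).
  move=> mw; apply: (measurable_funM _ (measurable_conv (kernel_measurable hJ))).
  apply: (measurable_funM (measurable_product m1 m1)).
  by apply: measurable_funX; exact: measurable_difference.
split=> //; first exact: subset_trans UH.
have [] // := int2_ae (G := fun p => \1_V p.1 * \1_V p.2 *
  (v p.1 - v p.2) ^+ 2 * J' (p.1 - p.2)) vv _ (mE _ mv').
  by move=> p /= -> ->.
apply: int2_le (mE _ mv) _ (int2_of_calH mJ hJ JJ mU' vU') => p.
have le x : (\1_V x : R) <= \1_U' x.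
  rewrite !indicE ler_nat; case: (boolP (x \in V)) => //.
  by rewrite inE => Vx; rewrite mem_set//; apply/UU'/VU.
rewrite ger0_norm.
  apply: (ler_wpM2r (kernel_ge0 hJ _)); apply: (ler_wpM2r (sqr_ge0 _)).
  by rewrite ler_pM ?le// indicE ler0n.
apply: (mulr_ge0 _ (kernel_ge0 hJ _)); apply: (mulr_ge0 _ (sqr_ge0 _)).
by rewrite mulr_ge0// indicE ler0n.
Qed.

Section truncation.
Variables (V : set E) (f : E -> R) (C F0 d tau : R).
Hypothesis VU : V `<=` U.
Hypothesis hV : finite_energy_on J' H V v'.
Hypothesis hf : barrier V f C F0 d.
Hypothesis tau01 : 0 < tau <= 1.

Local Notation phi := (truncation v' f tau).

Let mf : measurable_fun setT f.
Proof. exact: (measurable_borel_fun (barrier_measurable hf)). Qed.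

Let mphi : measurable_fun setT phi.
Proof. exact: (measurable_truncation tau hv hf). Qed.

Let phi_neq0 x : phi x != 0 -> V x /\ 0 <= v' x <= tau * F0.
Proof.
rewrite /truncation; case: ifPn => [fx|]; last by rewrite eqxx.
have /andP[t0 _] := tau01; have /andP[_ f1] := barrier_bounds hf x.
have Vx : V x.
  apply: (barrier_region hf fx); rewrite subrr /dotv big1 => [|i _].
    by case/andP: (barrier_margin hf).
  by rewrite mxE mul0r.
move=> p0; split => //; rewrite (antisym_ge0 hv)/=; last exact/UH/VU.
rewrite leNgt; apply: contra p0 => vx; apply/eqP/max_l; rewrite subr_le0.
by apply: le_trans (ltW vx); rewrite ler_wpM2l// ltW.
Qed.

Let potential_bound x : `|v' x * phi x| <= tau * F0 * phi x.
Proof.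
have [->|/phi_neq0[_ /andP[v0 v1]]] := eqVneq (phi x) 0; first by rewrite !mulr0 normr0.
have p0 := truncation_ge0 v' f tau x.
by rewrite ger0_norm ?mulr_ge0// ler_wpM2r.
Qed.

Let calD_truncation : calD J U phi.
Proof.
split => //.
  rewrite (eq_calJ mJ mJ' JJ mphi mphi) calJ_int2 ?ltry//.
  exact: int2_truncation_energy hJ hv hV hf tau01.
apply: aeW => x nU; apply/eqP; apply/negPn/negP => /phi_neq0[/VU//].
Qed.

Let int_potential :
  ((- (M * F0 * tau * \int[leb]_x phi x)%R)%:E <=
  \int[leb]_(x in U) (c x * v x * phi x)%:E)%E.
Proof.
have iphi := int1_truncation hv hV hf tau01.
have mcv : measurable_fun U (fun x => (c x * v x * phi x)%:E).
  apply/measurable_EFinP; apply: measurable_funM; last exact: measurable_funTS.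
  by apply: measurable_funM => //; exact: measurable_funTS.
have F0_0 : 0 <= F0 by have := barrier_bounds hf 0; lra.
have t0 : 0 <= tau by case/andP: tau01 => /ltW.
have K0 : 0 <= M * F0 * tau by rewrite !mulr_ge0.
have Kphi x : 0 <= M * F0 * tau * phi x.
  exact: (mulr_ge0 K0 (truncation_ge0 v' f tau x)).
have iK := int1Z (M * F0 * tau) iphi.
have : (`|\int[leb]_(x in U) (c x * v x * phi x)%:E| <=
    (M * F0 * tau * \int[leb]_x phi x)%:E)%E.
  apply: (le_trans (le_abse_integral leb mU mcv)).
  apply: (@le_trans _ _ (\int[leb]_(x in U) (M * F0 * tau * phi x)%:E)%E).
    apply: ae_ge0_le_integral => //.
    - exact: (measurableT_comp (@abse_measurable _ setT) mcv).
    - by move=> x _; rewrite lee_fin.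
    - by apply: measurable_funTS; exact: measurable_int iK.
    - apply: filterS2 cM vv => x cx vx Ux; rewrite lee_fin -vx -mulrA normrM.
      rewrite -mulrA -[leRHS]mulrA ler_pM ?cx//.
      by have := potential_bound x; lra.
  apply: (@le_trans _ _ (\int[leb]_x (M * F0 * tau * phi x)%:E)%E).
    apply: ge0_subset_integral => //; first exact: measurable_int iK.
    by move=> x _; rewrite lee_fin.
  rewrite -(RintegralZl _ measurableT iphi) fineK//.
  exact: (integrable_fin_num measurableT iK).
set I := (\int[leb]_(x in U) _)%E.
by case: I => [r| |] //=; rewrite ?leey// !lee_fin ler_norml => /andP[].
Qed.

(** Where the truncation is positive, [v'] is at most [tau * F0]: this gives the
    factor [tau] in the bound for the potential term. *)
Lemma truncation_supersolution :
  - (M * F0 * tau * \int[leb]_x phi x) <=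
  2^-1 * \int[leb2]_p ((v' p.1 - v' p.2) * (phi p.1 - phi p.2) * J' (p.1 - p.2)).
Proof.
have iv' := int2_truncation_v hJ hv hV hf tau01.
have mX (w : E -> R) : measurable_fun setT w -> measurable_fun setT (fun p : E * E =>
    (w p.1 - w p.2) * (phi p.1 - phi p.2) * J' (p.1 - p.2)).
  move=> mw; apply: (measurable_funM _ (measurable_conv (kernel_measurable hJ))).
  exact: (measurable_funM (measurable_difference mw) (measurable_difference mphi)).
have [iv vE] : int2 (fun p : E * E =>
      (v p.1 - v p.2) * (phi p.1 - phi p.2) * J' (p.1 - p.2)) /\
    \int[leb2]_p ((v p.1 - v p.2) * (phi p.1 - phi p.2) * J' (p.1 - p.2)) =
    \int[leb2]_p ((v' p.1 - v' p.2) * (phi p.1 - phi p.2) * J' (p.1 - p.2)).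
  by apply: int2_ae vv _ (mX _ mv) iv' => p /= -> ->.
rewrite -lee_fin -vE -(calJ_int2 iv) -(eq_calJ mJ mJ' JJ mv mphi).
apply: (le_trans int_potential); apply: super; first exact: calD_truncation.
by apply: aeW => x; exact: truncation_ge0.
Qed.

End truncation.

End supersolution.

(** * Local bounds and compact sets *)

Section local_bound.
Context {R : realType} {N : nat}.
Local Notation E := 'rV[R]_N.+1.
Local Notation leb2 := (leb \x leb)%E.
Implicit Types x y z : E.

Lemma measurable_euclidean_ball (x0 : E) (a : R) : 0 < a ->
  measurable [set y | dotv (y - x0) (y - x0) < a].
Proof.
move=> a0; have mf := measurable_borel_fun (barrier_measurable (bump_barrier x0 a0)).
rewrite (_ : mkset _ = quadratic_bump x0 a @^-1` `]0, +oo[%classic).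
  by rewrite -[X in measurable X]setTI; apply: mf => //; exact: measurable_itv.
apply/seteqP; split => y /=; rewrite in_itv/= andbT; last exact: bump_gt0.
by move=> h; rewrite lt_max subr_gt0 h orbT.
Qed.

Lemma leb_bounded_lty (U : set E) : bounded_set U -> (leb U < +oo)%E.
Proof.
move=> [r [_ hr]]; pose n := Num.bound (Num.max r 0 + 1).
have UM x : U x -> `|x| <= Num.max r 0 + 1.
  apply: hr; rewrite -[ltLHS]addr0; apply: ler_ltD => //.
  by rewrite le_max lexx.
apply: (@le_lt_trans _ _ (leb (@cube R N n))); last exact: leb_cube_lty.
apply: le_leb => x /UM xM; apply/cubeP => i.
have : `|x 0 i| < n%:R.
  apply: (@le_lt_trans _ _ `|x|); last first.
    apply: (le_lt_trans xM); apply: archi_boundP.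
    by rewrite addr_ge0// le_max lexx orbT.
  rewrite [leRHS]mx_normrE; exact: (le_bigmax 0 (fun j : 'I_1 * 'I_N.+1 => `|x j.1 j.2|) (0, i)).
by rewrite ltr_norml => /andP[-> /ltW].
Qed.

Variables (J : E -> R) (H U : set E) (Q : E -> E) (v : E -> R) (M : R).
Hypothesis hJ : singular_kernel J.
Hypothesis hQ : half_space_reflection H Q.
Hypothesis hv : antisymmetric_nonneg H Q v.
Hypothesis Kmono : forall x, H x ->
  \forall y \ae leb, H y -> J (x - Q y) < J (x - y).
Hypothesis Joo : (\int[leb]_z (J z)%:E = +oo)%E.
Hypothesis Uoo : (leb U < +oo)%E.
Hypothesis energy : forall V : set E, measurable V -> (leb V < +oo)%E ->
  V `<=` U -> finite_energy_on J H V v.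
Hypothesis M0 : 0 <= M.
Hypothesis super : forall (V : set E) (f : E -> R) (C F0 d tau : R),
  V `<=` U -> finite_energy_on J H V v -> barrier V f C F0 d -> 0 < tau <= 1 ->
  - (M * F0 * tau * \int[leb]_x truncation v f tau x) <=
  2^-1 * \int[leb2]_p ((v p.1 - v p.2) *
    (truncation v f tau p.1 - truncation v f tau p.2) * J (p.1 - p.2)).

(** Two concentric bumps are needed: the first shows that [v] is positive in
    its support, which is then the region where the second one is used. *)
Lemma local_lower_bound (x0 : E) (r : R) : 0 < r -> ball x0 r `<=` U ->
  ~ (\forall x \ae leb, H x -> v x = 0) ->
  exists s eps : R, [/\ 0 < s, 0 < eps &
    \forall x \ae leb, ball x0 s x -> eps <= v x].
Proof.
move=> r0 rU vn0; pose rho2 := r ^+ 2 / 4.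
have rho0 : 0 < rho2 by rewrite divr_gt0// exprn_gt0.
pose q y := dotv (y - x0) (y - x0).
pose V1 : set E := [set y | q y < 4 * rho2].
pose V2 : set E := [set y | q y < 4 * (rho2 / 4)].
have rho40 : 0 < rho2 / 4 by rewrite divr_gt0.
have V1U : V1 `<=` U.
  move=> y yV; apply: rU; apply: enorm_lt_ball.
  rewrite -(ltr_pXn2r (n := 2)) ?nnegrE ?enorm_ge0 ?(ltW r0)// enorm_sqr.
  rewrite -opprB dotvNN; move: yV; rewrite /V1/= /q /rho2; lra.
have V2U : V2 `<=` U.
  by move=> y; rewrite /V2/= => h; apply: V1U; rewrite /V1/=; lra.
have mV1 : measurable V1 by apply: measurable_euclidean_ball; rewrite mulr_gt0.
have mV2 : measurable V2 by apply: measurable_euclidean_ball; rewrite mulr_gt0.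
have V1oo : (leb V1 < +oo)%E by apply: le_lt_trans Uoo; exact: le_leb.
have V2oo : (leb V2 < +oo)%E by apply: le_lt_trans Uoo; exact: le_leb.
have e1 := energy mV1 V1oo V1U; have e2 := energy mV2 V2oo V2U.
have b1 := bump_barrier x0 rho0; have b2 := bump_barrier x0 rho40.
have M1 : 0 <= M * rho2 by rewrite mulr_ge0// ltW.
have M2 : 0 <= M * (rho2 / 4) by rewrite mulr_ge0// ltW.
have w1 tau := @super _ _ _ _ _ tau V1U e1 b1.
have w2 tau := @super _ _ _ _ _ tau V2U e2 b2.
have pos := ae_positive_of_nonzero hJ hQ hv e1 b1 Kmono M1 w1 vn0.
have vpos : \forall x \ae leb, V2 x -> 0 < v x.
  apply: filterS pos => x vx V2x; apply: vx.
  by rewrite lt_max subr_gt0; apply/orP; right; move: V2x; rewrite /V2/= /q; lra.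
have [tau tau0 low] :=
  lower_bound_of_positive hJ hQ hv e2 b2 Kmono M2 w2 mV2 V2oo Joo vpos.
pose s := Num.sqrt (rho2 / 8 / N.+1%:R).
have s2 : N.+1%:R * s ^+ 2 = rho2 / 8.
  have n0 : (0 : R) < N.+1%:R by rewrite ltr0n.
  rewrite sqr_sqrtr; first by rewrite mulrC divfK// gt_eqF.
  exact: (divr_ge0 (divr_ge0 (ltW rho0) (ler0n _ _)) (ltW n0)).
exists s, (tau * (rho2 / 8)); split.
- by rewrite sqrtr_gt0; exact: (divr_gt0 (divr_gt0 rho0 (ltr0n _ 8)) (ltr0n _ N.+1)).
- by rewrite mulr_gt0// divr_gt0.
apply: filterS low => x hx xs.
have qx : q x <= rho2 / 8 by rewrite -s2 /q -dotvNN opprB; exact: dotv_lt_ball.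
have fx : rho2 / 8 <= quadratic_bump x0 (rho2 / 4) x.
  rewrite le_max; apply/orP; right; move: qx; rewrite /q; lra.
have f0 : 0 < quadratic_bump x0 (rho2 / 4) x.
  by apply: lt_le_trans fx; rewrite divr_gt0.
by apply: le_trans (hx f0); rewrite ler_wpM2l// ltW.
Qed.

End local_bound.

Section compact_sets.
Context {R : realType} {N : nat}.
Local Notation E := 'rV[R]_N.+1.
Implicit Types x y z : E.

Lemma ess_inf_on_gt0 (v : E -> R) (K U : set E) : compact K -> K `<=` U ->
  (forall x, U x -> exists s eps : R, [/\ 0 < s, 0 < eps &
    \forall y \ae leb, ball x s y -> eps <= v y]) ->
  (0 < ess_inf_on K v)%E.
Proof.
move=> cK KU loc.
pose P x (se : R * R) := U x -> [/\ 0 < se.1, 0 < se.2 &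
  \forall y \ae leb, ball x se.1 y -> se.2 <= v y].
have [se hse] : {se : E -> R * R & forall x, P x (se x)}.
  apply: (@choice _ _ P) => x; have [Ux|nUx] := pselect (U x).
    by have [s [eps h]] := loc x Ux; exists (s, eps).
  by exists (0, 0).
pose B x := (ball x (se x).1)°.
have cover_list (s : seq E) : (forall x, x \in s -> U x) ->
    exists2 eps : R, 0 < eps &
      \forall y \ae leb, (exists2 x, x \in s & B x y) -> eps <= v y.
  elim: s => [|x s IH] sU.
    by exists 1 => //; apply: aeW => y [].
  have [eps eps0 h] := IH (fun y ys => sU y (mem_behead (s := x :: s) ys)).
  have [_ e0 hx] := hse x (sU x (mem_head _ _)).
  exists (Num.min eps (se x).2); first by rewrite lt_min eps0.
  apply: filterS2 h hx => y h1 h2 [z].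
  rewrite inE => /predU1P[-> /interior_subset /h2|zs zy]; first by rewrite ge_min orbC => ->.
  by rewrite ge_min h1//; exists z.
have [D DK KD] : finite_subset_cover K B K.
  move: cK; rewrite compact_cover; apply => [x _|x Kx]; first exact: open_interior.
  have [s0 _ _] := hse x (KU x Kx).
  by exists x => //; apply: nbhsx_ballx.
have [eps eps0 h] := cover_list (finmap.enum_fset D) (fun x xD => KU _ (set_mem (DK x xD))).
apply: (@lt_le_trans _ _ eps%:E); first by rewrite lte_fin.
apply/ess_infP; apply: filterS h => y hy; rewrite /patch; case: ifPn => [yK|_]; last exact: leey.
rewrite lee_fin; apply: hy; have [x xD xy] := KD y (set_mem yK).
by exists x.
Qed.

End compact_sets.

Theorem proposition3p6 (R : realType) (N : nat)
    (e : 'rV[R]_N.+1) (l : R) (he : enorm e = 1)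
    (H : set 'rV[R]_N.+1) (HE : H = half_space e l)
    (Q : 'rV[R]_N.+1 -> 'rV[R]_N.+1) (QE : Q = reflection e l)
    (J : 'rV[R]_N.+1 -> R)
    (J_ge0 : forall z : 'rV[R]_N.+1, z != 0 -> 0 <= J z)
    (J_meas : measurable_fun [set z : 'rV[R]_N.+1 | z != 0] J)
    (J_even : forall z : 'rV[R]_N.+1, z != 0 -> J (- z) = J z)
    (J_J1 : J1 J)
    (J_refl : forall x y : 'rV[R]_N.+1, x != y -> J (Q x - Q y) = J (x - y))
    (J_mono : forall x y : 'rV[R]_N.+1, H x -> H y -> x != y -> J (x - Q y) < J (x - y))
    (U : set 'rV[R]_N.+1)
    (U_sub : U `<=` H) (U_open : open U) (U_bounded : bounded_set U)
    (c : 'rV[R]_N.+1 -> R) (c_Linfty : Linfty U c)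
    (v : 'rV[R]_N.+1 -> R)
    (v_super : antisym_supersolution J H Q U c v)
    (v_ge0 : \forall x \ae leb, H x -> 0 <= v x) :
  (\forall x \ae leb, v x = 0)
  \/ (forall K : set 'rV[R]_N.+1, compact K -> K `<=` U ->
        (0 < ess_inf_on K v)%E).
Proof.
have [v0|vn0] := pselect (\forall x \ae leb, v x = 0); [by left|right].
move=> K cK KU; subst H Q.
set H := half_space e l in J_mono U_sub v_super v_ge0 *.
set Q := reflection e l in J_mono v_super J_refl *.
have hQ : half_space_reflection H Q.
  split.
  - rewrite (_ : H = (fun x => dotv x e) @^-1` `]l, +oo[%classic).
      rewrite -[X in measurable X]setTI.
      apply: (measurable_borel_fun (k := fun x => dotv x e)) => //.
      exact: measurable_dotv.
    by apply/seteqP; split => x /=; rewrite in_itv/= andbT.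
  - exact: leb_preserving_reflection.
  - exact: (reflectionK l he).
  - by move=> x; rewrite /H /half_space/= reflection_dotv//; lra.
have Qfix x : ~ H x -> ~ H (Q x) -> Q x = x.
  rewrite /H /half_space/= reflection_dotv// => h1 h2.
  rewrite /Q /reflection (_ : dotv x e = l) ?subrr ?mulr0 ?scale0r ?subr0//.
  by move/negP: h1; move/negP: h2; rewrite -!leNgt; lra.
have mJ := measurable_of_punctured J_meas.
have [J' [hJ JJ Joo]] := kernel_modification J_ge0 J_meas J_even J_J1.
have [vQ [U' [oU' _ _ cUU' vU']] _ super] := v_super.
have [[mv _] _] := vU'.
have [v' [hv vv]] :=
  antisymmetric_modification hQ Qfix mv (L2_square vU'.1) vQ v_ge0.
have mU := measurable_borel_leb (measurable_open U_open).
have mU' := measurable_borel_leb (measurable_open oU').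
have UU' : U `<=` U' by apply: subset_trans cUU'; exact: subset_closure.
have [M [M0 cM]] := Linfty_bound c_Linfty.
have Kmono x : H x -> \forall y \ae leb, H y -> J' (x - Q y) < J' (x - y).
  move=> Hx; have h1 := ae_leb_preserving (leb_preserving_subl x) JJ.
  have h2 := ae_leb_preserving (reflection_preserving hQ) h1.
  apply: filterS3 h1 h2 (ae_neq x) => y -> -> yx Hy.
  by apply: J_mono => //; rewrite eq_sym.
have v'n0 : ~ (\forall x \ae leb, H x -> v' x = 0).
  move=> v'0; apply: vn0.
  have v'Q0 := ae_leb_preserving (reflection_preserving hQ) v'0.
  apply: filterS3 vv v'0 v'Q0 => x <- h1 h2.
  have [/h1//|nHx] := pselect (H x).
  have [/h2|nHQ] := pselect (H (Q x)); last exact: (antisym_boundary hv).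
  by rewrite (antisymE hv) => /eqP; rewrite oppr_eq0 => /eqP.
have energy := finite_energy_region mJ hJ JJ hv vv mv U_sub mU' UU' vU'.
have weak := truncation_supersolution mJ hJ JJ hv vv mv U_sub mU c_Linfty.1 M0 cM super.
apply: ess_inf_on_gt0 cK KU _ => x Ux.
have [r r0 rU] : exists2 r : R, 0 < r & ball x r `<=` U.
  by move: U_open; rewrite openE => /(_ x Ux); rewrite /interior/= => /nbhs_ballP[r r0 rU]; exists r.
have [s [eps [s0 eps0 low]]] := local_lower_bound hJ hQ hv Kmono Joo
  (leb_bounded_lty U_bounded) energy M0 weak r0 rU v'n0.
exists s, eps; split => //.
by apply: filterS2 low vv => y h <-.
Qed.
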